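(* For each Dirichlet series $f(s)=\sum_{n=1}^\infty a_n n^{-s}$ in $\mathcal{A}(\mathbb{C}_+)$, let $F$ denote the corresponding function on $\mathbb{T}^\infty$ under the Bohr lift, and let $f(it)$ denote the boundary value of $f$ at $it$. Consider the identity $$\lim_{T\to\infty}\frac{1}{\lambda([0,T])}\int_{0}^{T}|f(it)|^2\,d\lambda(t)=\int_{\mathbb{T}^\infty}|F(z)|^2\,d\mu(z).\qquad(\ast)$$ (i) Let $\mu$ be a Borel probability measure on the infinite torus $\mathbb{T}^\infty$. Then there exists a locally finite Borel measure $\lambda$ on $\mathbb{R}$ such that $(\ast)$ holds for all $f\in\mathcal{A}(\mathbb{C}_+)$. (ii) Let $\lambda$ be a locally finite Borel measure on $\mathbb{R}$ such that the limit on the left-hand side of $(\ast)$ exists and is finite for all $f\in\mathcal{A}(\mathbb{C}_+)$. Then there exists a unique Borel probability measure $\mu$ on $\mathbb{T}^\infty$ such that $(\ast)$ holds for all $f\in\mathcal{A}(\mathbb{C}_+)$.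
   Context: $\mathbb{C}_+=\{s\in\mathbb{C}:\operatorname{Re}(s)>0\}$. $\mathbb{T}^\infty=\prod_{j=1}^\infty\mathbb{T}$ is the countably infinite product of unit circles $\mathbb{T}=\{|z|=1\}\subset\mathbb{C}$ with the product topology (a compact metrizable space). Measures are nonnegative. The integral $\int_0^T$ with respect to $\lambda$ is over the closed interval $[0,T]$. The assertion that the limit exists includes that $\lambda([0,T])>0$ for all sufficiently large $T$. $\mathcal{A}(\mathbb{C}_+)$ is the set of Dirichlet series $f(s)=\sum_{n=1}^\infty a_n n^{-s}$ (with $a_n\in\mathbb{C}$) that converge at every point of $\mathbb{C}_+$ and define a uniformly continuous function on $\mathbb{C}_+$. By a known theorem (Aron, Bayart, Gauthier, Maestre, Nestoridis), $\mathcal{A}(\mathbb{C}_+)$ consists exactly of the functions on $\mathbb{C}_+$ that are uniform limits on $\mathbb{C}_+$ of sequences of Dirichlet polynomials $\sum_{n=1}^N a_n n^{-s}$. Each $f\in\mathcal{A}(\mathbb{C}_+)$ extends continuously to the closed half plane $\{\operatorname{Re}(s)\ge 0\}$, and $f(it)$ denotes the value of this extension at $it$. Bohr lift: let $p_j$ be the $j$th prime. The correspondence is $z_j=p_j^{-s}$. For a Dirichlet polynomial $f(s)=\sum_{n=1}^N a_n n^{-s}$, writing $n=p_1^{\alpha_1}\cdots p_d^{\alpha_d}$, the corresponding polynomial is $F(z)=\sum_{n=1}^N a_n z_1^{\alpha_1}\cdots z_d^{\alpha_d}$; thus $f(it)=F(p_1^{-it},p_2^{-it},\dots)$ for $t\in\mathbb{R}$.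 For $f\in\mathcal{A}(\mathbb{C}_+)$, $F$ is the continuous function on $\mathbb{T}^\infty$ which is the uniform limit on $\mathbb{T}^\infty$ of the polynomials $F_m$ corresponding to Dirichlet polynomials $f_m$ converging to $f$ uniformly on $\mathbb{C}_+$ (this is independent of the choice of $(f_m)$, because $\sup_{\mathbb{T}^\infty}|G|=\sup_{\mathbb{C}_+}|g|$ for every Dirichlet polynomial $g$ with corresponding polynomial $G$). *)

(* Defs.v *)
From HB Require Import structures.
From mathcomp Require Import all_boot all_order all_algebra.
From mathcomp Require Import complex.
From mathcomp Require Import all_classical all_reals all_analysis.
Set Implicit Arguments.
Unset Strict Implicit.
Unset Printing Implicit Defensive.
Import Order.TTheory GRing.Theory Num.Theory.
Import numFieldNormedType.Exports.
Local Open Scope classical_set_scope.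
Local Open Scope ring_scope.
Local Open Scope complex_scope.

(* The cast makes the norm topology of a numFieldType available on R[i]. *)
Notation cplx R := (R[i] : numClosedFieldType).

Definition right_half_plane (R : realType) : set (cplx R) :=
  [set s | 0 < complex.Re s].
Arguments right_half_plane : clear implicits.

Definition cexp (R : realType) (z : cplx R) : cplx R :=
  (expR (complex.Re z))%:C * (cos (complex.Im z) +i* sin (complex.Im z)).

(* n^{-s} = exp(- s ln n); only meaningful for n >= 1. *)
Definition npow_opp (R : realType) (n : nat) (s : cplx R) : cplx R :=
  cexp (- s * (ln (n%:R : R))%:C).

Definition dirichlet_poly (R : realType) (N : nat) (a : nat -> cplx R)
    (s : cplx R) : cplx R :=
  \sum_(1 <= n < N.+1) a n * npow_opp n s.

Definition dirichlet_series (R : realType) (a : nat -> cplx R) (s : cplx R)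
    : cplx R :=
  limn (fun N => dirichlet_poly N a s).

(* The coefficient a 0 plays no role. *)
Definition dirichlet_algebra (R : realType) : set (nat -> cplx R) :=
  [set a | (forall s, right_half_plane R s ->
              cvgn (fun N => dirichlet_poly N a s)) /\
           unif_continuous (fun s : right_half_plane R =>
              dirichlet_series a (\val s))].

(* The value at it of the continuous extension of f to Re s >= 0. *)
Definition boundary_value (R : realType) (a : nat -> cplx R) (t : R)
    : cplx R :=
  lim (dirichlet_series a @
         within (right_half_plane R) (nbhs (0 +i* t : cplx R))).

Definition itorus (R : realType) : Type :=
  {ptws nat -> [set z : cplx R | `|z| = 1]}.

HB.instance Definition _ (R : realType) := Uniform.on (itorus R).

Lemma circle1 (R : realType) : (1 : cplx R) \in [set z : cplx R | `|z| = 1].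
Proof. by rewrite inE /= normr1. Qed.

HB.instance Definition _ (R : realType) :=
  isPointed.Build (itorus R) (fun=> SigSub (circle1 R)).

Definition borel_itorus (R : realType) :=
  g_sigma_algebraType (@open (itorus R)).

(* The primes in increasing order are p_0 < p_1 < ..., so that p = p_j exactly
   when j primes are smaller than p. *)
Definition prime_index (p : nat) : nat := count prime (iota 0 p).

Definition bohr_poly (R : realType) (N : nat) (a : nat -> cplx R)
    (z : itorus R) : cplx R :=
  \sum_(1 <= n < N.+1)
    a n * \prod_(p <- primes n) (\val (z (prime_index p))) ^+ logn p n.

Definition is_bohr_lift (R : realType) (a : nat -> cplx R)
    (F : itorus R -> cplx R) : Prop :=
  exists (N : nat -> nat) (b : nat -> nat -> cplx R),
    {uniform right_half_plane R,
      (fun m => dirichlet_poly (N m) (b m)) @ \oo --> dirichlet_series a} /\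
    {uniform, (fun m => bohr_poly (N m) (b m)) @ \oo --> F}.

(* Two lifts of the same series coincide, so xget selects the lift; every series
   in dirichlet_algebra has one, and the default value is never used there. *)
Definition bohr_lift (R : realType) (a : nat -> cplx R) : itorus R -> cplx R :=
  xget (fun=> 0) [set F | is_bohr_lift a F].

Definition locally_finite (R : realType)
    (lambda : {measure set R -> \bar R}) : Prop :=
  forall x : R, exists U : set R,
    [/\ nbhs x U, measurable U & (lambda U < +oo)%E].

(* For locally finite lambda, lambda `[0, T] is finite and fine loses nothing. *)
Definition mean_square (R : realType) (lambda : {measure set R -> \bar R})
    (a : nat -> cplx R) (T : R) : \bar R :=
  (((fine (lambda `[0%R, T]%classic))^-1)%:E *
   \int[lambda]_(t in `[0%R, T]%classic)
     (ComplexField.Normc.normc (boundary_value a t) ^+ 2)%:E)%E.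

Definition mean_square_cvg (R : realType) (lambda : {measure set R -> \bar R})
    (a : nat -> cplx R) (l : \bar R) : Prop :=
  (\forall T \near +oo, (0 < lambda `[0%R, T]%classic)%E) /\
  mean_square lambda a T @[T --> +oo] --> l.

Definition mean_identity (R : realType) (lambda : {measure set R -> \bar R})
    (mu : probability (borel_itorus R) R) (a : nat -> cplx R) : Prop :=
  mean_square_cvg lambda a
    (\int[mu]_z (ComplexField.Normc.normc (bohr_lift a z) ^+ 2)%:E)%E.

(* Main.v *)
(* On the imaginary axis [f(it) = F(flow t)] with [flow t = (p_j^{-it})_j], so [mean_identity] asks
   that the images of lambda under the flow equidistribute towards mu, tested on the [|F|^2].

   (i) By Kronecker's theorem and compactness there are finite-valued measurable maps
   [theta_n : itorus -> (tau_n, tau_{n+1}]] such that [flow (theta_n z)] tends to [z].  The sum of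
   the images of mu under the [theta_n] works, by dominated convergence and Cesaro's lemma.

   (ii) The flow means of lambda over [0, T] have a limit along an ultrafilter which is a mean on
   the bounded Borel functions; the Riesz representation of this mean is mu, and the assumed
   convergence along T replaces the ultrafilter by +oo.  For uniqueness, take
   [f = n^{-s} + conj(c) m^{-s}]: then [|F|^2 = 1 + |c|^2 + 2 Re (c (mono n) conj(mono m))], and
   suitable trigonometric polynomials converge boundedly to indicators of cylinders.

   That [dirichlet_algebra] consists of uniform limits of Dirichlet polynomials is proved by
   averaging [f] over small vertical translations, which multiplies the coefficients by gaussian
   weights in [ln n] and makes the series converge absolutely. *)
Require Import Defs.
From HB Require Import structures.
From mathcomp Require Import all_boot all_order all_algebra.
From mathcomp Require Import complex.
From mathcomp Require Import all_classical all_reals all_analysis.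
From mathcomp Require Import measurable_realfun.
From mathcomp Require Import ring lra zify.
Set Implicit Arguments.
Unset Strict Implicit.
Unset Printing Implicit Defensive.
Import Order.TTheory GRing.Theory Num.Theory.
Import numFieldNormedType.Exports.
Local Open Scope classical_set_scope.
Local Open Scope ring_scope.
Local Open Scope complex_scope.

(** In (ii) the hypothesis speaks of the functions [|F|^2] only, not of all continuous functions.
    The ultrafilter avoids a density argument: it first yields some limit for every bounded Borel
    function, and the hypothesis is used afterwards on the [|F|^2] alone. The price is that the
    resulting mean is only finitely additive. So [mu] is rebuilt from the values on closed sets, by
    inner and then outer approximation, and compactness supplies countable subadditivity. What
    survives is [L (\1_K) <= mu K] for closed [K]; applied to [g] and to [1 - g], this one
    inequality settles continuous [g].

    Polynomial spikes stand in for Stone-Weierstrass twice: in the density of the flow, and in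
    recovering cylinders from trigonometric polynomials.

    In (i) each window [(tau_n, tau_{n+1}]] has mass one and length at least one. The mass makes the
    normalisation count windows, the length gives local finiteness, and the window cut by [T] costs
    only a bounded error.

    Averages of Dirichlet series and the means in Kronecker's theorem run over finitely many points,
    so no complex-valued integral occurs. *)

Notation normc := ComplexField.Normc.normc.
Notation Re := complex.Re.
Notation Im := complex.Im.

(** * Complex numbers *)

Section ComplexNorm.
Variable R : realType.
Implicit Types (x y z : cplx R) (r : R).

Lemma normE z : `|z| = (normc z)%:C.
Proof. by rewrite normc_def; case: z. Qed.

Lemma normc_ge0 z : 0 <= normc z.
Proof. by case: z => a b; rewrite sqrtr_ge0. Qed.

Lemma normcBC x y : normc (x - y) = normc (y - x).
Proof. by rewrite -normcN opprB. Qed.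

Lemma normc_sum I (s : seq I) (P : pred I) (F : I -> cplx R) :
  normc (\sum_(i <- s | P i) F i) <= \sum_(i <- s | P i) normc (F i).
Proof.
elim/big_ind2 : _ => [|u v u' v' h1 h2|//].
  by rewrite ComplexField.Normc.normc0.
by apply: (le_trans (le_normcD _ _)); rewrite lerD.
Qed.

Lemma normcM x y : normc (x * y) = normc x * normc y.
Proof. exact: ComplexField.Normc.normcM. Qed.

Lemma normcX x n : normc (x ^+ n) = normc x ^+ n.
Proof.
elim: n => [|n ih]; first by rewrite !expr0 ComplexField.Normc.normc1.
by rewrite !exprS normcM ih.
Qed.

Lemma normcR r : normc r%:C = `|r|.
Proof. by rewrite /= expr0n/= addr0 sqrtr_sqr. Qed.

Lemma normc0_eq0 z : normc z = 0 -> z = 0.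
Proof. exact: ComplexField.Normc.eq0_normc. Qed.

Lemma normc_trans z x y : normc (x - y) <= normc (x - z) + normc (z - y).
Proof. by rewrite (le_trans _ (le_normcD _ _))// addrA subrK. Qed.

Lemma le_normcB x y : `|normc x - normc y| <= normc (x - y).
Proof.
rewrite ler_norml; apply/andP; split.
  by rewrite lerNl opprB lerBlDr normcBC -{1}(subrK x y) le_normcD.
by rewrite lerBlDr -{1}(subrK y x) le_normcD.
Qed.

Lemma sqr_normc_ReIm z : normc z ^+ 2 = Re z ^+ 2 + Im z ^+ 2.
Proof. by case: z => a b /=; rewrite sqr_sqrtr// addr_ge0// sqr_ge0. Qed.

Lemma normRe_le z : `|Re z| <= normc z.
Proof.
rewrite -(@ler_pXn2r _ 2)// ?nnegrE ?normc_ge0//.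
by rewrite sqr_normc_ReIm real_normK ?num_real// lerDl sqr_ge0.
Qed.

Lemma normIm_le z : `|Im z| <= normc z.
Proof.
rewrite -(@ler_pXn2r _ 2)// ?nnegrE ?normc_ge0//.
by rewrite sqr_normc_ReIm [leLHS]real_normK ?num_real// lerDr sqr_ge0.
Qed.

Lemma normc_le_ReIm z : normc z <= `|Re z| + `|Im z|.
Proof.
rewrite -(@ler_pXn2r _ 2)// ?nnegrE ?normc_ge0 ?addr_ge0//.
rewrite sqr_normc_ReIm sqrrD [X in _ <= X + _ + _]real_normK ?num_real//.
rewrite [X in _ <= _ + X]real_normK ?num_real// lerD2r lerDl.
by rewrite mulrn_wge0// mulr_ge0.
Qed.

Lemma normc_J z : normc (z^*) = normc z.
Proof. by case: z => a b /=; rewrite sqrrN. Qed.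

Lemma mulcJ z : z * z^* = (normc z ^+ 2)%:C.
Proof.
rewrite sqr_normc_ReIm; case: z => a b /=.
by apply/eqP; rewrite eq_complex/=; apply/andP; split; apply/eqP; ring.
Qed.

Lemma ReD x y : Re (x + y) = Re x + Re y. Proof. by case: x; case: y. Qed.
Lemma ImD x y : Im (x + y) = Im x + Im y. Proof. by case: x; case: y. Qed.
Lemma ReN x : Re (- x) = - Re x. Proof. by case: x. Qed.
Lemma ImN x : Im (- x) = - Im x. Proof. by case: x. Qed.
Lemma ReB x y : Re (x - y) = Re x - Re y. Proof. by rewrite ReD ReN. Qed.
Lemma ImB x y : Im (x - y) = Im x - Im y. Proof. by rewrite ImD ImN. Qed.
Lemma Re_mulR r z : Re (r%:C * z) = r * Re z.
Proof. by case: z => a b /=; rewrite mul0r subr0. Qed.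
Lemma Re_mul x y : Re (x * y) = Re x * Re y - Im x * Im y.
Proof. by case: x; case: y. Qed.

(** The order of [R[i]] is partial and its positive elements are the positive reals, so each complex
    radius of the norm topology can be traded for a real one. *)
Lemma gt0_RC (e : cplx R) : 0 < e -> exists2 r, 0 < r & e = r%:C.
Proof.
rewrite ltcE => /andP[/eqP /= h1 h2]; exists (Re e) => //.
by case: e h1 h2 => a b /= ->.
Qed.

Lemma cvgcP (T : Type) (F : set_system T) (FF : Filter F) (f : T -> cplx R)
    (l : cplx R) :
  (f @ F --> l) <-> (forall e, 0 < e -> \forall t \near F, normc (l - f t) < e).
Proof.
split.
  move=> /cvgrPdist_lt h e e0.
  have /h : (0 : cplx R) < e%:C by rewrite ltcR.
  by apply: filterS => t; rewrite normE ltcR.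
move=> h; apply/cvgrPdist_lt => _ /gt0_RC[r r0 ->].
by have := h _ r0; apply: filterS => t; rewrite normE ltcR.
Qed.

Lemma nbhscP z (A : set (cplx R)) :
  nbhs z A <-> exists2 e : R, 0 < e & forall y, normc (z - y) < e -> A y.
Proof.
split.
  move/nbhs_ballP => [_ /= /gt0_RC[r r0 ->] zA]; exists r => // y zy; apply: zA.
  by rewrite /ball/= /ball_/= normE ltcR.
move=> [e e0 eA]; apply/nbhs_ballP; exists e%:C => /=; first by rewrite ltcR.
by move=> y; rewrite /ball/= /ball_/= normE ltcR => /eA.
Qed.

Lemma cplx_continuousP (U : pseudoMetricNormedZmodType R) (f : cplx R -> U) z :
  (forall e, 0 < e -> exists2 d : R, 0 < d &
    forall y, normc (z - y) < d -> `|f z - f y| < e) -> {for z, continuous f}.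
Proof.
move=> h; apply/(@cvgrPdist_lt _ _ _ (nbhs (z : cplx R))) => e /h[d d0 hd].
by apply/nbhscP; exists d.
Qed.

Lemma continuous_normc : continuous (@normc R : cplx R -> R).
Proof.
move=> z; apply: cplx_continuousP => e e0.
by exists e => // y zy; exact: (le_lt_trans (le_normcB _ _)).
Qed.

Lemma continuous_Re : continuous (@complex.Re R : cplx R -> R).
Proof.
move=> z; apply: cplx_continuousP => e e0; exists e => // y; apply: le_lt_trans.
by rewrite -ReB normRe_le.
Qed.

Lemma cvgc_ReIm (T : Type) (F : set_system T) (FF : Filter F) (f : T -> cplx R)
    (l : cplx R) :
  Re (f t) @[t --> F] --> Re l -> Im (f t) @[t --> F] --> Im l -> f @ F --> l.
Proof.
move=> /cvgrPdist_lt fr /cvgrPdist_lt fi; apply/cvgcP => e e0.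
have e20 : 0 < e / 2 by rewrite divr_gt0.
near=> t; apply: (le_lt_trans (normc_le_ReIm _)); rewrite ReB ImB (splitr e).
by rewrite ltrD//; near: t; [exact: fr|exact: fi].
Unshelve. all: by end_near. Qed.

Lemma continuous_conjc : continuous (conjc : cplx R -> cplx R).
Proof.
move=> z; apply/(@cvgcP _ (nbhs (z : cplx R))) => e e0.
by apply/nbhscP; exists e => // y; rewrite -rmorphB normc_J.
Qed.

Lemma hausdorff_cplx : hausdorff_space (cplx R).
Proof. exact: norm_hausdorff. Qed.

End ComplexNorm.

Arguments ComplexField.Normc.normc : simpl never.

(** * The complex exponential on the closed left half plane *)

Section ComplexExp.
Variable R : realType.
Implicit Types (x y z : cplx R) (r t : R).

Lemma cexp0 : cexp (0 : cplx R) = 1.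
Proof. by rewrite /cexp/= expR0 cos0 sin0 mul1r. Qed.

Lemma cexpD x y : cexp (x + y) = cexp x * cexp y.
Proof.
case: x => a b; case: y => c d; rewrite /cexp /= expRD cosD sinD.
by apply/eqP; rewrite eq_complex/=; apply/andP; split; apply/eqP; ring.
Qed.

Lemma cexpMn z n : cexp (z *+ n) = cexp z ^+ n.
Proof.
elim: n => [|n ih]; first by rewrite mulr0n expr0 cexp0.
by rewrite mulrSr cexpD ih exprSr.
Qed.

Lemma normc_cexp z : normc (cexp z) = expR (Re z).
Proof.
rewrite /cexp normcM normcR ger0_norm ?expR_ge0// /normc/=.
by rewrite cos2Dsin2 sqrtr1 mulr1.
Qed.

Lemma conjc_cexp z : (cexp z)^* = cexp z^*.
Proof.
case: z => a b; rewrite /cexp/= cosN sinN.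
by apply/eqP; rewrite eq_complex/=; apply/andP; split; apply/eqP; ring.
Qed.

Lemma sin_le_id t : 0 <= t -> `|sin t| <= t.
Proof.
move=> t0; rewrite le_eqVlt in t0; case/orP : t0 => [/eqP <-|t0].
  by rewrite sin0 normr0.
have sc : {within `[0, t], continuous (@sin R)}.
  by apply: continuous_subspaceT => x; exact: continuous_sin.
have [c _] := @MVT R (@sin R) (@cos R) 0 t t0 (fun (x : R) _ => is_derive_sin x) sc.
 rewrite sin0 !subr0 => ->; rewrite normrM (gtr0_norm t0).
by rewrite ler_piMl ?cos_max// ltW.
Qed.

Lemma normr_sin_le t : `|sin t| <= `|t|.
Proof.
have [t0|t0] := leP 0 t; first by rewrite (ger0_norm t0) sin_le_id.
have t0' : 0 <= - t by rewrite oppr_ge0 ltW.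
by rewrite -(normrN (sin t)) -sinN -(normrN t) (ger0_norm t0') sin_le_id.
Qed.

Lemma cos_subr1_half t : 1 - cos t = 2 * sin (t / 2) ^+ 2.
Proof.
rewrite {1}(_ : t = (t / 2) *+ 2); last by rewrite -mulr_natr divfK.
by rewrite cos_mulr2n cos2sin2; ring.
Qed.

Lemma cos_subr1_le t : 1 - cos t <= t ^+ 2 / 2.
Proof.
rewrite cos_subr1_half.
have : sin (t / 2) ^+ 2 <= (t / 2) ^+ 2.
  rewrite -[leLHS]real_normK ?num_real// -[leRHS]real_normK ?num_real//.
  by rewrite lerXn2r ?nnegrE ?normr_sin_le.
by rewrite expr_div_n; lra.
Qed.

(** A chord is at most its arc: the squared chord is [2 - 2 * cos t]. *)
Lemma normc_cexp_im t : normc (cexp (0 +i* t) - 1) <= `|t|.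
Proof.
rewrite -(@ler_pXn2r _ 2)// ?nnegrE ?normc_ge0//.
rewrite real_normK ?num_real// sqr_normc_ReIm /cexp /= expR0.
have h := cos2Dsin2 t; have h2 := cos_subr1_le t.
rewrite [leLHS](_ : _ = cos t ^+ 2 + sin t ^+ 2 + 1 - 2 * cos t); last by ring.
by rewrite h; lra.
Qed.

Lemma normc_cexpB1 z : Re z <= 0 -> normc (cexp z - 1) <= 2 * normc z.
Proof.
case: z => a b; rewrite [complex.Re _]/= => a0.
have {1}-> : a +i* b = (a +i* 0) + (0 +i* b) :> cplx R.
  by apply/eqP; rewrite eq_complex/= addr0 add0r !eqxx.
rewrite cexpD (_ : _ - 1 = (cexp (a +i* 0)) * (cexp (0 +i* b) - 1) +
  (cexp (a +i* 0) - 1)); last by ring.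
apply: (le_trans (le_normcD _ _)).
rewrite normcM normc_cexp/=.
have -> : cexp (a +i* 0 : cplx R) - 1 = (expR a - 1)%:C.
  rewrite /cexp/= cos0 sin0; apply/eqP; rewrite eq_complex/=.
  by apply/andP; split; apply/eqP; ring.
rewrite normcR.
have ea1 : expR a <= 1 by rewrite expR_le1.
have ea : `|expR a - 1| <= `|a|.
  rewrite ler0_norm ?subr_le0// (ler0_norm a0).
  by have := expR_ge1Dx a; lra.
have e0 := expR_ge0 a.
have hb : expR a * normc (cexp (0 +i* b) - 1) <= `|b|.
  by rewrite (le_trans _ (normc_cexp_im b))// ler_piMl// normc_ge0.
have := normRe_le (a +i* b : cplx R); have := normIm_le (a +i* b : cplx R) => /=.
by lra.
Qed.

(** Factoring out the exponential with the larger real part leaves an exponent in the left half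
    plane, where [normc_cexpB1] applies. *)
Lemma cexp_Lipschitz x y : Re x <= 0 -> Re y <= 0 ->
  normc (cexp x - cexp y) <= 2 * normc (x - y).
Proof.
wlog : x y / Re x <= Re y.
  move=> h x0 y0; have [xy|/ltW yx] := leP (Re x) (Re y); first exact: h.
  by rewrite normcBC (normcBC x); exact: h.
move=> xy x0 y0.
have -> : cexp x - cexp y = cexp y * (cexp (x - y) - 1).
  by rewrite mulrBr -cexpD mulr1 subrKC.
rewrite normcM normc_cexp.
apply: (@le_trans _ _ (1 * normc (cexp (x - y) - 1))).
  by rewrite ler_wpM2r ?normc_ge0// expR_le1.
by rewrite mul1r normc_cexpB1// ReB subr_le0.
Qed.

End ComplexExp.

(** * The infinite torus and the Kronecker flow *)

Lemma prime_indexS n : prime_index n.+1 = (prime_index n + prime n)%N.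
Proof. by rewrite /prime_index -addn1 iotaD count_cat/= add0n addn0. Qed.

Lemma prime_index_le m n : (m <= n)%N -> (prime_index m <= prime_index n)%N.
Proof.
elim: n => [|n ih]; first by rewrite leqn0 => /eqP ->.
rewrite leq_eqVlt => /orP[/eqP ->//|]; rewrite ltnS => /ih h.
by rewrite prime_indexS (leq_trans h)// leq_addr.
Qed.

Lemma prime_index_inj p q : prime p -> prime q ->
  prime_index p = prime_index q -> p = q.
Proof.
move=> pp pq; wlog : p q pp pq / (p <= q)%N.
  move=> h e; have [pq'|/ltnW qp'] := leqP p q; first exact: h.
  exact/esym/h.
rewrite leq_eqVlt => /orP[/eqP//|/prime_index_le].
by rewrite prime_indexS pp addn1 => /[swap] ->; rewrite ltnn.
Qed.

Lemma prime_index_surj j : exists2 p, prime p & prime_index p = j.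
Proof.
have unb : exists n, (j < prime_index n)%N.
  elim: j => [|j [n hn]]; first by exists 3.
  have [p np pp] := prime_above n; exists p.+1.
  by rewrite prime_indexS pp addn1 ltnS (leq_trans hn)// prime_index_le// ltnW.
case: (ex_minnP unb) => -[//|m]; rewrite prime_indexS => h1 h2.
have h3 : (prime_index m <= j)%N.
  by rewrite leqNgt; apply/negP => /h2; rewrite ltnn.
by exists m; move: h1; case: (prime m); lia.
Qed.

(** Inverse of [prime_index] on the primes; by [prime_index_surj] the default 2 is never taken as
    such. *)
Definition nth_prime (j : nat) : nat := xget 2%N [set p | prime p /\ prime_index p = j].

Lemma nth_primeP j : prime (nth_prime j) /\ prime_index (nth_prime j) = j.
Proof.
rewrite /nth_prime; case: xgetP => [p _ //|h].
by have [p pp pj] := prime_index_surj j; exfalso; apply: (h p).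
Qed.

Lemma nth_primeK p : prime p -> nth_prime (prime_index p) = p.
Proof. by move=> pp; have [pn] := nth_primeP (prime_index p); exact: prime_index_inj. Qed.

(** Induction strips the prime [pdiv n]. This identifies the monomials along the flow with [n^{-it}]
    without handling the exponents of a factorisation. *)
Lemma mult_ext (K : comNzRingType) (f g : nat -> K) : f 1%N = g 1%N ->
  (forall m n, (0 < m)%N -> (0 < n)%N -> f (m * n)%N = f m * f n) ->
  (forall m n, (0 < m)%N -> (0 < n)%N -> g (m * n)%N = g m * g n) ->
  (forall p, prime p -> f p = g p) ->
  forall n, (0 < n)%N -> f n = g n.
Proof.
move=> fg1 fM gM fgp n; have [m] := ubnP n; elim: m n => // m ih n nm n0.
have [n1|n1] := eqVneq n 1%N; first by rewrite n1.
have n2 : (1 < n)%N by lia.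
have pn := pdiv_prime n2.
have p0 := prime_gt0 pn; have p1 := prime_gt1 pn.
have d0 : (0 < n %/ pdiv n)%N by rewrite divn_gt0// dvdn_leq// pdiv_dvd.
rewrite -(divnK (pdiv_dvd n)) fM// gM// (fgp _ pn) ih//.
by rewrite (leq_trans _ (_ : n <= m)%N)// ltn_Pdiv.
Qed.

Section Torus.
Variable R : realType.
Local Notation X := (itorus R).
Local Notation circle := [set z : cplx R | `|z| = 1].
Implicit Types (z w : X) (t : R).

Definition tcoord (z : X) (j : nat) : cplx R := \val (z j).

Lemma normc_circle (u : circle) : normc (\val u) = 1.
Proof.
have := set_valP u; by rewrite /= normE => -[].
Qed.

Lemma normc_coord z j : normc (tcoord z j) = 1.
Proof. exact: normc_circle. Qed.

Lemma unit_in (u : cplx R) : normc u = 1 -> u \in circle.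
Proof. by move=> u1; rewrite inE/= normE u1. Qed.

Definition mkunit (u : cplx R) (u1 : normc u = 1) : circle := SigSub (unit_in u1).

Lemma normc_cexpi t : normc (cexp (0 +i* t : cplx R)) = 1.
Proof. by rewrite normc_cexp expR0. Qed.

Definition unit_exp t : circle := mkunit (normc_cexpi t).

Lemma cexp_im_Lipschitz t t' :
  normc (cexp (0 +i* t : cplx R) - cexp (0 +i* t')) <= `|t - t'|.
Proof.
have -> : cexp (0 +i* t : cplx R) - cexp (0 +i* t') =
    cexp (0 +i* t') * (cexp (0 +i* (t - t')) - 1).
  rewrite mulrBr -cexpD mulr1; congr (cexp _ - _).
  by apply/eqP; rewrite eq_complex/= addr0 subrKC !eqxx.
by rewrite normcM normc_cexpi mul1r normc_cexp_im.
Qed.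

(** The circle carries the initial topology of its inclusion, so its neighbourhoods come from open
    sets of the plane. *)
Lemma cvg_circle (F : set_system circle) (u : circle) : Filter F ->
  (forall e, 0 < e -> \forall v \near F, normc (\val u - \val v) < e) -> F --> u.
Proof.
move=> FF h A [B [[W oW <-] Wu] WA].
have /nbhscP[e e0 eW] : nbhs (\val u : cplx R) W by apply: open_nbhs_nbhs.
by apply: filterS (h _ e0) => v /eW /WA.
Qed.

Lemma continuous_unit_exp : continuous unit_exp.
Proof.
move=> t; apply: cvg_circle => e e0.
near=> v; near: v; apply/nbhs_ballP.
exists e => //= s ts; apply: (le_lt_trans (cexp_im_Lipschitz _ _)).
by exact: ts.
Unshelve. all: by end_near. Qed.

Lemma unit_exp_surj (u : cplx R) : normc u = 1 ->
  exists2 t, t \in `[- pi, pi] & cexp (0 +i* t) = u.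
Proof.
move=> u1; have := sqr_normc_ReIm u; rewrite u1 expr1n.
case: u u1 => a b _ /= h.
have a1 : -1 <= a <= 1 by nra.
have sa : Num.sqrt (1 - a ^+ 2) = `|b|.
  by rewrite h addrAC subrr add0r sqrtr_sqr.
have [b0|b0] := leP 0 b.
  exists (acos a).
    by rewrite in_itv/= acos_lepi// andbT (le_trans _ (acos_ge0 a1))// oppr_le0 pi_ge0.
  rewrite /cexp /= expR0 acosK ?in_itv//= sin_acos// sa ger0_norm//.
  by apply/eqP; rewrite eq_complex/=; apply/andP; split; apply/eqP; ring.
exists (- acos a).
  rewrite in_itv/= lerN2 acos_lepi//=.
  by rewrite (le_trans _ (pi_ge0 R))// oppr_le0 acos_ge0.
rewrite /cexp /= expR0 cosN sinN acosK ?in_itv//= sin_acos// sa ltr0_norm//.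
by apply/eqP; rewrite eq_complex/=; apply/andP; split; apply/eqP; ring.
Qed.

Lemma compact_circle : compact [set: circle].
Proof.
have -> : [set: circle] = unit_exp @` `[- pi, pi]%classic.
  apply/seteqP; split => // u _.
  have [t tpi tu] := unit_exp_surj (normc_circle u).
  by exists t => //; apply: val_inj.
apply: continuous_compact; last exact: segment_compact.
by apply: continuous_subspaceT; exact: continuous_unit_exp.
Qed.

Lemma compact_itorus : compact [set: X].
Proof.
have := @tychonoff nat (fun=> (circle : topologicalType)) (fun=> setT) (fun=> compact_circle).
by rewrite (_ : [set f : forall i, circle | forall i, setT (f i)] = setT); [|apply/seteqP; split].
Qed.

Definition box (z : X) (d : nat) (r : R) : set X :=
  [set y | forall j, (j < d)%N -> normc (tcoord z j - tcoord y j) < r].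

Lemma continuous_coord j : continuous (tcoord ^~ j).
Proof.
move=> z; apply: (@continuous_comp _ _ _ (fun y : X => y j) (fun u : circle => \val u)).
  have /(pointwise_cvgP _ _)/(_ j) : {ptws, nbhs z --> z} by move=> A.
exact.
exact: (@initial_continuous circle (cplx R) set_val).
Qed.

Lemma box_open z d r : open (box z d r).
Proof.
elim: d => [|d ih].
  by rewrite (_ : box z 0 r = setT); [exact: openT|apply/seteqP; split].
have -> : box z d.+1 r =
    box z d r `&` [set y | normc (tcoord z d - tcoord y d) < r].
  apply/seteqP; split => [y h|y [h1 h2] j].
    by split => [j jd|]; [apply: h; rewrite ltnS ltnW|exact: h].
  by rewrite ltnS leq_eqVlt => /orP[/eqP ->//|/h1].
apply: openI => //.
apply: (@open_comp _ _ (tcoord ^~ d) [set u | normc (tcoord z d - u) < r]).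
  by move=> y _; exact: continuous_coord.
rewrite openE => u /= ur; apply/nbhscP; exists (r - normc (tcoord z d - u)).
  by rewrite subr_gt0.
move=> v uv; apply: (le_lt_trans (normc_trans u _ _)).
by rewrite addrC -ltrBrDr.
Qed.

Lemma box_center z d r : 0 < r -> box z d r z.
Proof. by move=> r0 j _; rewrite subrr ComplexField.Normc.normc0. Qed.

Lemma nbhs_box z d r : 0 < r -> nbhs z (box z d r).
Proof. by move=> r0; apply: open_nbhs_nbhs; split; [exact: box_open|exact: box_center]. Qed.

(** The filter generated by the boxes around [z] converges to [z] in every coordinate, hence in the
    product topology, so it contains every neighbourhood of [z]. *)
Lemma nbhs_itorusP z (A : set X) :
  nbhs z A -> exists d r, 0 < r /\ box z d r `<=` A.
Proof.
move=> zA; pose B (dr : nat * R) := box z dr.1 dr.2.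
pose F : set_system X := filter_from [set dr : nat * R | 0 < dr.2] B.
have FF : Filter F.
  apply: filter_from_filter; first by exists (0%N, 1) => /=.
  move=> [d r] [e s] /= r0 s0; exists (maxn d e, Num.min r s) => /=.
    by rewrite lt_min r0.
  move=> y h; split => j hj; have := h j;
    rewrite /= leq_max hj ?orbT => /(_ isT); rewrite lt_min => /andP[]//.
have : F --> z.
  apply/pointwise_cvgP => j; apply: cvg_circle => e e0.
  by exists (j.+1, e) => //= y; exact.
by move/(_ _ zA) => [[d r] /= r0 h]; exists d, r.
Qed.

Lemma hausdorff_itorus : hausdorff_space X.
Proof.
move=> z w /= h; apply: funext => j; apply: val_inj; apply/subr0_eq.
apply: normc0_eq0.
apply/eqP; rewrite eq_le normc_ge0 andbT leNgt; apply/negP => e0.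
have e20 : 0 < normc (tcoord z j - tcoord w j) / 2 by rewrite divr_gt0.
have [y [/(_ j (ltnSn j)) h1 /(_ j (ltnSn j)) h2]] :=
  h _ _ (nbhs_box z j.+1 e20) (nbhs_box w j.+1 e20).
have := normc_trans (tcoord y j) (tcoord z j) (tcoord w j).
by rewrite leNgt (normcBC (tcoord y j)) => /negP; apply; lra.
Qed.

End Torus.

Section ComplexContinuity.
Variables (R : realType) (T : topologicalType).
Implicit Types (f g : T -> cplx R) (x : T).

Lemma continuous_addc f g x : {for x, continuous f} -> {for x, continuous g} ->
  {for x, continuous (fun y => f y + g y)}.
Proof. by move=> cf cg; exact: cvgD cf cg. Qed.

Lemma continuous_mulc f g x : {for x, continuous f} -> {for x, continuous g} ->
  {for x, continuous (fun y => f y * g y)}.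
Proof. by move=> cf cg; exact: cvgM cf cg. Qed.

Lemma continuous_expc f n x : {for x, continuous f} ->
  {for x, continuous (fun y => f y ^+ n)}.
Proof.
move=> cf; elim: n => [|n ih].
  by rewrite (_ : (fun y => _) = fun=> 1); [exact: cst_continuous|apply/funext => y].
rewrite (_ : (fun y => _) = (fun y => f y * f y ^+ n)).
  exact: (continuous_mulc cf ih).
by apply/funext => y; rewrite exprS.
Qed.

Lemma continuous_prodc I (s : seq I) (F : I -> T -> cplx R) x :
  (forall i, {for x, continuous (F i)}) ->
  {for x, continuous (fun y => \prod_(i <- s) F i y)}.
Proof.
move=> cF; elim: s => [|i s ih].
  rewrite (_ : (fun y => _) = fun=> 1); first exact: cst_continuous.
  by apply/funext => y; rewrite big_nil.
rewrite (_ : (fun y => _) = (fun y => F i y * \prod_(j <- s) F j y)).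
  exact: (continuous_mulc (cF i) ih).
by apply/funext => y; rewrite big_cons.
Qed.

End ComplexContinuity.

(** * Monomials, the flow and trigonometric polynomials *)

Section Monomials.
Variable R : realType.
Local Notation X := (itorus R).
Implicit Types (z w : X) (t : R).

Definition mono (n : nat) (z : X) : cplx R :=
  \prod_(p <- primes n) tcoord z (prime_index p) ^+ logn p n.

(** Primes that do not divide [n] enter with exponent 0, so several integers can share one range of
    factors, on which [lognM] acts termwise. *)
Lemma monoE B n z : (n < B)%N -> (0 < n)%N ->
  mono n z = \prod_(0 <= p < B) tcoord z (prime_index p) ^+ logn p n.
Proof.
move=> nB n0; rewrite /mono.
rewrite (perm_big [seq p <- index_iota 0 B | p \in primes n])/=; last first.
  apply: uniq_perm; [exact: primes_uniq|exact/filter_uniq/iota_uniq|].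
  move=> p; rewrite mem_filter mem_index_iota/=.
  have [pn|//] := boolP (p \in primes n); apply/esym.
  move: pn; rewrite mem_primes => /and3P[_ _ pn].
  by rewrite (leq_ltn_trans _ nB)// dvdn_leq.
rewrite big_filter big_mkcond; apply: eq_bigr => p _.
case: ifPn => //; rewrite -logn_gt0 -leqNgt leqn0 => /eqP ->.
by rewrite expr0.
Qed.

Lemma mono1 z : mono 1 z = 1.
Proof. by rewrite /mono big_nil. Qed.

Lemma monoM m n z : (0 < m)%N -> (0 < n)%N -> mono (m * n) z = mono m z * mono n z.
Proof.
move=> m0 n0; have mn0 : (0 < m * n)%N by rewrite muln_gt0 m0.
rewrite (@monoE (m * n).+1)// (@monoE (m * n).+1 m) ?ltnS ?leq_pmulr//.
rewrite (@monoE (m * n).+1 n) ?ltnS ?leq_pmull// -big_split/=.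
by apply: eq_bigr => p _; rewrite lognM// exprD.
Qed.

Lemma mono_prime p z : prime p -> mono p z = tcoord z (prime_index p).
Proof.
by move=> pp; rewrite /mono primes_prime// big_seq1 logn_prime// eqxx expr1.
Qed.

Lemma coord_mono j z : tcoord z j = mono (nth_prime j) z.
Proof. by have [pp e] := nth_primeP j; rewrite mono_prime// e. Qed.

Lemma normc_mono n z : normc (mono n z) = 1.
Proof.
rewrite /mono; elim/big_ind : _ => [|x y hx hy|p _].
- exact: ComplexField.Normc.normc1.
- by rewrite normcM hx hy mulr1.
- by rewrite normcX normc_coord expr1n.
Qed.

Lemma continuous_mono n : continuous (mono n).
Proof.
move=> z; apply: continuous_prodc => p; apply: continuous_expc.
exact: continuous_coord.
Qed.

Lemma bohr_polyE N a z : bohr_poly N a z = \sum_(1 <= n < N.+1) a n * mono n z.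
Proof. by []. Qed.

Lemma npow_oppM m n (s : cplx R) : (0 < m)%N -> (0 < n)%N ->
  npow_opp (m * n) s = npow_opp m s * npow_opp n s.
Proof.
move=> m0 n0; rewrite /npow_opp -cexpD -mulrDr -rmorphD natrM lnM ?posrE ?ltr0n//.
Qed.

Lemma npow_opp1 (s : cplx R) : npow_opp 1 s = 1.
Proof. by rewrite /npow_opp ln1 mulr0 cexp0. Qed.

Lemma normc_npow_opp n (s : cplx R) :
  normc (npow_opp n s) = expR (- Re s * ln n%:R).
Proof. by rewrite /npow_opp normc_cexp; case: s => a b /=; rewrite mulr0 subr0. Qed.

Definition flow t : X := fun j => unit_exp (- t * ln (nth_prime j)%:R).

Lemma npow_opp_it n t : npow_opp n (0 +i* t : cplx R) = cexp (0 +i* (- t * ln n%:R)).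
Proof.
rewrite /npow_opp; congr cexp; apply/eqP; rewrite eq_complex/=.
by apply/andP; split; apply/eqP; ring.
Qed.

Lemma mono_flow n t : (0 < n)%N -> mono n (flow t) = npow_opp n (0 +i* t).
Proof.
move: n; apply: mult_ext.
- by rewrite mono1 npow_opp1.
- by move=> m n; exact: monoM.
- by move=> m n; exact: npow_oppM.
- by move=> p pp; rewrite mono_prime// npow_opp_it /tcoord /= nth_primeK.
Qed.

Lemma bohr_poly_flow N a t : bohr_poly N a (flow t) = dirichlet_poly N a (0 +i* t).
Proof.
rewrite bohr_polyE /dirichlet_poly; apply: eq_big_nat => n /andP[n0 _].
by rewrite mono_flow.
Qed.

Lemma continuous_flow : continuous flow.
Proof.
move=> t A /nbhs_itorusP[d [r [r0 rA]]]; apply: filterS (rA) _.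
rewrite /box/= nbhs_simpl/=.
elim: d {rA} => [|d ih]; first by
  rewrite (_ : _ @^-1` _ = setT); [exact: filterT|apply/seteqP; split].
have h : \forall x \near t, normc (tcoord (flow t) d - tcoord (flow x) d) < r.
  pose l : R := ln (nth_prime d)%:R.
  have l0 : 0 < `|l| + 1 by rewrite ltr_wpDl.
  apply/nbhs_ballP; exists (r / (`|l| + 1)); first by rewrite /= divr_gt0.
  move=> x; rewrite /ball/= ltr_pdivlMr// => tx; apply: (le_lt_trans (cexp_im_Lipschitz _ _)).
  rewrite -/l -mulrBl normrM opprK addrC -normrN opprB.
  apply: le_lt_trans tx.
  by rewrite ler_wpM2l ?normr_ge0// lerDl.
near=> x => j; rewrite ltnS leq_eqVlt => /orP[/eqP ->|]; first by near: x.
by move: j; near: x.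
Unshelve. all: by end_near. Qed.

Lemma normc_mulcircle z w j : normc (tcoord z j * tcoord w j) = 1.
Proof. by rewrite normcM !normc_coord mulr1. Qed.

Definition mulX z w : X := fun j => mkunit (normc_mulcircle z w j).

Lemma coord_mulX z w j : tcoord (mulX z w) j = tcoord z j * tcoord w j.
Proof. by []. Qed.

Lemma mono_mulX n z w : mono n (mulX z w) = mono n z * mono n w.
Proof.
by rewrite /mono -big_split/=; apply: eq_bigr => p _; rewrite coord_mulX exprMn.
Qed.

Lemma normc_conjcircle z j : normc ((tcoord z j)^*)%C = 1.
Proof. by rewrite normc_J normc_coord. Qed.

Definition invX z : X := fun j => mkunit (normc_conjcircle z j).

Definition oneX : X := fun=> mkunit (ComplexField.Normc.normc1 R).

Lemma coord_invX z j : tcoord (invX z) j = (tcoord z j)^*.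
Proof. by []. Qed.

(** Multiplication by the unimodular number [(tcoord z j)^*] is an isometry. Distances to [z] thus
    become distances to [oneX] after a translation, and spikes with different centres have the same
    mean along the flow. *)
Lemma mulXV z j w : normc (1 - tcoord (mulX (invX z) w) j) = normc (tcoord z j - tcoord w j).
Proof.
have h : tcoord z j * (tcoord z j)^* = 1.
  by rewrite mulcJ normc_coord expr1n.
have -> : 1 - tcoord (mulX (invX z) w) j = (tcoord z j)^* * (tcoord z j - tcoord w j).
  by rewrite coord_mulX coord_invX mulrBr [_ * tcoord z j]mulrC h.
by rewrite normcM normc_J normc_coord mul1r.
Qed.

(** Every character of the torus is a quotient of two monomials, that is [mono n] times a conjugate
    [mono m]. Products are derived in [trig_polyM], so inductions see only characters and sums. *)
Inductive trig_poly : (X -> cplx R) -> Prop :=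
| trig_poly_char (c : cplx R) (n m : nat) : (0 < n)%N -> (0 < m)%N ->
    trig_poly (fun z => c * (mono n z * (mono m z)^*))
| trig_polyD f g : trig_poly f -> trig_poly g -> trig_poly (fun z => f z + g z).

Lemma trig_poly_ext f g : trig_poly f -> f =1 g -> trig_poly g.
Proof. by move=> tf /funext <-. Qed.

Lemma trig_poly_cst c : trig_poly (fun=> c).
Proof.
apply: (trig_poly_ext (trig_poly_char c (ltn0Sn 0) (ltn0Sn 0))) => z.
by rewrite mono1 rmorph1 !mulr1.
Qed.

Lemma trig_polyM f g : trig_poly f -> trig_poly g -> trig_poly (fun z => f z * g z).
Proof.
move=> tf tg; elim: tf g tg => [c n m n0 m0 g|f1 f2 _ h1 _ h2 g tg].
  elim=> [c' n' m' n0' m0'|g1 g2 _ h1 _ h2].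
    have nn : (0 < n * n')%N by rewrite muln_gt0 n0.
    have mm : (0 < m * m')%N by rewrite muln_gt0 m0.
    apply: (trig_poly_ext (trig_poly_char (c * c') nn mm)) => z.
    by rewrite !monoM// rmorphM/=; ring.
  by apply: (trig_poly_ext (trig_polyD h1 h2)) => z; rewrite mulrDr.
by apply: (trig_poly_ext (trig_polyD (h1 _ tg) (h2 _ tg))) => z; rewrite mulrDl.
Qed.

Lemma trig_polyX f k : trig_poly f -> trig_poly (fun z => f z ^+ k).
Proof.
move=> tf; elim: k => [|k ih].
  by apply: (trig_poly_ext (trig_poly_cst 1)) => z; rewrite expr0.
by apply: (trig_poly_ext (trig_polyM tf ih)) => z; rewrite exprS.
Qed.

Lemma trig_polyB f g : trig_poly f -> trig_poly g -> trig_poly (fun z => f z - g z).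
Proof.
move=> tf tg; apply: (trig_poly_ext (trig_polyD tf (trig_polyM (trig_poly_cst (-1)) tg))) => z.
by rewrite mulN1r.
Qed.

Lemma trig_poly_prod I (s : seq I) (F : I -> X -> cplx R) :
  (forall i, trig_poly (F i)) -> trig_poly (fun z => \prod_(i <- s) F i z).
Proof.
move=> h; elim: s => [|i s ih].
  by apply: (trig_poly_ext (trig_poly_cst 1)) => z; rewrite big_nil.
by apply: (trig_poly_ext (trig_polyM (h i) ih)) => z; rewrite big_cons.
Qed.

Lemma trig_poly_dist (u : cplx R) j :
  trig_poly (fun z => ((normc (u - tcoord z j)) ^+ 2)%:C).
Proof.
have [pp _] := nth_primeP j; have p0 := prime_gt0 pp.
have t1 := trig_poly_char 1 p0 (ltn0Sn 0).
have t2 := trig_poly_char 1 (ltn0Sn 0) p0.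
apply: (trig_poly_ext (trig_polyM (trig_polyB (trig_poly_cst u) t1)
  (trig_polyB (trig_poly_cst u^*%C) t2))) => z.
by rewrite -mulcJ rmorphB/= !coord_mono mono1 rmorph1; ring.
Qed.

Lemma continuous_trig_poly f : trig_poly f -> continuous f.
Proof.
elim=> [c n m _ _ z|{}f g _ hf _ hg z]; last exact: (continuous_addc (hf z) (hg z)).
have h : {for z, continuous (fun y => (mono m y)^* : cplx R)}.
  apply: (@continuous_comp _ _ _ (mono m) (@conjc R : cplx R -> cplx R)).
    exact: continuous_mono.
  exact: continuous_conjc.
have hc : {for z, continuous (fun y : X => c)} by exact: cst_continuous.
exact: (continuous_mulc hc (continuous_mulc (@continuous_mono n z) h)).
Qed.

End Monomials.

(** * Density of the flow *)

Section Spike.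

(* As n grows, [spike k n] tends to the indicator of [0, 1) on [0, k]. *)
Definition spike (K : unitRingType) (k n : nat) (x : K) : K :=
  (1 - (x / k%:R) ^+ n) ^+ (n * k ^ n).

Variable F : realFieldType.
Implicit Types x : F.

Lemma bernoulli x n : 0 <= x <= 1 -> 1 - n%:R * x <= (1 - x) ^+ n.
Proof.
move=> /andP[x0 x1]; elim: n => [|n ih]; first by rewrite mul0r subr0 expr0.
rewrite exprS; apply: (@le_trans _ _ ((1 - x) * (1 - n%:R * x))); last first.
  by rewrite ler_wpM2l// subr_ge0.
have h : 0 <= n%:R * x ^+ 2 by rewrite mulr_ge0// sqr_ge0.
by rewrite -natr1; nra.
Qed.

(** Since [(1 - x) * (1 + n.+1%:R * x) <= 1 + n%:R * x], the product [(1 - x) ^+ n * (1 + n%:R * x)]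
    does not increase with [n] and stays below its value 1 at [n = 0]. *)
Lemma expr_1B_le x n : 0 <= x <= 1 -> (1 - x) ^+ n <= (1 + n%:R * x)^-1.
Proof.
move=> /andP[x0 x1]; have x10 : 0 <= 1 - x by rewrite subr_ge0.
have h0 : 0 < 1 + n%:R * x by rewrite ltr_wpDr// mulr_ge0.
rewrite -(ler_pM2r h0) mulVf ?gt_eqF//.
elim: n h0 => [|n ih] h0; first by rewrite expr0 mul0r addr0 mulr1.
have h0' : 0 < 1 + n%:R * x by rewrite ltr_wpDr// mulr_ge0.
have := ih h0'; apply: le_trans; rewrite exprSr -mulrA ler_wpM2l ?exprn_ge0//.
have h1 : 0 <= n%:R * x ^+ 2 by rewrite mulr_ge0// sqr_ge0.
have h2 : 0 <= x ^+ 2 by rewrite sqr_ge0.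
by rewrite -natr1; nra.
Qed.

Section props.
Variables (k n : nat) (x : F).
Hypotheses (k0 : (0 < k)%N) (x0 : 0 <= x) (xk : x <= k%:R).

Let pow01 : 0 <= (x / k%:R) ^+ n <= 1.
Proof.
rewrite exprn_ge0 ?divr_ge0//= exprn_ile1// ?divr_ge0//.
by rewrite ler_pdivrMr ?ltr0n// mul1r.
Qed.

(** The origin of the exponent of [spike]: its factor [k ^ n] cancels the rescaling by [k], so the
    bounds below do not depend on [k]. *)
Let powE : (n * k ^ n)%:R * (x / k%:R) ^+ n = n%:R * x ^+ n.
Proof.
rewrite natrM natrX expr_div_n; field.
by rewrite expf_eq0 pnatr_eq0; case: n k0 => [|?]; case: k.
Qed.

Lemma spike_ge0 : 0 <= spike k n x.
Proof. by rewrite exprn_ge0// subr_ge0; case/andP: pow01. Qed.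

Lemma spike_le1 : spike k n x <= 1.
Proof.
case/andP: pow01 => a b.
by rewrite exprn_ile1 ?subr_ge0// lerBlDr lerDl.
Qed.

Lemma spike_ge : 1 - n%:R * x ^+ n <= spike k n x.
Proof. by rewrite -powE; exact: bernoulli. Qed.

Lemma spike_le : 1 <= x -> spike k n x <= n.+1%:R^-1.
Proof.
move=> x1; apply: (le_trans (expr_1B_le _ pow01)).
rewrite powE lef_pV2 ?posrE ?ltr0n//; last first.
  by rewrite ltr_wpDr// mulr_ge0// exprn_ge0.
by rewrite -nat1r lerD2l ler_peMr// exprn_ege1.
Qed.

End props.

Lemma prodr_ge_1B I (s : seq I) (G : I -> F) (e : F) : 0 <= e <= 1 ->
  (forall i, 1 - e <= G i <= 1) -> 1 - (size s)%:R * e <= \prod_(i <- s) G i <= 1.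
Proof.
move=> /andP[e0 e1] h; have G0 i : 0 <= G i.
  by case/andP: (h i) => [+ _]; apply: le_trans; rewrite subr_ge0.
elim: s => [|i s /andP[h1 h2]]; first by rewrite big_nil mul0r subr0 lexx.
rewrite big_cons; case/andP: (h i) => [h3 h4].
have p0 : 0 <= \prod_(j <- s) G j by rewrite prodr_ge0.
rewrite mulr_ile1// andbT /= -natr1.
have [s1|s1] := leP ((size s)%:R * e) 1.
  have : 0 <= (size s)%:R * e by rewrite mulr_ge0.
  by nra.
by rewrite (@le_trans _ _ 0)// ?mulr_ge0//; lra.
Qed.

End Spike.

(** Links the two roles of the same polynomial: the estimates hold over the reals, while
    trigonometric polynomials are complex-valued. *)
Lemma spike_morph (K L : fieldType) (f : {rmorphism K -> L}) k n x :
  f (spike k n x) = spike k n (f x).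
Proof. by rewrite /spike rmorphXn rmorphB rmorph1 rmorphXn fmorph_div rmorph_nat. Qed.

Section Kronecker.
Variable R : realType.
Local Notation X := (itorus R).

Definition avg (u : nat -> cplx R) (n : nat) : cplx R :=
  (n.+1%:R)^-1 * \sum_(k < n.+1) u k.

Definition mean_to u (c : cplx R) := avg u @ \oo --> c.

Lemma mean_toD u v c d : mean_to u c -> mean_to v d -> mean_to (fun k => u k + v k) (c + d).
Proof.
move=> uc vd; have -> : mean_to (fun k => u k + v k) (c + d) =
    (((avg u : nat -> cplx R) + (avg v : nat -> cplx R)) @ \oo --> c + d).
  rewrite /mean_to (_ : avg (fun k => u k + v k) = avg u + avg v)//.
  by apply/funext => n; rewrite /avg /= big_split mulrDr.
exact: cvgD uc vd.
Qed.

Lemma mean_to_cst c : mean_to (fun=> c) c.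
Proof.
rewrite /mean_to (_ : avg _ = fun=> c); first exact: cvg_cst.
apply/funext => n; rewrite /avg sumr_const card_ord -[X in _ * X]mulr_natl mulrA mulVf ?mul1r//.
Qed.

Lemma mean_to_le (u : nat -> R) (a : R) (c : cplx R) : (forall j, u j <= a) ->
  mean_to (fun j => (u j)%:C) c -> Re c <= a.
Proof.
move=> ua /cvgcP uc; rewrite leNgt; apply/negP => ac.
have /uc/filter_ex[m] : 0 < Re c - a by rewrite subr_gt0.
apply/negP; rewrite -leNgt; apply: le_trans (normRe_le _); rewrite ReB.
apply: le_trans (ler_norm _); rewrite lerB// /avg.
rewrite -rmorph_sum -(rmorph_nat (real_complex R)) -fmorphV -rmorphM/=.
rewrite mulrC ler_pdivrMr ?ltr0n//.
apply: (@le_trans _ _ (\sum_(j < m.+1) a)); first by apply: ler_sum => j _.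
by rewrite sumr_const card_ord mulr_natr.
Qed.

Lemma mean_to_ge (u : nat -> R) (a : R) (c : cplx R) : (forall j, a <= u j) ->
  mean_to (fun j => (u j)%:C) c -> a <= Re c.
Proof.
move=> ua /cvgcP uc; rewrite leNgt; apply/negP => ac.
have /uc/filter_ex[m] : 0 < a - Re c by rewrite subr_gt0.
apply/negP; rewrite -leNgt normcBC; apply: le_trans (normRe_le _); rewrite ReB.
apply: le_trans (ler_norm _); rewrite lerB// /avg.
rewrite -rmorph_sum -(rmorph_nat (real_complex R)) -fmorphV -rmorphM/=.
rewrite mulrC ler_pdivlMr ?ltr0n//.
apply: (@le_trans _ _ (\sum_(j < m.+1) a)); last by apply: ler_sum => j _.
by rewrite sumr_const card_ord mulr_natr.
Qed.

(** The geometric sums stay bounded by [2 / normc (q - 1)], so division by the number of terms sends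
    them to 0. *)
Lemma mean_to_geo (a q : cplx R) : normc q = 1 -> q != 1 ->
  mean_to (fun k => a * q ^+ k) 0.
Proof.
move=> q1 qn1; apply/cvgcP => e e0.
have qB0 : 0 < normc (q - 1).
  rewrite lt_neqAle normc_ge0 andbT eq_sym; apply/eqP => /normc0_eq0/eqP.
  by rewrite subr_eq0 (negbTE qn1).
pose M := 2 * normc a / normc (q - 1).
have M0 : 0 <= M by rewrite divr_ge0 ?normc_ge0// mulr_ge0// normc_ge0.
near=> n; rewrite sub0r normcN /avg -mulr_sumr normcM.
have -> : \sum_(k < n.+1) q ^+ k = (q ^+ n.+1 - 1) / (q - 1).
  by rewrite subrX1 mulrAC mulfV ?mul1r// subr_eq0.
have -> : normc (n.+1%:R^-1 : cplx R) = n.+1%:R^-1.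
  by rewrite ComplexField.Normc.normcV -(rmorph_nat (real_complex R)) normcR ger0_norm.
rewrite mulrC ltr_pdivrMr ?ltr0n// !normcM ComplexField.Normc.normcV.
apply: (@le_lt_trans _ _ M).
  rewrite mulrA ler_pM2r ?invr_gt0// mulrC ler_wpM2r ?normc_ge0//.
  apply: (le_trans (le_normcD _ _)).
  by rewrite normcN normcX q1 expr1n ComplexField.Normc.normc1.
rewrite mulrC -ltr_pdivrMr// (@lt_trans _ _ n%:R) ?ltr_nat//.
by near: n; exact: nbhs_infty_gtr.
Unshelve. all: by end_near. Qed.

Lemma imc_mulrn (x : R) k : (0 +i* x : cplx R) *+ k = 0 +i* (k%:R * x).
Proof.
elim: k => [|k ih]; first by rewrite mulr0n mul0r.
rewrite mulrS ih -nat1r.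
by apply/eqP; rewrite eq_complex/=; apply/andP; split; apply/eqP; ring.
Qed.

Lemma trig_poly_mean f : trig_poly f -> exists c : cplx R,
  forall w t, \forall d \near 0^'+, mean_to (fun k => f (mulX w (flow (t + k%:R * d)))) c.
Proof.
elim=> [c n m n0 m0|g h _ [c hc] _ [d hd]]; last first.
  exists (c + d) => w t; apply: filterS2 (hc w t) (hd w t) => r h1 h2.
  exact: (mean_toD h1 h2).
have [nm|nm] := eqVneq n m.
  exists c => w t; apply: nearW => d.
  rewrite nm (_ : (fun k : nat => _) = fun=> c); first exact: mean_to_cst.
  by apply/funext => k; rewrite mulcJ normc_mono expr1n mulr1.
exists 0 => w t.
pose th : R := ln m%:R - ln n%:R.
have th0 : th != 0.
  rewrite subr_eq0; apply: contra nm => /eqP/ln_inj; rewrite !posrE !ltr0n.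
  by move=> /(_ m0 n0)/eqP; rewrite eqr_nat eq_sym.
have flowE s : mono n (flow s) * (mono m (flow s))^*%C = cexp (0 +i* (s * th)).
  rewrite !mono_flow// !npow_opp_it conjc_cexp -cexpD; congr cexp.
  by apply/eqP; rewrite eq_complex/= /th; apply/andP; split; apply/eqP; ring.
near=> d.
have d0 : 0 < d by near: d; exact: nbhs_right_gt.
have dth : d * `|th| < pi.
  rewrite -ltr_pdivlMr ?normr_gt0//; near: d; apply: nbhs_right_lt.
  by rewrite divr_gt0 ?pi_gt0// normr_gt0.
rewrite (_ : (fun k : nat => _) = fun k => (c * (mono n w * (mono m w)^*%C) *
   cexp (0 +i* (t * th))) * cexp (0 +i* (d * th)) ^+ k).
  apply: mean_to_geo; first by rewrite normc_cexpi.
  apply/eqP => /(congr1 (@complex.Im R)).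
  rewrite /cexp/= expR0 mul0r addr0 mul1r => /eqP.
  suff s0 : sin (d * `|th|) != 0.
    have [th1|th1] := leP 0 th; first by rewrite -{1}(ger0_norm th1) (negbTE s0).
    rewrite -{1}(opprK th) mulrN sinN oppr_eq0 -(ltr0_norm th1) (negbTE s0)//.
  by rewrite gt_eqF// sin_gt0_pi// dth mulr_gt0// normr_gt0.
apply/funext => k; rewrite !mono_mulX.
have h : cexp (0 +i* (t * th)) * cexp (0 +i* (d * th)) ^+ k =
    mono n (flow (t + k%:R * d)) * (mono m (flow (t + k%:R * d)))^*%C.
  rewrite flowE -cexpMn -cexpD; congr cexp.
  rewrite imc_mulrn.
  by apply/eqP; rewrite eq_complex/=; apply/andP; split; apply/eqP; ring.
rewrite [RHS](_ : _ = c * (mono n w * (mono m w)^*%C) *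
  (cexp (0 +i* (t * th)) * cexp (0 +i* (d * th)) ^+ k)); last by ring.
by rewrite h rmorphM/=; ring.
Unshelve. all: by end_near. Qed.

Lemma itorus_finite_cover (I : choiceType) (U : I -> set X) :
  (forall i, open (U i)) -> (forall z, exists i, U i z) ->
  exists s : seq I, forall z, exists2 i, i \in s & U i z.
Proof.
move=> oU cU; have := @compact_itorus R; rewrite compact_cover.
move=> /(_ I setT U (fun i _ => oU i)) [z _|s _ h].
  by have [i Ui] := cU z; exists i.
by exists (finmap.enum_fset s) => z; have [i /= si Ui] := h z Logic.I; exists i.
Qed.

Section density.
Variables (d : nat) (r : R) (r0 : 0 < r).

Let dist2 (z w : X) j : R := normc (tcoord z j - tcoord w j) ^+ 2 / r ^+ 2.

(** Two points of the circle are at distance at most 2, so [4 / r ^+ 2] bounds [dist2] and the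
    spikes are used where they lie in [[0, 1]]. *)
Let k : nat := (Num.bound (4 / r ^+ 2)).+1.

Let dist2_ge0 z w j : 0 <= dist2 z w j.
Proof. by rewrite divr_ge0// sqr_ge0. Qed.

Let dist2_lek z w j : dist2 z w j <= k%:R.
Proof.
apply: (@le_trans _ _ (4 / r ^+ 2)); last first.
  rewrite ltW// (lt_trans (archi_boundP _)) ?ltr_nat//.
  by rewrite divr_ge0// sqr_ge0.
rewrite ler_pM2r ?invr_gt0 ?exprn_gt0// (_ : 4 = 2 ^+ 2); last by ring.
rewrite lerXn2r ?nnegrE ?normc_ge0//.
by apply: (le_trans (le_normcD _ _)); rewrite normcN !normc_coord.
Qed.

Definition box_spike n (z w : X) : R := \prod_(j <- iota 0 d) spike k n (dist2 z w j).

Lemma trig_poly_box_spike n z : trig_poly (fun w => (box_spike n z w)%:C).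
Proof.
apply: (@trig_poly_ext _ (fun w => \prod_(j <- iota 0 d) (spike k n (dist2 z w j))%:C)).
  apply: trig_poly_prod => j.
  apply: (@trig_poly_ext _ (fun w => spike k n ((normc (tcoord z j - tcoord w j) ^+ 2)%:C *
     (r ^- 2)%:C))); last first.
    by move=> w; rewrite -rmorphM/= -(spike_morph (real_complex R)).
  rewrite /spike; apply/trig_polyX/trig_polyB; first exact: trig_poly_cst.
  apply/trig_polyX/trig_polyM; last exact: trig_poly_cst.
  by apply: trig_polyM; [exact: trig_poly_dist|exact: trig_poly_cst].
by move=> w; rewrite /box_spike rmorph_prod.
Qed.

Lemma box_spike_ge0 n z w : 0 <= box_spike n z w.
Proof. by apply: prodr_ge0 => j _; exact: spike_ge0. Qed.

Lemma box_spike_le n z w : ~ box z d r w -> box_spike n z w <= n.+1%:R^-1.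
Proof.
move=> /existsNP[j /not_implyP[jd /negP]]; rewrite -leNgt => hj.
have d1 : 1 <= dist2 z w j.
  rewrite /dist2 ler_pdivlMr ?exprn_gt0// mul1r.
  by rewrite lerXn2r ?nnegrE ?normc_ge0// ltW.
have ji : j \in iota 0 d by rewrite mem_iota.
rewrite /box_spike (big_rem j ji)/=.
apply: (@le_trans _ _ (spike k n (dist2 z w j) * 1)).
  rewrite ler_wpM2l ?spike_ge0//.
  by apply: prodr_ile1 => i _; rewrite spike_ge0//= spike_le1.
by rewrite mulr1 spike_le.
Qed.

Lemma box_spike_mulX n z w :
  box_spike n z w = box_spike n (oneX R) (mulX (invX z) w).
Proof.
apply: eq_bigr => j _.
suff -> : dist2 z w j = dist2 (oneX R) (mulX (invX z) w) j by [].
by rewrite /dist2 -(mulXV z).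
Qed.

(** At half the radius [dist2] is at most 1/4, so each factor is at least [1 - n / 4^n >= 1 - 2^-n];
    the [d] factors together lose at most [d / 2^n <= 1/2]. *)
Lemma box_spike_half n z w : (2 * d <= n)%N -> box z d (r / 2) w ->
  2^-1 <= box_spike n z w.
Proof.
move=> dn zw.
have nn : n%:R < (2 ^ n)%:R :> R by rewrite ltr_nat ltn_expl.
have n2 : n%:R * (4^-1) ^+ n <= (2 ^ n)%:R^-1 :> R.
  rewrite (_ : 4^-1 = 2^-1 * 2^-1); last by field.
  rewrite exprMn mulrA natrX exprVn -[leRHS]mul1r ler_wpM2r ?invr_ge0 ?exprn_ge0//.
  by rewrite ler_pdivrMr ?exprn_gt0// mul1r -natrX ltW.
have : 1 - d%:R * (2 ^ n)%:R^-1 <= box_spike n z w.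
  have -> : box_spike n z w = \prod_(j <- iota 0 d)
     (if (j < d)%N then spike k n (dist2 z w j) else 1).
    by rewrite /box_spike big_seq [RHS]big_seq; apply: eq_bigr => j; rewrite mem_iota/= add0n => ->.
  have := @prodr_ge_1B R _ (iota 0 d) (fun j => if (j < d)%N then spike k n (dist2 z w j) else 1)
    (2 ^ n)%:R^-1.
  rewrite size_iota => h; apply: (andP (h _ _)).1.
    by rewrite invr_ge0 ler0n/= invf_le1 ?ltr0n ?expn_gt0// ler1n expn_gt0.
  move=> j; case: ifPn => [jd|_]; last by rewrite lexx gerBl invr_ge0 ler0n.
  rewrite spike_le1// andbT; apply: le_trans (spike_ge _ _ _ _) => //.
  rewrite lerB//; apply: le_trans n2; rewrite ler_wpM2l// lerXn2r ?nnegrE//.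
  rewrite /dist2 ler_pdivrMr ?exprn_gt0//.
  have := zw _ jd; have := normc_ge0 (tcoord z j - tcoord w j).
  by nra.
apply: le_trans.
have : d%:R * (2 ^ n)%:R^-1 <= 2^-1 :> R.
  rewrite ler_pdivrMr ?ltr0n ?expn_gt0// mulrC ler_pdivlMr//.
  rewrite -natrM ler_nat mulnC (leq_trans dn)// ltnW// ltn_expl//.
by lra.
Qed.

(* If the flow avoided the box after time [t], the mean of the spike centred at [z] would be
   at most 1/(n+1); but this mean does not depend on the centre, and finitely many
   spikes add up to at least 1/2. *)
Lemma flow_dense t z : exists2 s, t < s & box z d r (flow s).
Proof.
apply: contrapT => /forall2NP hn.
have [s hs] : exists s : seq X, forall z, exists2 w, w \in s & box w d (r / 2) z.
  apply: itorus_finite_cover => [w|w]; first exact: box_open.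
  by exists w; apply: box_center; rewrite divr_gt0.
(* The first summand is what [box_spike_half] requires; the second makes [size s / (n + 1)] smaller
   than 1/2. *)
pose n := (2 * d + 2 * size s)%N.
have [c hc] := trig_poly_mean (trig_poly_box_spike n (oneX R)).
have t1 : t < t + 1 by rewrite ltrDl.
have [e [e0 ez es]] : exists e, [/\ 0 < e,
    mean_to (fun j => (box_spike n z (flow (t + 1 + j%:R * e)))%:C) c &
    mean_to (fun j => \sum_(w <- s) (box_spike n w (flow (t + 1 + j%:R * e)))%:C)
      (\sum_(w <- s) c)].
  have : \forall e \near 0^'+, [/\ 0 < e,
    mean_to (fun j => (box_spike n z (flow (t + 1 + j%:R * e)))%:C) c &
    mean_to (fun j => \sum_(w <- s) (box_spike n w (flow (t + 1 + j%:R * e)))%:C)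
      (\sum_(w <- s) c)].
    have hc' w : \forall e \near 0^'+,
        mean_to (fun j => (box_spike n w (flow (t + 1 + j%:R * e)))%:C) c.
      apply: filterS (hc (invX w) (t + 1)) => e; rewrite (_ : (fun k => _) = (fun j => (box_spike n w (flow (t + 1 + j%:R * e)))%:C))//.
      by apply/funext => j; rewrite (box_spike_mulX n w).
    have hs' : \forall e \near 0^'+,
       mean_to (fun j => \sum_(w <- s) (box_spike n w (flow (t + 1 + j%:R * e)))%:C)
      (\sum_(w <- s) c).
      elim: (s) => [|w s' ih].
        apply: nearW => e; rewrite big_nil; under eq_fun do rewrite big_nil.
        exact: mean_to_cst.
      apply: filterS2 (hc' w) ih => e h1 h2.
      rewrite big_cons; under eq_fun do rewrite big_cons.
      exact: (mean_toD h1 h2).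
    apply: filterS3 (nbhs_right_gt (0 : R)) (hc' z) hs' => e e0 h1 h2.
    by split; [exact: e0|exact: h1|exact: h2].
  by move=> /filter_ex.
have c_le : Re c <= n.+1%:R^-1.
  apply: (mean_to_le _ ez) => j; apply: box_spike_le => h.
  have := hn (t + 1 + j%:R * e) => -[|//].
  by apply; rewrite (lt_le_trans t1)// lerDl mulr_ge0// ltW.
have c_ge : 2^-1 <= (size s)%:R * Re c.
  have -> : (size s)%:R * Re c = Re (\sum_(w <- s) c).
    by rewrite big_const_seq count_predT iter_addr_0 raddfMn/= mulr_natl.
  have es' : mean_to (fun j => (\sum_(w <- s) box_spike n w (flow (t + 1 + j%:R * e)))%:C)
      (\sum_(w <- s) c).
    by move: es; under eq_fun do rewrite -rmorph_sum.
  apply: (mean_to_ge _ es') => j.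
  have [w ws hw] := hs (flow (t + 1 + j%:R * e)).
  rewrite (big_rem w ws)/=.
  apply: (le_trans (box_spike_half (n := n) _ hw)); first by rewrite leq_addr.
  by rewrite lerDl sumr_ge0// => v _; exact: box_spike_ge0.
have : (size s)%:R * Re c <= (size s)%:R * n.+1%:R^-1 by rewrite ler_wpM2l.
have : (size s)%:R * n.+1%:R^-1 < 2^-1 :> R.
  rewrite ltr_pdivrMr ?ltr0n// mulrC ltr_pdivlMr// -natrM ltr_nat /n; lia.
move=> h1 h2; have := le_lt_trans (le_trans c_ge h2) h1.
by rewrite ltxx.
Unshelve. all: by end_near. Qed.

End density.
End Kronecker.

(** * Uniform approximation by Dirichlet polynomials *)

Section RealEstimates.
Variable R : realType.
Implicit Types x y h : R.

Lemma sin_ge_cubic h : 0 <= h -> h - h ^+ 3 / 2 <= sin h.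
Proof.
rewrite le_eqVlt => /predU1P[<-|h0].
  by rewrite sin0 expr0n/= mul0r subrr.
have sc : {within `[0, h], continuous (@sin R)}.
  by apply: continuous_subspaceT => x; exact: continuous_sin.
have [c] := @MVT R (@sin R) (@cos R) 0 h h0 (fun (x : R) _ => is_derive_sin x) sc.
rewrite in_itv/= sin0 !subr0 => /andP[c0 ch] ->.
have := cos_subr1_le c => hc.
have cc : c ^+ 2 <= h ^+ 2 by rewrite lerXn2r ?nnegrE ?ltW.
have : (1 - h ^+ 2 / 2) * h <= cos c * h by rewrite ler_pM2r//; lra.
by apply: le_trans; rewrite le_eqVlt; apply/orP; left; apply/eqP; field.
Qed.

Lemma sqr_sin_ge h : h ^+ 2 - h ^+ 4 <= sin h ^+ 2.
Proof.
wlog h0 : h / 0 <= h.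
  move=> H; have [/H//|/ltW h0] := leP 0 h.
  have := H (- h); rewrite oppr_ge0 => /(_ h0).
  by rewrite sinN !sqrrN (_ : (- h) ^+ 4 = h ^+ 4)//; ring.
have [h1|h1] := leP h 1; last first.
  apply: (@le_trans _ _ 0); last exact: sqr_ge0.
  rewrite (_ : h ^+ 4 = h ^+ 2 * h ^+ 2); last by ring.
  have : 1 <= h ^+ 2 by rewrite expr_ge1// ltW.
  by nra.
have s1 := sin_ge_cubic h0.
have h3 : 0 <= h - h ^+ 3 / 2.
  have -> : h - h ^+ 3 / 2 = h * (1 - h ^+ 2 / 2) by field.
  have h2 : h ^+ 2 <= 1 by rewrite expr_le1.
  by rewrite mulr_ge0//; lra.
apply: (@le_trans _ _ ((h - h ^+ 3 / 2) ^+ 2)).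
  have -> : (h - h ^+ 3 / 2) ^+ 2 = h ^+ 2 - h ^+ 4 + (h ^+ 3 / 2) ^+ 2 by field.
  by rewrite lerDl sqr_ge0.
by rewrite lerXn2r ?nnegrE// (le_trans h3).
Qed.

Lemma expRN_le x : 0 <= x -> expR (- x) <= 1 - x + x ^+ 2.
Proof.
move=> x0; rewrite expRN; have x1 : 0 < 1 + x by rewrite ltr_wpDr.
apply: (@le_trans _ _ (1 + x)^-1).
  by rewrite lef_pV2 ?posrE ?expR_gt0// expR_ge1Dx.
rewrite -(ler_pM2r x1) mulVf ?gt_eqF//.
have -> : (1 - x + x ^+ 2) * (1 + x) = 1 + x ^+ 3 by ring.
by rewrite lerDl exprn_ge0.
Qed.

(** Both functions are [1 - y ^+ 2 / 2] up to fourth order: the exponential by [expRN_le], the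
    cosine through [1 - cos y = 2 * sin (y / 2) ^+ 2]. *)
Lemma cos_expR_near y : `|cos y - expR (- (y ^+ 2 / 2))| <= y ^+ 4 / 4.
Proof.
have y2 : 0 <= y ^+ 2 / 2 by rewrite divr_ge0// sqr_ge0.
have h1 := expRN_le y2; have h2 := expR_ge1Dx (- (y ^+ 2 / 2)).
have h3 := cos_subr1_le y; have h4 := cos_subr1_half y.
have h5 := sqr_sin_ge (y / 2).
have e1 : (y ^+ 2 / 2) ^+ 2 = y ^+ 4 / 4 by field.
have e2 : (y / 2) ^+ 2 - (y / 2) ^+ 4 = y ^+ 2 / 4 - y ^+ 4 / 16 by field.
have y4 : 0 <= y ^+ 4 by rewrite (_ : y ^+ 4 = (y ^+ 2) ^+ 2) ?sqr_ge0//; ring.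
rewrite e1 in h1; rewrite e2 in h5.
by rewrite ler_norml; apply/andP; split; lra.
Qed.

Lemma normr_subX_le x y m : `|x| <= 1 -> `|y| <= 1 ->
  `|x ^+ m - y ^+ m| <= m%:R * `|x - y|.
Proof.
move=> x1 y1; elim: m => [|m ih]; first by rewrite !expr0 subrr normr0 mul0r.
have -> : x ^+ m.+1 - y ^+ m.+1 = x * (x ^+ m - y ^+ m) + (x - y) * y ^+ m.
  by rewrite !exprS; ring.
apply: (le_trans (ler_normD _ _)); rewrite !normrM -natr1 mulrDl mul1r lerD//.
  by rewrite (le_trans _ ih)// ler_piMl.
by rewrite ler_piMr// normrX exprn_ile1.
Qed.

(** A quantitative central limit theorem for the walk with [m] steps of variance [v / m]: passing to
    [m]-th powers multiplies the fourth-order error, of size [1 / m^2], by [m]. *)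
Lemma cos_pow_near (v L : R) m : 0 <= v -> (0 < m)%N ->
  `|cos (Num.sqrt (v / m%:R) * L) ^+ m - expR (- (v * L ^+ 2 / 2))| <=
  (v * L ^+ 2) ^+ 2 / 4 / m%:R.
Proof.
move=> v0 m0; set y := Num.sqrt _ * L.
have mR : (0 : R) < m%:R by rewrite ltr0n.
have y2 : y ^+ 2 = v * L ^+ 2 / m%:R.
  by rewrite /y exprMn sqr_sqrtr ?divr_ge0//; field; rewrite gt_eqF.
have -> : expR (- (v * L ^+ 2 / 2)) = expR (- (y ^+ 2 / 2)) ^+ m.
  rewrite -expRM_natr y2; congr expR; field; rewrite gt_eqF//.
have e1 : `|expR (- (y ^+ 2 / 2))| <= 1.
  by rewrite ger0_norm ?expR_ge0// expR_le1 oppr_le0 divr_ge0// sqr_ge0.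
apply: (le_trans (normr_subX_le _ (cos_max _) e1)).
apply: (@le_trans _ _ (m%:R * (y ^+ 4 / 4))); first by rewrite ler_pM2l// cos_expR_near.
have -> : y ^+ 4 = (y ^+ 2) ^+ 2 by ring.
rewrite y2 le_eqVlt; apply/orP; left; apply/eqP; field; rewrite gt_eqF//.
Qed.

(** Completing the square leaves [(v * L - 3) ^+ 2 / (2 * v)]. With [L = ln n] the bound is a
    multiple of [n^-3]; against coefficients of size [n] this leaves the summable [n^-2]. *)
Lemma gauss_le (v L : R) : 0 < v ->
  expR (- (v * L ^+ 2 / 2)) <= expR (9 / (2 * v)) * expR (- (3 * L)).
Proof.
move=> v0; rewrite -expRD ler_expR -subr_ge0.
have -> : 9 / (2 * v) + - (3 * L) - - (v * L ^+ 2 / 2) = (v * L - 3) ^+ 2 / (2 * v).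
  by field; rewrite gt_eqF.
by rewrite divr_ge0 ?sqr_ge0// mulr_ge0// ltW.
Qed.

Lemma sum_inv_sqr_le N M : (0 < N)%N ->
  \sum_(N.+1 <= n < M.+1) (n%:R ^- 2) <= (N%:R^-1 : R).
Proof.
move=> N0.
have NR : (0 : R) < N%:R by rewrite ltr0n.
have [MN|NM] := leqP M N; first by rewrite big_geq ?invr_ge0// ltnS.
apply: (@le_trans _ _ (N%:R^-1 - M%:R^-1)); last by rewrite gerBl invr_ge0.
elim: M NM => // M ih; rewrite ltnS leq_eqVlt => /predU1P[<-|NM].
  rewrite big_nat1 -subr_ge0.
  have -> : N%:R^-1 - N.+1%:R^-1 - N.+1%:R ^- 2 = (N%:R * N.+1%:R ^+ 2)^-1 :> R.
    rewrite -natr1; field; rewrite gt_eqF//= gt_eqF// ltr_wpDr//.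
  by rewrite invr_ge0 mulr_ge0// exprn_ge0.
have MR : (0 : R) < M%:R by rewrite ltr0n (leq_trans N0)// ltnW.
rewrite big_nat_recr/=; last by rewrite ltnS ltnW.
apply: (le_trans (lerD (ih NM) (lexx _))).
rewrite -subr_ge0.
have -> : N%:R^-1 - M.+1%:R^-1 - (N%:R^-1 - M%:R^-1 + M.+1%:R ^- 2) =
    (M%:R * M.+1%:R ^+ 2)^-1 :> R.
  rewrite -natr1; field; rewrite !gt_eqF//= ltr_wpDr//.
by rewrite invr_ge0 mulr_ge0// exprn_ge0.
Qed.

End RealEstimates.

(** * Averages over a symmetric random walk *)

Section ShiftAverage.
Variables (R : realType) (d : R).
Implicit Types (phi psi : R -> cplx R) (u : R).

Definition shift_avg phi u : cplx R := (2^-1)%:C * (phi (u + d) + phi (u - d)).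

Lemma iter_shift_avgB m phi psi u :
  iter m shift_avg (fun x => phi x - psi x) u =
  iter m shift_avg phi u - iter m shift_avg psi u.
Proof. by elim: m u => // m ih u; rewrite !iterS /shift_avg !ih; ring. Qed.

Lemma iter_shift_avg_sum m I (s : seq I) (F : I -> R -> cplx R) u :
  iter m shift_avg (fun x => \sum_(i <- s) F i x) u =
  \sum_(i <- s) iter m shift_avg (F i) u.
Proof.
elim: m u => // m ih u; rewrite !iterS /shift_avg !ih.
by rewrite -big_split/= mulr_sumr.
Qed.

(** Exponentials are eigenfunctions of [shift_avg], with eigenvalue the characteristic function
    [cos (d * th)] of one step. *)
Lemma iter_shift_avg_cexp m (c : cplx R) (th : R) u :
  iter m shift_avg (fun x => c * cexp (0 +i* (x * th))) u =
  ((cos (d * th)) ^+ m)%:C * (c * cexp (0 +i* (u * th))).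
Proof.
elim: m u => [|m ih] u; first by rewrite expr0 mul1r.
rewrite iterS /shift_avg !ih.
have -> : cexp (0 +i* ((u + d) * th)) = cexp (0 +i* (u * th)) * cexp (0 +i* (d * th)) :> cplx R.
  rewrite -cexpD; congr cexp.
  by apply/eqP; rewrite eq_complex/=; apply/andP; split; apply/eqP; ring.
have -> : cexp (0 +i* ((u - d) * th)) = cexp (0 +i* (u * th)) * cexp (0 +i* (- (d * th))) :> cplx R.
  rewrite -cexpD; congr cexp.
  by apply/eqP; rewrite eq_complex/=; apply/andP; split; apply/eqP; ring.
have h : (2^-1)%:C * (cexp (0 +i* (d * th)) + cexp (0 +i* (- (d * th)))) = (cos (d * th))%:C :> cplx R.
  rewrite /cexp /= expR0 cosN sinN.
  by apply/eqP; rewrite eq_complex/=; apply/andP; split; apply/eqP; field.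
by rewrite exprSr rmorphM/= -h; ring.
Qed.

Lemma iter_shift_avg_cst m (c : cplx R) u : iter m shift_avg (fun=> c) u = c.
Proof.
elim: m u => // m ih u; rewrite iterS /shift_avg !ih.
have h : (2^-1)%:C + (2^-1)%:C = 1 :> cplx R.
  by apply/eqP; rewrite eq_complex/=; apply/andP; split; apply/eqP; field.
by rewrite mulrDr -mulrDl h mul1r.
Qed.

(** Averaging [u ^+ 2] over the two shifts adds exactly [d ^+ 2]; after [m] steps this is the
    variance of the walk. *)
Lemma iter_shift_avg_le m phi al be : 0 <= be ->
  (forall u, normc (phi u) <= al + be * u ^+ 2) ->
  forall u, normc (iter m shift_avg phi u) <= al + be * (m%:R * d ^+ 2) + be * u ^+ 2.
Proof.
move=> be0 h; elim: m => [u|m ih u]; first by rewrite mul0r mulr0 addr0.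
rewrite iterS /shift_avg normcM normcR ger0_norm ?invr_ge0//.
rewrite mulrC ler_pdivrMr//.
apply: (le_trans (le_normcD _ _)); apply: (le_trans (lerD (ih _) (ih _))).
by rewrite le_eqVlt -natr1; apply/orP; left; apply/eqP; ring.
Qed.

End ShiftAverage.

Lemma abel_summation (K : comNzRingType) (b c : nat -> K) N M : (N <= M)%N ->
  \sum_(N <= n < M) b n * c n = (\sum_(N <= n < M) b n) * c M +
    \sum_(N <= n < M) (\sum_(N <= k < n.+1) b k) * (c n - c n.+1).
Proof.
elim: M => [|M ih]; first by rewrite leqn0 => /eqP ->; rewrite !big_geq// mul0r addr0.
rewrite leq_eqVlt => /predU1P[->|]; first by rewrite !big_geq// mul0r addr0.
rewrite ltnS => NM; rewrite big_nat_recr//= [\sum_(N <= n < M.+1) _ * (_ - _)]big_nat_recr//=.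
have hS : \sum_(N <= n < M.+1) b n = \sum_(N <= n < M) b n + b M by rewrite big_nat_recr.
by rewrite ih//= hS; ring.
Qed.

(** * Tails of Dirichlet series and gaussian smoothing *)

Section DirichletSeries.
Variable R : realType.
Implicit Types (s w : cplx R) (a : nat -> cplx R) (u t : R).

Lemma npow_oppD n s w : npow_opp n (s + w) = npow_opp n s * npow_opp n w.
Proof. by rewrite /npow_opp opprD mulrDl cexpD. Qed.

Lemma lnN_ge0 n : (0 < n)%N -> 0 <= ln n%:R :> R.
Proof. by move=> n0; rewrite ln_ge0// ler1n. Qed.

Lemma normc_npow_opp_le1 n s : (0 < n)%N -> 0 <= Re s -> normc (npow_opp n s) <= 1.
Proof.
by move=> n0 s0; rewrite normc_npow_opp expR_le1 mulNr oppr_le0 mulr_ge0// lnN_ge0.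
Qed.

Lemma npow_opp_Lipschitz n s w : (0 < n)%N -> 0 <= Re s -> 0 <= Re w ->
  normc (npow_opp n s - npow_opp n w) <= 2 * ln n%:R * normc (s - w).
Proof.
move=> n0 s0 w0; rewrite /npow_opp.
have h (x : cplx R) : 0 <= Re x -> Re (- x * (ln n%:R)%:C) <= 0.
  by move=> x0; rewrite mulrC Re_mulR ReN mulrN oppr_le0 mulr_ge0// lnN_ge0.
apply: (le_trans (cexp_Lipschitz (h _ s0) (h _ w0))).
rewrite -mulrBl normcM normcR ger0_norm ?lnN_ge0//.
by rewrite -opprD normcN mulrAC mulrA.
Qed.

(** Modulus and phase are treated apart. The phase costs [|Im w| * h * exp(-x)] with [x = Re w * h],
    and [x * exp(-x) <= 1 - exp(-x)] turns this into the cost of the modulus times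
    [|Im w| / Re w]. *)
Lemma one_sub_cexp_le (h : R) w : 0 <= h -> 0 < Re w ->
  normc (1 - cexp (- w * h%:C)) <= (1 + `|Im w| / Re w) * (1 - expR (- Re w * h)).
Proof.
move=> h0 w0; set x := Re w * h.
have x0 : 0 <= x by rewrite mulr_ge0// ltW.
have -> : cexp (- w * h%:C) = (expR (- x))%:C * cexp (0 +i* (- Im w * h)).
  case: w w0 @x x0 => p q /= p0 x0; rewrite /cexp/= expR0 !mulr0 subr0 add0r mulNr.
  by apply/eqP; rewrite eq_complex/=; apply/andP; split; apply/eqP; ring.
have -> : 1 - (expR (- x))%:C * cexp (0 +i* (- Im w * h)) =
    (1 - expR (- x))%:C + (expR (- x))%:C * (1 - cexp (0 +i* (- Im w * h))) :> cplx R.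
  by rewrite rmorphB rmorph1; ring.
have e0 := expR_ge0 (- x).
have e1 : expR (- x) <= 1 by rewrite expR_le1 oppr_le0.
apply: (le_trans (le_normcD _ _)); rewrite normcM !normcR.
have e2 : 0 <= 1 - expR (- x) by rewrite subr_ge0.
have -> : - Re w * h = - x by rewrite mulNr.
rewrite (ger0_norm e2) (ger0_norm e0) [leRHS]mulrDl mul1r lerD2l.
apply: (@le_trans _ _ (expR (- x) * (`|Im w| * h))).
  rewrite ler_wpM2l// normcBC (le_trans (normc_cexp_im _))//.
  by rewrite normrM normrN (ger0_norm h0).
have -> : expR (- x) * (`|Im w| * h) = `|Im w| / Re w * (expR (- x) * x).
  by rewrite /x; field; rewrite gt_eqF.
rewrite ler_wpM2l ?divr_ge0 ?(ltW w0)//.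
have ex : expR (- x) * expR x = 1 by rewrite mulrC expRxMexpNx_1.
have : expR (- x) * (1 + x) <= expR (- x) * expR x by rewrite ler_wpM2l// expR_ge1Dx.
by rewrite ex; lra.
Qed.

(** The differences on the right telescope, so the total variation of [n^{-w}] in [n] is bounded by
    the Stolz factor [1 + |Im w| / Re w]. *)
Lemma npow_opp_succ_le n w : (0 < n)%N -> 0 < Re w ->
  normc (npow_opp n w - npow_opp n.+1 w) <=
  (1 + `|Im w| / Re w) * (normc (npow_opp n w) - normc (npow_opp n.+1 w)).
Proof.
move=> n0 w0.
pose h : R := ln n.+1%:R - ln n%:R.
have h0 : 0 <= h by rewrite subr_ge0 ler_ln ?posrE ?ltr0n// ler_nat.
have E : npow_opp n.+1 w = npow_opp n w * cexp (- w * h%:C).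
  rewrite /npow_opp -cexpD -mulrDr -rmorphD/= /h; congr (cexp (_ * _%:C)).
  by rewrite addrC subrK.
rewrite E normcM -[X in normc (X - _)]mulr1 -mulrBr normcM.
have -> : normc (cexp (- w * h%:C)) = expR (- Re w * h).
  by rewrite normc_cexp mulrC Re_mulR ReN mulrC.
rewrite -[X in _ <= _ * (X - _)]mulr1 -mulrBr mulrCA ler_wpM2l ?normc_ge0//.
exact: one_sub_cexp_le.
Qed.

Lemma dirichlet_polyB a N M s : (N <= M)%N ->
  dirichlet_poly M a s - dirichlet_poly N a s = \sum_(N.+1 <= n < M.+1) a n * npow_opp n s.
Proof.
by move=> NM; rewrite /dirichlet_poly (@big_cat_nat _ _ _ N.+1 1 M.+1)//= addrAC subrr add0r.
Qed.

Lemma dirichlet_poly_cauchy a s : cvgn (fun N => dirichlet_poly N a s) ->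
  forall e, 0 < e -> exists N0, forall N M, (N0 <= N)%N -> (N <= M)%N ->
    normc (dirichlet_poly M a s - dirichlet_poly N a s) <= e.
Proof.
move=> /cvgcP h e e0; have /h [N0 _ hN] : 0 < e / 2 by rewrite divr_gt0.
exists N0 => N M N0N NM; set l := lim _ in hN.
apply: (le_trans (normc_trans l _ _)); rewrite (splitr e) normcBC.
by rewrite lerD// ltW//; apply: hN => //=; exact: leq_trans NM.
Qed.

Lemma dirichlet_series_cvg a s : cvgn (fun N => dirichlet_poly N a s) ->
  forall e, 0 < e -> \forall N \near \oo,
    normc (dirichlet_series a s - dirichlet_poly N a s) < e.
Proof. by move=> /cvgcP. Qed.

(** Abel summation against the partial sums at [s], which are at most [e] from [N0] on. The explicit
    growth in [Im w] is what allows averaging over all vertical shifts afterwards. *)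
Lemma dirichlet_tail a s : cvgn (fun N => dirichlet_poly N a s) ->
  forall e, 0 < e -> exists N0, forall N M w, (N0 <= N)%N -> (N <= M)%N -> 0 < Re w ->
    normc (dirichlet_poly M a (s + w) - dirichlet_poly N a (s + w)) <=
    e * (2 + `|Im w| / Re w).
Proof.
move=> cs e e0; have [N0 hN] := dirichlet_poly_cauchy cs e0.
exists N0 => N M w N0N NM w0; rewrite dirichlet_polyB//.
under eq_bigr do rewrite npow_oppD mulrA.
rewrite abel_summation ?ltnS//.
have wM : normc (npow_opp M.+1 w) <= 1 by rewrite normc_npow_opp_le1// ltW.
apply: (le_trans (le_normcD _ _)).
rewrite (_ : 2 + _ = 1 + (1 + `|Im w| / Re w)); last by ring.
rewrite mulrDr mulr1; apply: lerD.
  rewrite normcM -dirichlet_polyB//.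
  apply: (@le_trans _ _ (e * 1)); last by rewrite mulr1.
  by apply: ler_pM; rewrite ?normc_ge0//; exact: hN.
apply: (le_trans (normc_sum _ _ _)).
pose K := 1 + `|Im w| / Re w.
have K0 : 0 <= K by rewrite addr_ge0// divr_ge0// ltW.
apply: (@le_trans _ _ (\sum_(N.+1 <= n < M.+1)
    (e * K * (normc (npow_opp n w) - normc (npow_opp n.+1 w))))).
  apply: ler_sum_nat => n /andP[Nn nM].
  rewrite normcM -dirichlet_polyB ?(ltnW Nn)// -mulrA.
  apply: ler_pM; rewrite ?normc_ge0//; first by apply: hN => //; exact: ltnW.
  by apply: npow_opp_succ_le => //; exact: leq_ltn_trans Nn.
rewrite -mulr_sumr -mulrA ler_wpM2l ?(ltW e0)// -/K.
rewrite (@telescope_sumr_eq _ _ _ (fun n => - normc (npow_opp n w)))//; last first.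
  by move=> k _; rewrite opprK addrC.
rewrite opprK addrC -[leRHS]mulr1 ler_wpM2l//.
apply: (@le_trans _ _ (normc (npow_opp N.+1 w))); first by rewrite gerBl normc_ge0.
by rewrite normc_npow_opp_le1// ltW.
Qed.

Lemma dirichlet_series_tail a s : cvgn (fun N => dirichlet_poly N a s) ->
  forall e, 0 < e -> exists N0, forall N w, (N0 <= N)%N -> 0 < Re w ->
    cvgn (fun N => dirichlet_poly N a (s + w)) ->
    normc (dirichlet_series a (s + w) - dirichlet_poly N a (s + w)) <=
    e * (2 + `|Im w| / Re w).
Proof.
move=> cs e e0; have [N0 hN] := dirichlet_tail cs e0.
exists N0 => N w N0N w0 cw; apply/ler_addgt0Pr => r r0.
have [M [hM NM]] : exists M, normc (dirichlet_series a (s + w) -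
    dirichlet_poly M a (s + w)) < r /\ (N <= M)%N.
  exact: filter_ex (filterI (dirichlet_series_cvg cw r0) (nbhs_infty_ge N)).
apply: (le_trans (normc_trans (dirichlet_poly M a (s + w)) _ _)).
by rewrite addrC lerD ?hN// ltW.
Qed.

Lemma dirichlet_coef_le a s : cvgn (fun N => dirichlet_poly N a s) ->
  exists2 C, 0 <= C & forall n, (0 < n)%N -> normc (a n * npow_opp n s) <= C.
Proof.
move=> cs; have := cs => /cvg_seq_bounded/pinfty_ex_gt0[C C0 hC].
have {}hC n : normc (dirichlet_poly n a s) <= Re C.
  by have := hC n I; rewrite /= normE lecE => /andP[_].
exists (Re C + Re C).
  by rewrite addr_ge0// (le_trans (normc_ge0 _) (hC 0%N)).
move=> [//|n] _.
have -> : a n.+1 * npow_opp n.+1 s = dirichlet_poly n.+1 a s - dirichlet_poly n a s.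
  by rewrite dirichlet_polyB// big_nat1.
by rewrite (le_trans (le_normcD _ _))// normcN lerD.
Qed.

Definition gauss_coef (v : R) a (n : nat) : cplx R :=
  a n * (expR (- (v * ln n%:R ^+ 2 / 2)))%:C.

(** Convergence at 1 bounds [a n] by a multiple of [n], and the gaussian weight is at most a
    multiple of [n^-3]. The resulting tail bound is uniform in the closed half plane. *)
Lemma gauss_coef_tail a v : 0 < v -> cvgn (fun N => dirichlet_poly N a 1) ->
  exists2 K, 0 <= K & forall N M s, (0 < N)%N -> (N <= M)%N -> 0 <= Re s ->
   normc (dirichlet_poly M (gauss_coef v a) s - dirichlet_poly N (gauss_coef v a) s)
     <= K / N%:R.
Proof.
move=> v0 /dirichlet_coef_le[C C0 hC].
pose K := C * expR (9 / (2 * v)).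
have K0 : 0 <= K by rewrite mulr_ge0// expR_ge0.
exists K => // N M s N0 NM s0; rewrite dirichlet_polyB//.
apply: (le_trans (normc_sum _ _ _)).
apply: (@le_trans _ _ (\sum_(N.+1 <= n < M.+1) (K * n%:R ^- 2))); last first.
  by rewrite -mulr_sumr ler_wpM2l// sum_inv_sqr_le.
apply: ler_sum_nat => n /andP[Nn nM].
have n0 : (0 < n)%N by exact: leq_ltn_trans Nn.
have nR : (0 : R) < n%:R by rewrite ltr0n.
rewrite normcM /gauss_coef normcM normcR ger0_norm ?expR_ge0//.
apply: (@le_trans _ _ (normc (a n) * expR (- (v * ln n%:R ^+ 2 / 2)))).
  by rewrite ler_piMr ?normc_npow_opp_le1// mulr_ge0 ?normc_ge0// expR_ge0.
have an : normc (a n) <= C * n%:R.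
  have := hC _ n0; rewrite normcM normc_npow_opp/= mulN1r expRN lnK ?posrE//.
  by rewrite ler_pdivrMr.
apply: (le_trans (ler_pM (normc_ge0 _) (expR_ge0 _) an (gauss_le _ v0))).
have -> : expR (- (3 * ln n%:R)) = n%:R ^- 3 :> R.
  by rewrite expRN -[3]/(3%:R) expRM_natl lnK ?posrE.
by rewrite le_eqVlt; apply/orP; left; apply/eqP; rewrite /K; field; rewrite gt_eqF.
Qed.

Lemma dirichlet_unif_continuous a : dirichlet_algebra a ->
  forall e, 0 < e -> exists2 d, 0 < d & forall s w, 0 < Re s -> 0 < Re w ->
    normc (s - w) < d -> normc (dirichlet_series a s - dirichlet_series a w) < e.
Proof.
move=> [_ ua] e e0.
have /ua : entourage [set xy : cplx R * cplx R | normc (xy.1 - xy.2) < e].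
  rewrite -entourage_ballE; exists e%:C => /=; first by rewrite ltcR.
  by move=> [x y]; rewrite /ball/= normE ltcR.
move=> [/= B]; rewrite -entourage_ballE => -[/= _ /gt0_RC[d d0 ->] dB] BA.
exists d => // s w s0 w0 sw.
have sP : s \in right_half_plane R by rewrite inE.
have wP : w \in right_half_plane R by rewrite inE.
apply: (BA (SigSub sP, SigSub wP)); apply: dB => /=.
by rewrite /ball/= normE ltcR.
Qed.

Lemma right_half_planeD s u : Re (s + (0 +i* u)) = Re s.
Proof. by rewrite ReD /= addr0. Qed.

(** A chain of steps shorter than [d] gives linear growth in [|u| / d]. It is relaxed to quadratic
    growth, because the walk averages [u ^+ 2] exactly. *)
Lemma dirichlet_vertical a : dirichlet_algebra a ->
  forall e, 0 < e -> exists2 d, 0 < d & forall s u, 0 < Re s ->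
    normc (dirichlet_series a (s + (0 +i* u)) - dirichlet_series a s) <=
    e * (2 + u ^+ 2 / d ^+ 2).
Proof.
move=> aA e e0; have [d d0 hd] := dirichlet_unif_continuous aA e0.
exists d => // s u s0; pose f := dirichlet_series a.
pose n := (Num.truncn (`|u| / d)).+1.
have nR : (0 : R) < n%:R by rewrite ltr0n.
have ud : `|u / n%:R| < d.
  rewrite normrM normfV (ger0_norm (ltW nR)) ltr_pdivrMr// mulrC -ltr_pdivrMr//.
  exact: truncnS_gt.
have step k : normc (f (s + (0 +i* (k%:R * (u / n%:R)))) - f s) <= k%:R * e.
  elim: k => [|k ih].
    rewrite !mul0r (_ : _ +i* _ = 0)// addr0 subrr.
    by rewrite ComplexField.Normc.normc0.
  apply: (le_trans (normc_trans (f (s + (0 +i* (k%:R * (u / n%:R))))) _ _)).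
  rewrite -nat1r [leRHS]mulrDl mul1r lerD// ltW// hd ?right_half_planeD//.
  rewrite opprD addrACA subrr add0r.
  rewrite (_ : _ - _ = 0 +i* (u / n%:R)); last first.
    by apply/eqP; rewrite eq_complex/=; apply/andP; split; apply/eqP; ring.
  by rewrite /normc expr0n/= add0r sqrtr_sqr.
have := step n; rewrite mulrC divfK ?gt_eqF// => /le_trans; apply.
rewrite mulrC ler_wpM2l ?(ltW e0)//.
have un : n%:R <= `|u| / d + 1 by rewrite -natr1 lerD2r truncn_le// divr_ge0// ltW.
apply: (le_trans un).
have -> : u ^+ 2 / d ^+ 2 = (`|u| / d) ^+ 2 by rewrite expr_div_n real_normK ?num_real.
have h : 0 <= (`|u| / d - 2^-1) ^+ 2 by exact: sqr_ge0.
by nra.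
Qed.


Lemma realc_mulBl (x y : R) s : x%:C * s - y%:C * s = (x - y)%:C * s.
Proof. by rewrite -mulrBl -rmorphB. Qed.

Lemma npow_oppD_im n s u : npow_opp n (s + (0 +i* u)) =
  npow_opp n s * cexp (0 +i* (u * - ln n%:R)).
Proof.
rewrite npow_oppD; congr (_ * _); rewrite npow_opp_it; congr (cexp (_ +i* _)).
by rewrite mulNr mulrN.
Qed.

(* [f] is close to its averages over [m] steps of a random walk of step [+- i sqrt (v / m)],
   and these averages multiply the n-th coefficient by [cos (sqrt (v / m) * ln n) ^ m],
   which tends to the gaussian weight as [m] grows. *)
Lemma dirichlet_gauss_approx a : dirichlet_algebra a ->
  forall e, 0 < e -> exists2 v, 0 < v & forall s, 0 < Re s ->
    \forall N \near \oo,
      normc (dirichlet_series a s - dirichlet_poly N (gauss_coef v a) s) <= 5 * e.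
Proof.
move=> aA e e0; have [ca _] := aA.
have [d d0 hd] := dirichlet_vertical aA e0.
(* With this variance the term [u ^+ 2 / d ^+ 2] averages to 1, so the distance from [f s] to its
   average is at most [3 * e]. *)
pose v := d ^+ 2; have v0 : 0 < v by rewrite exprn_gt0.
exists v => // s s0; pose f := dirichlet_series a.
(* The point [s - w0] is still in the half plane, and [w0 + iu] has positive real part for every
   [u]: tails at [s + iu] are controlled by convergence at [s - w0]. *)
pose w0 : cplx R := (Re s / 2)%:C.
have w00 : 0 < Re s / 2 by rewrite divr_gt0.
(* Chosen so that the tail bound, once averaged by a walk of variance [v], becomes exactly [e]. *)
pose K := (2 + (Re s / 2)^-1) * (1 + v).
have K0 : 0 < K by rewrite mulr_gt0// ltr_wpDr// ?invr_ge0 ltW.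
have cs1 : cvgn (fun N => dirichlet_poly N a (s - w0)).
  by apply: ca; rewrite /right_half_plane/= ReB /=; lra.
have eK0 : 0 < e / K by rewrite divr_gt0.
have [N0 hN0] := dirichlet_series_tail cs1 eK0.
near=> N.
have N0N : (N0 <= N)%N by near: N; exact: nbhs_infty_ge.
pose g u := dirichlet_poly N a (s + (0 +i* u)).
have tail u : normc (f (s + (0 +i* u)) - g u) <=
    e / K * (2 + (Re s / 2)^-1) + (e / K * (2 + (Re s / 2)^-1)) * u ^+ 2.
  have E : s + (0 +i* u) = (s - w0) + (w0 + (0 +i* u)) by rewrite addrA subrK.
  rewrite /g /f E; apply: le_trans (hN0 N _ N0N _ _) _.
  - by rewrite ReD /= addr0.
  - by rewrite -E; apply: ca; rewrite /right_half_plane/= ReD/= addr0.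
  have -> : Im (w0 + (0 +i* u)) = u by rewrite ImD/= add0r.
  have -> : Re (w0 + (0 +i* u)) = Re s / 2 by rewrite ReD/= addr0.
  have i0 : 0 <= (Re s / 2)^-1 by rewrite invr_ge0 ltW.
  move: i0 (ltW eK0); move: (Re s / 2)^-1 (e / K) => q x q0 x0.
  rewrite [leRHS](_ : _ = x * ((2 + q) * (1 + u ^+ 2))); last by ring.
  rewrite ler_wpM2l//.
  have u1 : `|u| <= 1 + u ^+ 2.
    rewrite -(real_normK (num_real u)).
    by have h : 0 <= (`|u| - 2^-1) ^+ 2 by [exact: sqr_ge0]; nra.
  have u2 : 0 <= u ^+ 2 by exact: sqr_ge0.
  by nra.
apply/ler_addgt0Pr => r r0.
pose P := dirichlet_poly N (gauss_coef v a) s.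
pose A m := iter m (shift_avg (Num.sqrt (v / m%:R))) g 0.
have AE m : A m = \sum_(1 <= n < N.+1)
    ((cos (Num.sqrt (v / m%:R) * - ln n%:R)) ^+ m)%:C * (a n * npow_opp n s).
  have gE : g = fun u => \sum_(1 <= n < N.+1) (a n * npow_opp n s) * cexp (0 +i* (u * - ln n%:R)).
    apply/funext => u; apply: eq_bigr => n _.
    by rewrite npow_oppD_im mulrA.
  rewrite /A gE iter_shift_avg_sum; apply: eq_bigr => n _.
  by rewrite iter_shift_avg_cexp mul0r cexp0 mulr1.
(* The constant may depend on [N] and [s], because the number [m] of steps is chosen last. *)
have [C C0 hC] : exists2 C, 0 <= C & forall m, (0 < m)%N -> normc (A m - P) <= C / m%:R.
  exists (\sum_(1 <= n < N.+1) ((v * (- ln n%:R) ^+ 2) ^+ 2 / 4 * normc (a n * npow_opp n s))).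
    apply: sumr_ge0 => n _; rewrite mulr_ge0 ?normc_ge0// divr_ge0//.
    exact: sqr_ge0.
  move=> m m0; rewrite AE /P /dirichlet_poly -sumrB.
  apply: (le_trans (normc_sum _ _ _)); rewrite mulr_suml; apply: ler_sum => n _.
  rewrite /gauss_coef.
  have -> : a n * (expR (- (v * ln n%:R ^+ 2 / 2)))%:C * npow_opp n s =
     (expR (- (v * (- ln n%:R) ^+ 2 / 2)))%:C * (a n * npow_opp n s) by rewrite sqrrN; ring.
  rewrite realc_mulBl [leLHS]normcM normcR [leRHS]mulrAC ler_wpM2r ?normc_ge0//.
  by apply: cos_pow_near; rewrite // ltW.
pose m := (Num.truncn (C / r)).+1.
have mR : (0 : R) < m%:R by rewrite ltr0n.
have hm : C / m%:R <= r.
  by rewrite ler_pdivrMr// mulrC -ler_pdivrMr// ltW// truncnS_gt.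
have md : m%:R * Num.sqrt (v / m%:R) ^+ 2 = v.
  by rewrite sqr_sqrtr ?divr_ge0 ?(ltW v0)//; field; rewrite gt_eqF.
pose phi u := f (s + (0 +i* u)).
pose B := iter m (shift_avg (Num.sqrt (v / m%:R))) phi 0.
have fB : normc (f s - B) <= 3 * e.
  rewrite normcBC -(iter_shift_avg_cst (Num.sqrt (v / m%:R)) m (f s) 0) -iter_shift_avgB.
  have := @iter_shift_avg_le _ (Num.sqrt (v / m%:R)) m (fun u => phi u - f s) (2 * e) (e / v).
  move=> h; apply: (le_trans (h _ _ 0)).
  - by rewrite divr_ge0 ?(ltW v0) ?(ltW e0).
  - move=> u; apply: (le_trans (hd _ _ s0)); rewrite -/v le_eqVlt; apply/orP; left.
    by apply/eqP; ring.
  rewrite md expr0n/= mulr0 addr0 le_eqVlt; apply/orP; left.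
  by apply/eqP; field; rewrite gt_eqF.
have BA : normc (B - A m) <= e.
  rewrite /B /A -iter_shift_avgB.
  have K1 : 0 <= e / K * (2 + (Re s / 2)^-1).
    by rewrite mulr_ge0 ?(ltW eK0)// addr_ge0// invr_ge0 ltW.
  apply: (le_trans (iter_shift_avg_le _ m K1 tail 0)).
  rewrite md expr0n/= mulr0 addr0 le_eqVlt; apply/orP; left; apply/eqP.
  have Kn : K != 0 by rewrite gt_eqF.
  by rewrite -[RHS](divfK Kn); move: (e / K) => x; rewrite /K; ring.
apply: (le_trans (normc_trans B _ _)).
rewrite (_ : 5 * e + r = 3 * e + (e + r + e)); last by ring.
rewrite lerD//; apply: (le_trans (normc_trans (A m) _ _)).
have := hC m isT; rewrite -/P; lra.
Unshelve. all: by end_near. Qed.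

(** In [dirichlet_gauss_approx] the rank [N] depends on [s], but [v] does not. The tail bound
    [K / N1], uniform in [s], moves from that rank back to the fixed [N1]; the budget is
    [5 * (e / 6) + e / 6]. *)
Lemma dirichlet_algebra_approx a : dirichlet_algebra a ->
  forall e, 0 < e -> exists N b, forall s, 0 < Re s ->
    normc (dirichlet_series a s - dirichlet_poly N b s) <= e.
Proof.
move=> aA e e0; have e60 : 0 < e / 6 by rewrite divr_gt0.
have [v v0 hv] := dirichlet_gauss_approx aA e60.
have c1 : cvgn (fun N => dirichlet_poly N a 1).
  by apply: aA.1; rewrite /right_half_plane/= ltr01.
have [K K0 hK] := gauss_coef_tail v0 c1.
pose N1 := (Num.truncn (K / (e / 6))).+1.
have NR : (0 : R) < N1%:R by rewrite ltr0n.
have KN : K / N1%:R <= e / 6.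
  by rewrite ler_pdivrMr// mulrC -ler_pdivrMr// ltW// truncnS_gt.
exists N1, (gauss_coef v a) => s s0.
have [N [hN N1N]] := filter_ex (filterI (hv s s0) (nbhs_infty_ge N1)).
apply: (le_trans (normc_trans (dirichlet_poly N (gauss_coef v a) s) _ _)).
have := hK N1 N s isT N1N (ltW s0).
by lra.
Qed.

End DirichletSeries.

(** * The Bohr lift *)

Section UniformConvergence.
Variable R : realType.

Lemma cvg_uniformP (T : choiceType) (A : set T) (F : nat -> T -> cplx R) (f : T -> cplx R) :
  {uniform A, F @ \oo --> f} <->
  (forall e, 0 < e -> \forall n \near \oo, forall x, A x -> normc (f x - F n x) < e).
Proof.
split=> [h e e0|h P /uniform_nbhs[E [entE EP]]].
  apply: (h [set g | forall x, A x -> normc (f x - g x) < e]).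
  apply/uniform_nbhs; exists [set xy | normc (xy.1 - xy.2) < e]; split => //.
  rewrite -entourage_ballE; exists e%:C => /=; first by rewrite ltcR.
  by move=> [x y]; rewrite /ball/= normE ltcR.
move: entE; rewrite -entourage_ballE => -[/= _ /gt0_RC[d d0 ->] dE].
apply: filterS (h _ d0) => n hn; apply: EP => x Ax; apply: dE.
by rewrite /ball/= normE ltcR; exact: hn.
Qed.

(** Completeness of the reals is used for real and imaginary parts separately; the explicit rate
    then passes to the limit. *)
Lemma uniform_cauchy_cvg (T : Type) (G : nat -> T -> cplx R) :
  (forall m k z, normc (G m z - G k z) <= m.+1%:R^-1 + k.+1%:R^-1) ->
  exists F : T -> cplx R, forall m z, normc (F z - G m z) <= m.+1%:R^-1.
Proof.
move=> h.
have inv_lt (e : R) : 0 < e -> exists m, m.+1%:R^-1 < e.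
  by move=> e0; have [m hm] := filter_ex (near_infty_natSinv_lt (PosNum e0)); exists m.
have cvgR (u : nat -> R) : (forall m k, `|u m - u k| <= m.+1%:R^-1 + k.+1%:R^-1) ->
    cvgn u.
  move=> hu; apply: cauchy_cvg; apply: cauchy_exP => e e0.
  have e20 : 0 < e / 2 by rewrite divr_gt0.
  have [m hm] := inv_lt _ e20; exists (u m); exists m => // k /= mk.
  rewrite /ball/=; apply: (le_lt_trans (hu _ _)); rewrite (splitr e) ltrD//.
  by apply: le_lt_trans hm; rewrite lef_pV2 ?posrE ?ltr0n// ler_nat.
have cRe z : cvgn (fun m => Re (G m z)).
  by apply: cvgR => m k; rewrite -ReB (le_trans (normRe_le _)).
have cIm z : cvgn (fun m => Im (G m z)).
  by apply: cvgR => m k; rewrite -ImB (le_trans (normIm_le _)).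
pose F z : cplx R := limn (fun m => Re (G m z)) +i* limn (fun m => Im (G m z)).
have GF z : (fun m => G m z) @ \oo --> F z by apply: cvgc_ReIm => /=; [exact: cRe|exact: cIm].
exists F => m z; apply/ler_addgt0Pr => e e0.
have e20 : 0 < e / 2 by rewrite divr_gt0.
have [k0 hk0] := inv_lt _ e20.
have /cvgcP/(_ _ e20) h1 := GF z.
have [k [hk k0k]] := filter_ex (filterI h1 (nbhs_infty_ge k0)).
apply: (le_trans (normc_trans (G k z) _ _)).
have := h k m z.
have : k.+1%:R^-1 <= e / 2.
  by rewrite (le_trans _ (ltW hk0))// lef_pV2 ?posrE ?ltr0n// ler_nat.
move: hk; move: (k.+1%:R^-1) (m.+1%:R^-1) => p q.
by lra.
Qed.

End UniformConvergence.

Section BohrLift.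
Variable R : realType.
Local Notation X := (itorus R).
Implicit Types (s w : cplx R) (a : nat -> cplx R) (t : R) (z : X).

Lemma flow_dense_near z (A : set X) : nbhs z A -> exists t, A (flow t).
Proof.
move=> /nbhs_itorusP[d [r [r0 rA]]]; have [t _ ht] := flow_dense d r0 0 z.
by exists t; exact: rA.
Qed.

(** By density, every point of the torus is a limit of points of the orbit. *)
Lemma flow_sup (G : X -> cplx R) (C : R) : continuous G ->
  (forall t, normc (G (flow t)) <= C) -> forall z, normc (G z) <= C.
Proof.
move=> cG h z; apply/ler_addgt0Pr => e e0.
have [t ht] : exists t, normc (G z - G (flow t)) < e.
  have /cvgcP/(_ _ e0) := cG z.
  exact: flow_dense_near.
rewrite -(subrK (G (flow t)) (G z)) (le_trans (le_normcD _ _))// addrC lerD//.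
exact: ltW.
Qed.

Lemma dirichlet_poly_Lipschitz N a : exists2 L, 0 <= L & forall s w,
  0 <= Re s -> 0 <= Re w ->
  normc (dirichlet_poly N a s - dirichlet_poly N a w) <= L * normc (s - w).
Proof.
exists (\sum_(1 <= n < N.+1) (normc (a n) * (2 * ln n%:R))).
  rewrite big_nat; apply: sumr_ge0 => n /andP[n0 _].
  by rewrite mulr_ge0 ?normc_ge0// mulr_ge0// lnN_ge0.
move=> s w s0 w0; rewrite /dirichlet_poly -sumrB.
apply: (le_trans (normc_sum _ _ _)); rewrite mulr_suml.
apply: ler_sum_nat => n /andP[n0 _].
rewrite -mulrBr normcM -mulrA ler_wpM2l ?normc_ge0//.
exact: npow_opp_Lipschitz.
Qed.

Lemma Re_it t : Re (0 +i* t : cplx R) = 0. Proof. by []. Qed.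

Lemma dirichlet_poly_it N a t e : 0 < e -> exists2 d, 0 < d & forall s, 0 <= Re s ->
  normc ((0 +i* t) - s) < d ->
  normc (dirichlet_poly N a (0 +i* t) - dirichlet_poly N a s) < e.
Proof.
move=> e0; have [L L0 hL] := dirichlet_poly_Lipschitz N a.
have L1 : 0 < L + 1 by rewrite ltr_wpDl.
exists (e / (L + 1)); first by rewrite divr_gt0.
move=> s s0; rewrite ltr_pdivlMr// => hs.
apply: (le_lt_trans (hL _ _ _ s0)); first by rewrite Re_it.
apply: le_lt_trans hs; rewrite mulrC ler_wpM2l ?normc_ge0// lerDl//.
Qed.

Lemma normc_R0 (d t : R) : normc ((0 +i* t) - (d +i* t) : cplx R) = `|d|.
Proof. by rewrite /normc /= sub0r subrr expr0n/= addr0 sqrrN sqrtr_sqr. Qed.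

Lemma dirichlet_polyB_it N M b c (C : R) :
  (forall s, 0 < Re s -> normc (dirichlet_poly N b s - dirichlet_poly M c s) <= C) ->
  forall t, normc (dirichlet_poly N b (0 +i* t) - dirichlet_poly M c (0 +i* t)) <= C.
Proof.
move=> h t; apply/ler_addgt0Pr => e e0.
have e20 : 0 < e / 2 by rewrite divr_gt0.
have [d1 d10 h1] := dirichlet_poly_it N b t e20.
have [d2 d20 h2] := dirichlet_poly_it M c t e20.
pose d := Num.min d1 d2 / 2.
have d0 : 0 < d by rewrite divr_gt0// lt_min d10.
have dm : d < Num.min d1 d2 by rewrite /d ltr_pdivrMr// ltr_pMr ?ltr1n// lt_min d10.
move: (dm); rewrite lt_min => /andP[dd1 dd2].
have s0 : 0 < Re (d +i* t : cplx R) by [].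
have := h1 (d +i* t) (ltW s0); rewrite normc_R0 gtr0_norm// => /(_ dd1) k1.
have := h2 (d +i* t) (ltW s0); rewrite normc_R0 gtr0_norm// => /(_ dd2) k2.
have := h _ s0.
move: k1 k2; rewrite [X in _ -> X < _ -> _]normcBC.
set x := dirichlet_poly N b _; set y := dirichlet_poly N b _.
set x' := dirichlet_poly M c _; set y' := dirichlet_poly M c _.
move=> k1 k2 k3.
have -> : x - y' = (x - y) + (y - x') + (x' - y') by ring.
apply: (le_trans (le_normcD _ _)); apply: (le_trans (lerD (le_normcD _ _) (lexx _))).
by rewrite [X in _ <= _ + X]splitr; lra.
Qed.

Lemma continuous_bohr_poly N b : continuous (@bohr_poly R N b).
Proof.
rewrite (_ : bohr_poly N b = fun z => \sum_(1 <= n < N.+1) b n * mono n z)//.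
elim: (index_iota _ _) => [|n l ih].
  rewrite (_ : (fun z => _) = fun=> 0); last by apply/funext => z; rewrite big_nil.
  exact: cst_continuous.
rewrite (_ : (fun z => _) = fun z => b n * mono n z + \sum_(n <- l) b n * mono n z); last first.
  by apply/funext => z; rewrite big_cons.
move=> z; apply: (@continuous_addc _ _ (fun z => b n * mono n z)); last exact: ih.
have hc : {for z, continuous (fun y : X => b n)} by exact: cst_continuous.
exact: (continuous_mulc hc (@continuous_mono R n z)).
Qed.

(** The bound travels from the half plane to its boundary by continuity, from there to the orbit by
    [bohr_poly_flow], and to the torus by density. *)
Lemma bohr_poly_sup N M b c (C : R) :
  (forall s, 0 < Re s -> normc (dirichlet_poly N b s - dirichlet_poly M c s) <= C) ->
  forall z, normc (bohr_poly N b z - bohr_poly M c z) <= C.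
Proof.
move=> h; apply: flow_sup => [z|t]; last first.
  by rewrite !bohr_poly_flow; exact: dirichlet_polyB_it.
by apply: (@cvgB _ _ _ (nbhs z)); exact: continuous_bohr_poly.
Qed.

(** Polynomials within [1 / (m + 1)] of the series have pairwise differences that [bohr_poly_sup]
    carries to the torus, where their lifts converge uniformly. *)
Lemma is_bohr_lift_exists a : dirichlet_algebra a -> exists F, is_bohr_lift a F.
Proof.
move=> aA.
have /choice[P hP] : forall m : nat, exists Nb : nat * (nat -> cplx R), forall s, 0 < Re s ->
    normc (dirichlet_series a s - dirichlet_poly Nb.1 Nb.2 s) <= m.+1%:R^-1.
  move=> m; have m0 : (0 : R) < m.+1%:R^-1 by rewrite invr_gt0.
  by have [N [b hb]] := dirichlet_algebra_approx aA m0; exists (N, b).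
pose G m := @bohr_poly R (P m).1 (P m).2.
have [F hF] : exists F : X -> cplx R, forall m z, normc (F z - G m z) <= m.+1%:R^-1.
  apply: uniform_cauchy_cvg => m k; apply: bohr_poly_sup => s s0.
  apply: (le_trans (normc_trans (dirichlet_series a s) _ _)).
  by rewrite normcBC lerD// hP.
exists F, (fun m => (P m).1), (fun m => (P m).2); split.
  apply/cvg_uniformP => e e0; near=> m => s s0.
  apply: (le_lt_trans (hP _ _ s0)); near: m.
  exact: (near_infty_natSinv_lt (PosNum e0)).
apply/cvg_uniformP => e e0; near=> m => z _.
apply: (le_lt_trans (hF _ _)); near: m.
exact: (near_infty_natSinv_lt (PosNum e0)).
Unshelve. all: by end_near. Qed.

Lemma is_bohr_lift_continuous a F : is_bohr_lift a F -> continuous F.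
Proof.
move=> [N [b [_ /cvg_uniformP h]]] z; apply/(@cvgcP _ _ (nbhs z)) => e e0.
have e30 : 0 < e / 3 by rewrite divr_gt0.
have [m hm] := filter_ex (h _ e30).
have /cvgcP/(_ _ e30) := @continuous_bohr_poly (N m) (b m) z.
apply: filterS => y hy.
apply: (le_lt_trans (normc_trans (bohr_poly (N m) (b m) z) _ _)).
apply: (le_lt_trans (lerD (lexx _) (normc_trans (bohr_poly (N m) (b m) y) _ _))).
have := hm z I; have := hm y I; rewrite normcBC.
by lra.
Qed.

Lemma closure_right_half_plane t : closure (right_half_plane R) (0 +i* t).
Proof.
move=> B /nbhscP[e e0 eB]; exists ((e / 2) +i* t); split.
  by rewrite /right_half_plane/= divr_gt0.
apply: eB; rewrite normc_R0 gtr0_norm ?divr_gt0//.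
by rewrite ltr_pdivrMr// ltr_pMr// ltr1n.
Qed.

(** One polynomial close to the series on the half plane and to [F] on the torus gives a
    three-epsilon argument, which also proves that the limit in [boundary_value] exists. *)
Lemma is_bohr_lift_flow a F t : is_bohr_lift a F -> F (flow t) = boundary_value a t.
Proof.
move=> [N [b [/cvg_uniformP hf /cvg_uniformP hF]]].
have PF : ProperFilter (within (right_half_plane R) (nbhs (0 +i* t : cplx R))).
  by apply: within_nbhs_proper; exact: closure_right_half_plane.
apply/esym/cvg_lim; first exact: hausdorff_cplx.
apply/cvgcP => e e0.
have e30 : 0 < e / 3 by rewrite divr_gt0.
have [m [hm1 hm2]] := filter_ex (filterI (hf _ e30) (hF _ e30)).
have [d d0 hd] := dirichlet_poly_it (N m) (b m) t e30.
rewrite /within/=; apply/nbhscP; exists d => // s ts s0.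
have k1 := hm1 s s0; have k2 := hm2 (flow t) I.
have k3 := hd s (ltW s0) ts.
rewrite bohr_poly_flow in k2.
apply: (le_lt_trans (normc_trans (dirichlet_poly (N m) (b m) (0 +i* t)) _ _)).
apply: (le_lt_trans (lerD (lexx _) (normc_trans (dirichlet_poly (N m) (b m) s) _ _))).
rewrite normcBC in k1.
by lra.
Qed.

Lemma bohr_liftP a : dirichlet_algebra a -> is_bohr_lift a (bohr_lift a).
Proof.
move=> aA; rewrite /bohr_lift; case: xgetP => // h.
by have [F hF] := is_bohr_lift_exists aA; have := h F.
Qed.

(** Both lifts are continuous and equal the boundary value on the dense orbit. *)
Lemma is_bohr_lift_unique a F G : is_bohr_lift a F -> is_bohr_lift a G -> F = G.
Proof.
move=> hF hG; apply/funext => z; apply/eqP; rewrite -subr_eq0; apply/eqP.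
apply: normc0_eq0; apply/eqP; rewrite eq_le normc_ge0 andbT.
apply: (@flow_sup (fun z => F z - G z)).
  move=> y; apply: (@cvgB _ _ _ (nbhs y)); apply: is_bohr_lift_continuous; eassumption.
move=> t; rewrite (is_bohr_lift_flow t hF) (is_bohr_lift_flow t hG) subrr.
by rewrite ComplexField.Normc.normc0.
Qed.

Lemma continuous_bohr_lift a : dirichlet_algebra a -> continuous (bohr_lift a).
Proof. by move=> /bohr_liftP/is_bohr_lift_continuous. Qed.

Lemma bohr_lift_flow a t : dirichlet_algebra a ->
  boundary_value a t = bohr_lift a (flow t).
Proof. by move=> /bohr_liftP/is_bohr_lift_flow ->. Qed.

Lemma dirichlet_series_poly N a : (forall n, (N < n)%N -> a n = 0) ->
  forall s, (fun M => dirichlet_poly M a s) @ \oo --> dirichlet_poly N a s.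
Proof.
move=> a0 s; apply/cvgcP => e e0; exists N => // M /= NM.
rewrite normcBC dirichlet_polyB// big_nat big1 ?ComplexField.Normc.normc0//.
by move=> n /andP[Nn _]; rewrite a0// mul0r.
Qed.

Lemma dirichlet_series_polyE N a : (forall n, (N < n)%N -> a n = 0) ->
  dirichlet_series a = dirichlet_poly N a.
Proof.
move=> a0; apply/funext => s; apply: cvg_lim; first exact: hausdorff_cplx.
exact: dirichlet_series_poly.
Qed.

Lemma dirichlet_algebra_poly N a : (forall n, (N < n)%N -> a n = 0) -> dirichlet_algebra a.
Proof.
move=> a0; split.
  move=> s _; apply/cvg_ex; exists (dirichlet_poly N a s).
  exact: dirichlet_series_poly.
rewrite (dirichlet_series_polyE a0).
have [L L0 hL] := dirichlet_poly_Lipschitz N a.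
have L1 : 0 < L + 1 by rewrite ltr_wpDl.
move=> A; rewrite -entourage_ballE => -[/= _ /gt0_RC[d d0 ->] dA].
exists [set xy | normc (xy.1 - xy.2) < d / (L + 1)].
  rewrite -entourage_ballE; exists (d / (L + 1))%:C => /=; first by rewrite ltcR divr_gt0.
  by move=> [x y]; rewrite /ball/= normE ltcR.
move=> [[s sP] [w wP]] /= sw; apply: dA.
rewrite /ball/= normE ltcR.
move: (sP) (wP); rewrite !inE /right_half_plane/= => s0 w0.
apply: (le_lt_trans (hL _ _ (ltW s0) (ltW w0))).
move: sw; rewrite ltr_pdivlMr//; apply: le_lt_trans.
by rewrite mulrC ler_wpM2l ?normc_ge0// lerDl.
Qed.

Lemma bohr_lift_poly N a : (forall n, (N < n)%N -> a n = 0) -> bohr_lift a = bohr_poly N a.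
Proof.
move=> a0; apply: (@is_bohr_lift_unique a).
  exact/bohr_liftP/(dirichlet_algebra_poly a0).
exists (fun=> N), (fun=> a); split; apply/cvg_uniformP => e e0; apply: nearW => m x _.
  by rewrite (dirichlet_series_polyE a0) subrr ComplexField.Normc.normc0.
by rewrite subrr ComplexField.Normc.normc0.
Qed.

End BohrLift.

(** * Borel probability measures on the torus *)

Section BorelTopological.
Variables (R : realType) (T : ptopologicalType).
Local Notation B := (g_sigma_algebraType (@open T)).

Lemma borel_open (A : set T) : open A -> measurable (A : set B).
Proof. by move=> oA; exact: sub_sigma_algebra. Qed.

Lemma borel_closed (A : set T) : closed A -> measurable (A : set B).
Proof.
by move=> /closed_openC/borel_open/measurableC; rewrite setCK.
Qed.

Lemma continuous_borel_measurable (g : T -> R) :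
  continuous g -> measurable_fun setT (g : B -> R).
Proof.
move=> /continuousP cg; apply: (measurability _ (RGenOpens.measurableE R)).
move=> _ [_ [a [b ->] <-]]; rewrite setTI; apply: borel_open.
exact/cg/interval_open.
Qed.

Lemma measurable_borel d (S : measurableType d) (h : S -> B) :
  (forall A : set T, open A -> measurable (h @^-1` A)) -> measurable_fun setT h.
Proof.
move=> hA; apply: (@measurability _ _ S B setT h (@open T : set (set B))) => //.
by move=> _ [A oA <-]; rewrite setTI; exact: hA.
Qed.

End BorelTopological.

Section SpikeLimit.
Variable R : realType.

(** With [y = sqrt x], one factor [y ^+ n] tames [n], as [n * y ^+ n] is at most a geometric sum;
    the other one tends to 0. *)
Lemma cvg_natr_mul_expr (x : R) : 0 <= x -> x < 1 -> n%:R * x ^+ n @[n --> \oo] --> 0.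
Proof.
move=> x0 x1; pose y := Num.sqrt x.
have y0 : 0 <= y by exact: sqrtr_ge0.
have xy : x = y ^+ 2 by rewrite sqr_sqrtr.
have y1 : y < 1 by rewrite -(@ltr_pXn2r _ 2) ?nnegrE// expr1n -xy.
have h n : n%:R * y ^+ n <= (1 - y)^-1.
  rewrite -[leRHS]mul1r ler_pdivlMr ?subr_gt0//.
  apply: (@le_trans _ _ ((\sum_(i < n) y ^+ i) * (1 - y))).
    rewrite ler_wpM2r ?subr_ge0 ?(ltW y1)//.
    have -> : n%:R * y ^+ n = \sum_(i < n) y ^+ n by rewrite sumr_const card_ord mulr_natl.
    by apply: ler_sum => i _; rewrite ler_wiXn2l// ?(ltW y1)// ltnW.
  by rewrite mulrC -opprB mulNr -subrX1 opprB gerBl exprn_ge0.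
apply: (@squeeze_cvgr _ _ _ _ (fun=> 0) (fun n => (1 - y)^-1 * y ^+ n)).
- apply: nearW => n; rewrite mulr_ge0 ?exprn_ge0//=.
  by rewrite xy exprAC expr2 mulrA ler_wpM2r ?exprn_ge0.
- exact: cvg_cst.
- rewrite -[X in _ --> X](mulr0 (1 - y)^-1); apply: cvgM; first exact: cvg_cst.
  by apply: cvg_expr; rewrite ger0_norm.
Qed.

Lemma spike_cvg (k : nat) (x : R) : (0 < k)%N -> 0 <= x -> x <= k%:R ->
  spike k n x @[n --> \oo] --> (((x < 1)%R : bool)%:R : R).
Proof.
move=> k0 x0 xk; have [x1|x1] := ltP x 1.
  apply: (@squeeze_cvgr _ _ _ _ (fun n => 1 - n%:R * x ^+ n) (fun=> 1)).
  - by apply: nearW => n; rewrite spike_ge// spike_le1.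
  - rewrite -[X in _ --> X](subr0 1); apply: cvgB; first exact: cvg_cst.
    exact: cvg_natr_mul_expr.
  - exact: cvg_cst.
apply: (@squeeze_cvgr _ _ _ _ (fun=> 0) (fun n => n.+1%:R^-1)).
- by apply: nearW => n; rewrite spike_ge0// spike_le.
- exact: cvg_cst.
- exact: cvg_harmonic.
Qed.

End SpikeLimit.

(** * Cylinders determine a Borel probability measure *)

Section Cylinders.
Variable R : realType.
Local Notation X := (itorus R).

(** Entries are coordinate, centre and radius. A coordinate may occur several times, so that
    intersecting cylinders is concatenating lists. *)
Definition cyl (l : seq (nat * cplx R * R)) : set X :=
  [set z | forall c, c \in l -> normc (c.1.2 - tcoord z c.1.1) < c.2].

Definition pos_cyl : set (set X) :=
  [set A | exists2 l, all (fun c => 0 < c.2) l & A = cyl l].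

Lemma cyl_nil : cyl [::] = setT.
Proof. by apply/seteqP; split. Qed.

Lemma cyl_cons c l : cyl (c :: l) =
  [set z | normc (c.1.2 - tcoord z c.1.1) < c.2] `&` cyl l.
Proof.
apply/seteqP; split => [z h|z [h1 h2] c'].
  by split => [|c' hc']; apply: h; rewrite inE ?eqxx ?hc' ?orbT.
by rewrite inE => /predU1P[->//|]; exact: h2.
Qed.

Lemma open_tcoord_disc (u : cplx R) j (r : R) :
  open [set z : X | normc (u - tcoord z j) < r].
Proof.
apply: (@open_comp _ _ ((@tcoord R) ^~ j) [set v | normc (u - v) < r]).
  by move=> y _; exact: continuous_coord.
rewrite openE => v /= vr; apply/nbhscP; exists (r - normc (u - v)).
  by rewrite subr_gt0.
move=> w vw; apply: (le_lt_trans (normc_trans v _ _)).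
by rewrite addrC -ltrBrDr.
Qed.

Lemma open_cyl l : open (cyl l).
Proof.
elim: l => [|c l ih]; first by rewrite cyl_nil; exact: openT.
by rewrite cyl_cons; apply: openI => //; exact: open_tcoord_disc.
Qed.

Lemma setI_closed_pos_cyl : setI_closed pos_cyl.
Proof.
move=> _ _ [l lp ->] [l' lp' ->]; exists (l ++ l'); first by rewrite all_cat lp.
apply/seteqP; split => [z [h1 h2] c|z h].
  by rewrite mem_cat => /orP[]; [exact: h1|exact: h2].
by split => c hc; apply: h; rewrite mem_cat hc ?orbT.
Qed.

Lemma unit_exp_rat_dense (u : cplx R) (e : R) : normc u = 1 -> 0 < e ->
  exists q : rat, normc (cexp (0 +i* (ratr q)) - u) < e.
Proof.
move=> u1 e0; have [t _ <-] := unit_exp_surj u1.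
have te : t < t + e by rewrite ltrDl.
have [q] := rat_in_itvoo te; rewrite in_itv/= => /andP[q1 q2]; exists q.
apply: (le_lt_trans (cexp_im_Lipschitz _ _)).
by rewrite gtr0_norm ?subr_gt0// ltrBlDl.
Qed.

Let rat_cyl (l : seq (nat * rat * rat)) :=
  [seq (c.1.1, (cexp (0 +i* (ratr c.1.2)) : cplx R), ratr c.2 : R) | c <- l].

Lemma open_rat_cyl (U : set X) z : open U -> U z -> exists l : seq (nat * rat * rat),
  [/\ all (fun c => 0 < c.2) l, cyl (rat_cyl l) z & cyl (rat_cyl l) `<=` U].
Proof.
move=> oU Uz; have [d [r [r0 rU]]] : exists d r, 0 < r /\ box z d r `<=` U.
  by apply: nbhs_itorusP; exact: open_nbhs_nbhs.
have r20 : 0 < r / 2 by rewrite divr_gt0.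
have [p] := rat_in_itvoo r20; rewrite in_itv/= => /andP[p0 pr].
have /choice[q hq] : forall j, exists q : rat,
    normc (cexp (0 +i* (ratr q)) - tcoord z j) < ratr p.
  by move=> j; apply: unit_exp_rat_dense => //; exact: normc_coord.
exists [seq (j, q j, p) | j <- iota 0 d]; split.
- by apply/allP => _ /mapP[j _ ->] /=; rewrite -(ltr0q R).
- by move=> _ /mapP[_ /mapP[j _ ->] ->] /=; exact: hq.
move=> y hy; apply: rU => j jd.
have := hy (j, (cexp (0 +i* (ratr (q j))) : cplx R), ratr p).
have -> : (j, (cexp (0 +i* (ratr (q j))) : cplx R), ratr p) \in
    rat_cyl [seq (j, q j, p) | j <- iota 0 d].
  apply/mapP; exists (j, q j, p) => //; apply/mapP; exists j => //.
  by rewrite mem_iota.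
move=> /(_ isT)/= h1; have h2 := hq j.
apply: (le_lt_trans (normc_trans (cexp (0 +i* ratr (q j))) _ _)).
by rewrite (normcBC (tcoord z j)); lra.
Qed.

(** Cylinders with rational radii and rational arguments of the centres form a countable base. Lists
    whose cylinder does not fit in [U] contribute [set0], so the union runs over a whole countable
    type. *)
Lemma pos_cyl_generate : <<s pos_cyl >> = <<s @open X >>.
Proof.
apply/seteqP; split.
  apply: smallest_sub; first exact: smallest_sigma_algebra.
  by move=> _ [l _ ->]; apply: sub_sigma_algebra; exact: open_cyl.
apply: smallest_sub; first exact: smallest_sigma_algebra.
move=> U oU.
pose D (l : seq (nat * rat * rat)) : set X :=
  if all (fun c => 0 < c.2) l && `[< cyl (rat_cyl l) `<=` U >] then cyl (rat_cyl l) else set0.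
have -> : U = \bigcup_l D l.
  apply/seteqP; split => [z Uz|z [l _]].
    have [l [lp lz lU]] := open_rat_cyl oU Uz; exists l => //; rewrite /D lp/=.
    by rewrite (asboolT lU).
  by rewrite /D; case: ifPn => // /andP[_ /asboolP]; exact.
apply: (@countable_bigcupT_measurable _ (g_sigma_algebraType pos_cyl)) => //.
move=> l; rewrite /D; case: ifPn => [/andP[lp _]|_]; last exact: measurable0.
apply: sub_sigma_algebra; exists (rat_cyl l) => //.
by rewrite all_map; apply: sub_all lp => c /=; rewrite ltr0q.
Qed.

(** The centre need not lie on the circle, so its distance to a point of the circle is only bounded
    by [normc c.1.2 + 1]. *)
Let bd (c : nat * cplx R * R) : nat := (Num.bound ((normc c.1.2 + 1) ^+ 2 / c.2 ^+ 2)).+1.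

Definition cyl_spike (l : seq (nat * cplx R * R)) n (z : X) : R :=
  \prod_(c <- l) spike (bd c) n (normc (c.1.2 - tcoord z c.1.1) ^+ 2 / c.2 ^+ 2).

Lemma cyl_dist_ge0 c z : 0 <= normc (c.1.2 - tcoord z c.1.1) ^+ 2 / c.2 ^+ 2 :> R.
Proof. by rewrite divr_ge0// sqr_ge0. Qed.

Lemma cyl_dist_le (c : nat * cplx R * R) (z : X) :
  normc (c.1.2 - tcoord z c.1.1) ^+ 2 / c.2 ^+ 2 <= (bd c)%:R.
Proof.
apply: (@le_trans _ _ ((normc c.1.2 + 1) ^+ 2 / c.2 ^+ 2)).
  rewrite ler_wpM2r ?invr_ge0 ?sqr_ge0// lerXn2r ?nnegrE ?addr_ge0 ?normc_ge0//.
  by rewrite (le_trans (le_normcD _ _))// normcN normc_coord.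
rewrite ltW// (lt_trans (archi_boundP _)) ?ltr_nat//.
by rewrite divr_ge0// sqr_ge0.
Qed.

Lemma cyl_spike_ge0 l n z : 0 <= cyl_spike l n z.
Proof. by apply: prodr_ge0 => c _; rewrite spike_ge0 ?cyl_dist_ge0 ?cyl_dist_le. Qed.

Lemma cyl_spike_le1 l n z : cyl_spike l n z <= 1.
Proof.
apply: prodr_ile1 => c _.
by rewrite spike_ge0 ?cyl_dist_ge0 ?cyl_dist_le// spike_le1 ?cyl_dist_ge0 ?cyl_dist_le.
Qed.

Lemma trig_poly_cyl_spike l n : trig_poly (fun z => (cyl_spike l n z)%:C).
Proof.
apply: (@trig_poly_ext _ (fun z => \prod_(c <- l)
   (spike (bd c) n (normc (c.1.2 - tcoord z c.1.1) ^+ 2 / c.2 ^+ 2))%:C)); last first.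
  by move=> z; rewrite /cyl_spike rmorph_prod.
apply: trig_poly_prod => c.
apply: (@trig_poly_ext _ (fun w => spike (bd c) n ((normc (c.1.2 - tcoord w c.1.1) ^+ 2)%:C *
     (c.2 ^- 2)%:C))); last first.
  by move=> w; rewrite -rmorphM/= -(spike_morph (real_complex R)).
rewrite /spike; apply/trig_polyX/trig_polyB; first exact: trig_poly_cst.
apply/trig_polyX/trig_polyM; last exact: trig_poly_cst.
by apply: trig_polyM; [exact: trig_poly_dist|exact: trig_poly_cst].
Qed.

Lemma cyl_spike_cvg l z : all (fun c => 0 < c.2) l ->
  cyl_spike l n z @[n --> \oo] --> (\1_(cyl l) z : R).
Proof.
elim: l => [|c l ih] /=.
  move=> _; rewrite cyl_nil indicT /=.
  rewrite (_ : (fun n => _) = fun=> 1); first exact: cvg_cst.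
  by apply/funext => n; rewrite /cyl_spike big_nil.
move=> /andP[c0 /ih h].
rewrite (_ : (fun n => _) = (fun n =>
  spike (bd c) n (normc (c.1.2 - tcoord z c.1.1) ^+ 2 / c.2 ^+ 2) * cyl_spike l n z)); last first.
  by apply/funext => n; rewrite /cyl_spike big_cons.
rewrite cyl_cons indicI; apply: cvgM h.
rewrite indicE.
have -> : (z \in [set z | normc (c.1.2 - tcoord z c.1.1) < c.2]) =
    (normc (c.1.2 - tcoord z c.1.1) ^+ 2 / c.2 ^+ 2 < 1).
  rewrite (_ : _ / _ < 1 = (normc (c.1.2 - tcoord z c.1.1) < c.2)).
    by apply/idP/idP; rewrite inE.
  by rewrite ltr_pdivrMr ?exprn_gt0// mul1r ltr_pXn2r ?nnegrE ?normc_ge0// ltW.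
by apply: spike_cvg; rewrite ?cyl_dist_ge0 ?cyl_dist_le.
Qed.

Lemma continuous_Re_trig_poly (f : X -> cplx R) : trig_poly f -> continuous (fun z => Re (f z)).
Proof.
move=> /continuous_trig_poly cf z.
apply: (@continuous_comp _ _ _ f (@complex.Re R)); first exact: cf.
exact: continuous_Re.
Qed.

(** Cylinders form a generating pi-system. Each indicator is a bounded pointwise limit of
    trigonometric polynomials, so dominated convergence replaces uniform approximation. *)
Lemma borel_itorus_unique (mu nu : {measure set (borel_itorus R) -> \bar R}) :
  mu setT = 1%E -> nu setT = 1%E ->
  (forall f, trig_poly f -> (\int[mu]_z (Re (f z))%:E = \int[nu]_z (Re (f z))%:E)%E) ->
  forall A, measurable A -> mu A = nu A.
Proof.
move=> mu1 nu1 h.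
apply: (@measure_unique _ R (borel_itorus R) pos_cyl (fun=> setT)).
- by rewrite pos_cyl_generate.
- exact: setI_closed_pos_cyl.
- by move=> _; exists [::] => //; rewrite cyl_nil.
- by rewrite bigcup_const.
- move=> _ [l lp ->].
  have key (m : {measure set (borel_itorus R) -> \bar R}) : m setT = 1%E ->
     (\int[m]_z (cyl_spike l n z)%:E)%E @[n --> \oo] --> m (cyl l).
    move=> m1; have mc : measurable (cyl l : set (borel_itorus R)).
      by apply: borel_open; exact: open_cyl.
    have -> : m (cyl l) = (\int[m]_z (\1_(cyl l) z)%:E)%E.
      by rewrite integral_indic// setIT.
    apply: (@dominated_cvg _ _ _ _ _ measurableT _ _ (cst 1%E)) => //.
    + move=> n; apply/measurable_EFinP; apply: continuous_borel_measurable.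
      have := continuous_Re_trig_poly (trig_poly_cyl_spike l n).
      by [].
    + by move=> z _; apply: cvg_EFin; [exact: nearW|exact: cyl_spike_cvg].
    + apply: (@measurable_bounded_integrable _ _ _ _ (cst 1)) => //.
      * by rewrite m1 ltey.
      * exact: bounded_cst.
    + move=> n z _ /=; rewrite lee_fin ger0_norm ?cyl_spike_ge0//.
      exact: cyl_spike_le1.
  have k1 := key _ mu1; have k2 := key _ nu1.
  have E n : (\int[mu]_z (cyl_spike l n z)%:E = \int[nu]_z (cyl_spike l n z)%:E)%E.
    exact: (h _ (trig_poly_cyl_spike l n)).
  move: k1; under eq_fun do rewrite E; move=> k1.
  by apply: (cvg_unique _ k1 k2); exact: ereal_hausdorff.
- by move=> _; rewrite mu1 ltey.
Qed.

End Cylinders.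

(** * Means on bounded Borel functions and the Riesz representation *)

Section Means.
Variables (R : realType) (T : ptopologicalType).
Local Notation B := (g_sigma_algebraType (@open T)).

Definition bounded_borel (f : T -> R) : Prop :=
  measurable_fun setT (f : B -> R) /\ exists M, forall x, `|f x| <= M.

(* Means act on all bounded Borel functions, so that a mean can be evaluated on indicators of
   closed sets. *)
Record is_mean (L : (T -> R) -> R) : Prop := IsMean {
  mean_add : forall f g, bounded_borel f -> bounded_borel g ->
    L (fun x => f x + g x) = L f + L g;
  mean_scale : forall c f, bounded_borel f -> L (fun x => c * f x) = c * L f;
  mean_le : forall f g, bounded_borel f -> bounded_borel g ->
    (forall x, f x <= g x) -> L f <= L g;
  mean_one : L (fun=> 1) = 1 }.

Lemma bounded_borel_cst c : bounded_borel (fun=> c).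
Proof. by split; [exact: measurable_cst|exists `|c|]. Qed.

Lemma bounded_borelD f g : bounded_borel f -> bounded_borel g ->
  bounded_borel (fun x => f x + g x).
Proof.
move=> [mf [M hM]] [mg [N hN]]; split; first exact: measurable_funD.
by exists (M + N) => x; rewrite (le_trans (ler_normD _ _))// lerD.
Qed.

Lemma bounded_borelZ c f : bounded_borel f -> bounded_borel (fun x => c * f x).
Proof.
move=> [mf [M hM]]; split; first by apply: measurable_funM => //; exact: measurable_cst.
by exists (`|c| * M) => x; rewrite normrM ler_wpM2l.
Qed.

Lemma bounded_borel_indic (A : set T) : measurable (A : set B) -> bounded_borel (\1_A).
Proof.
move=> mA; split; first exact: measurable_indic.
by exists 1 => x; rewrite indicE; case: (_ \in _); rewrite /= ?normr1 ?normr0 ?ler01.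
Qed.

Lemma bounded_borel_sum I (s : seq I) (F : I -> T -> R) :
  (forall i, bounded_borel (F i)) -> bounded_borel (fun x => \sum_(i <- s) F i x).
Proof.
move=> h; elim: s => [|i s ih].
  by under eq_fun do rewrite big_nil; exact: bounded_borel_cst.
by under eq_fun do rewrite big_cons; exact: bounded_borelD.
Qed.

Lemma mean_sum L I (s : seq I) (F : I -> T -> R) : is_mean L ->
  (forall i, bounded_borel (F i)) -> L (fun x => \sum_(i <- s) F i x) = \sum_(i <- s) L (F i).
Proof.
move=> hL h; elim: s => [|i s ih].
  rewrite big_nil (_ : (fun x => _) = fun x => 0 * (fun=> 1) x).
    by rewrite mean_scale ?mul0r//; exact: bounded_borel_cst.
  by apply/funext => x; rewrite big_nil mul0r.
under eq_fun do rewrite big_cons.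
by rewrite mean_add// ?ih ?big_cons//; exact: bounded_borel_sum.
Qed.

Lemma mean_cst L c : is_mean L -> L (fun=> c) = c.
Proof.
move=> hL; rewrite (_ : (fun=> c) = fun x : T => c * (fun=> 1) x).
  by rewrite mean_scale ?mean_one ?mulr1//; exact: bounded_borel_cst.
by apply/funext => x; rewrite mulr1.
Qed.

Lemma probability_integrable (mu : probability B R) (f : T -> R) :
  bounded_borel f -> mu.-integrable setT (EFin \o f).
Proof.
move=> [mf [M hM]]; apply: measurable_bounded_integrable => //.
  exact: (le_lt_trans (probability_le1 mu measurableT) (ltry _)).
by exists M; split; [exact: num_real|move=> y My x _; exact: (le_trans (hM x) (ltW My))].
Qed.

Lemma mean_probability (mu : probability B R) : is_mean (fun f => \int[mu]_x f x).
Proof.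
have bi := @probability_integrable mu.
split.
- by move=> f g /bi f1 /bi g1; rewrite RintegralD.
- by move=> c f /bi f1; rewrite RintegralZl.
- by move=> f g /bi f1 /bi g1 fg; apply: le_Rintegral.
- rewrite Rintegral_cst// mul1r.
  exact: (congr1 fine (@probability_setT _ _ _ mu)).
Qed.

Lemma continuous_bounded_borel (g : T -> R) (M : R) : continuous g ->
  (forall x, 0 <= g x <= M) -> bounded_borel g.
Proof.
move=> cg h; split; first exact: continuous_borel_measurable.
by exists M => x; have /andP[g0 gM] := h x; rewrite ger0_norm.
Qed.

(** The number of levels [i + 1] not exceeding [y] is the integer part of [y]. *)
Lemma count_level_le (n : nat) (y : R) : 0 <= y -> y <= n%:R ->
  (\sum_(i < n) (i.+1%:R <= y)%R%:R <= y :> R) /\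
  (y <= \sum_(i < n) (i.+1%:R <= y)%R%:R + 1 :> R).
Proof.
move=> y0 yn.
have E m : (m <= Num.truncn y)%N -> \sum_(i < m) (i.+1%:R <= y)%R%:R = m%:R :> R.
  move=> my; rewrite (eq_bigr (fun=> 1)) ?sumr_const ?card_ord//.
  move=> i _; rewrite (_ : (i.+1%:R <= y) = true)//.
  by rewrite -truncn_ge_nat// (leq_trans _ my).
have tn : (Num.truncn y <= n)%N.
  by rewrite -(@ler_nat R) (le_trans _ yn)// truncn_le.
have -> : \sum_(i < n) (i.+1%:R <= y)%R%:R = (Num.truncn y)%:R :> R.
  rewrite -(big_mkord xpredT (fun i => (i.+1%:R <= y)%R%:R : R)).
  rewrite (@big_cat_nat _ _ _ (Num.truncn y))//= big_mkord E// [X in _ + X]big_nat big1 ?addr0//.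
  move=> i /andP[ti _]; rewrite (_ : (i.+1%:R <= y) = false)//.
  by apply/negbTE; rewrite -truncn_ge_nat// -ltnNge ltnS.
by split; [rewrite truncn_le|rewrite ltW// natr1 truncnS_gt].
Qed.

(* Layer-cake comparison: [g] is within [1 / n] of an average of indicators of superlevel sets. *)
Lemma mean_le_closed L M : is_mean L -> is_mean M ->
  (forall K, closed K -> L (\1_K) <= M (\1_K)) ->
  forall g : T -> R, continuous g -> (forall x, 0 <= g x <= 1) -> L g <= M g.
Proof.
move=> hL hM LM g cg g01; apply/ler_addgt0Pr => e e0.
pose n := (Num.truncn e^-1).+1.
have nR : (0 : R) < n%:R by rewrite ltr0n.
have ne : n%:R^-1 <= e by rewrite -[leRHS]invrK lef_pV2 ?posrE ?invr_gt0// ltW// truncnS_gt.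
pose K (i : nat) : set T := [set x | i.+1%:R <= n%:R * g x].
have bg : bounded_borel g by exact: (continuous_bounded_borel cg g01).
have cK i : closed (K i).
  apply: (@closed_comp _ _ (fun x => n%:R * g x) [set y | i.+1%:R <= y]).
    by move=> x _; apply: cvgM; [exact: cst_continuous|exact: cg].
  exact: closed_ge.
have bK i : bounded_borel (\1_(K i) : T -> R).
  exact: (bounded_borel_indic (borel_closed (cK i))).
pose s x : R := \sum_(i <- iota 0 n) \1_(K i) x.
have bs : bounded_borel s by exact: bounded_borel_sum.
have sE x : s x = \sum_(i < n) (i.+1%:R <= n%:R * g x)%R%:R.
  rewrite /s -[iota 0 n]/(index_iota 0 n) big_mkord; apply: eq_bigr => i _.
  rewrite indicE; congr (nat_of_bool _)%:R.
  by apply/idP/idP; rewrite inE.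
have sP x : s x <= n%:R * g x /\ n%:R * g x <= s x + 1.
  rewrite sE; apply: count_level_le; have /andP[g0 g1] := g01 x.
    by rewrite mulr_ge0.
  by rewrite -[leRHS]mulr1 ler_wpM2l.
have h1 : n%:R * L g <= L s + 1.
  rewrite -mean_scale// -[X in _ + X](mean_cst 1 hL) -mean_add//; last exact: bounded_borel_cst.
  apply: mean_le => //; first exact: bounded_borelZ.
    by apply: bounded_borelD => //; exact: bounded_borel_cst.
  by move=> x; have [] := sP x.
have h2 : L s <= M s by rewrite !mean_sum//; apply: ler_sum => i _; exact: LM.
have h3 : M s <= n%:R * M g.
  rewrite -mean_scale//; apply: mean_le => //; first exact: bounded_borelZ.
  by move=> x; have [] := sP x.
have : n%:R * L g <= n%:R * (M g + n%:R^-1).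
  by rewrite mulrDr mulfV ?gt_eqF// (le_trans h1)// lerD2r (le_trans h2).
by rewrite ler_pM2l// => /le_trans; apply; rewrite lerD2l.
Qed.

(** After rescaling into [[0, 1]], the comparison is applied to [h] and to [1 - h]. Dividing by
    [c + 1] rather than [c] covers [c = 0]. *)
Lemma mean_eq_closed L M : is_mean L -> is_mean M ->
  (forall K, closed K -> L (\1_K) <= M (\1_K)) ->
  forall (g : T -> R) (c : R), continuous g -> (forall x, 0 <= g x <= c) -> L g = M g.
Proof.
move=> hL hM LM g c cg g0c.
have [x0] : exists x : T, True by exists point.
have c0 : 0 <= c by have /andP[h1 h2] := g0c point; exact: le_trans h2.
move=> _; have c1 : 0 < c + 1 by rewrite ltr_wpDl.
pose h x := (c + 1)^-1 * g x.
have ch : continuous h by move=> x; apply: cvgM; [exact: cst_continuous|exact: cg].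
have h01 x : 0 <= h x <= 1.
  have /andP[h1 h2] := g0c x; rewrite mulr_ge0 ?invr_ge0 ?(ltW c1)//=.
  by rewrite /h mulrC ler_pdivrMr// mul1r (le_trans h2)// lerDl.
have bh := continuous_bounded_borel ch h01.
have bg := continuous_bounded_borel cg g0c.
suff : L h = M h.
  by rewrite !mean_scale// => /mulfI; apply; rewrite invr_neq0// gt_eqF.
apply/eqP; rewrite eq_le mean_le_closed//=.
have c1h : continuous (fun x => 1 + (-1) * h x).
  move=> x; apply: cvgD; first exact: cst_continuous.
  by apply: cvgM; [exact: cst_continuous|exact: ch].
have h01' x : 0 <= 1 + (-1) * h x <= 1.
  by have /andP[a b] := h01 x; apply/andP; split; lra.
have := mean_le_closed hL hM LM c1h h01'.
have bZ := bounded_borelZ (-1) bh; have b1 := bounded_borel_cst 1.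
by rewrite !mean_add// !mean_scale// !mean_one//; lra.
Qed.

End Means.

(** * The Riesz measure of a mean on a compact Hausdorff space *)

Section RieszMeasure.
Variables (R : realType) (T : ptopologicalType).
Hypotheses (cT : compact [set: T]) (hT : hausdorff_space T).
Local Notation B := (g_sigma_algebraType (@open T)).
Variable L : (T -> R) -> R.
Hypothesis hL : is_mean L.
Local Open Scope ereal_scope.

Let nu (K : set T) : R := L (\1_K).

Let bK (K : set T) : closed K -> bounded_borel (\1_K : T -> R).
Proof. by move=> cK; exact: (@bounded_borel_indic R T K (borel_closed cK)). Qed.

Let nu_le K K' : closed K -> closed K' -> K `<=` K' -> (nu K <= nu K')%R.
Proof.
move=> cK cK' KK'; apply: mean_le => //; [exact: bK|exact: bK|move=> x].
rewrite !indicE; have [xK|xK] := boolP (x \in K).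
  by rewrite (mem_set (KK' _ (set_mem xK))).
by rewrite ler0n.
Qed.

Let nuU_le K K' : closed K -> closed K' -> (nu (K `|` K') <= nu K + nu K')%R.
Proof.
move=> cK cK'; rewrite -mean_add//; [|exact: bK|exact: bK].
apply: mean_le => //; first by apply: bK; exact: closedU.
  by apply: bounded_borelD; exact: bK.
by move=> x; rewrite !indicE in_setU; case: (x \in K); case: (x \in K') => /=; lra.
Qed.

Let nuU_disj K K' : closed K -> closed K' -> K `&` K' = set0 ->
  (nu (K `|` K') = nu K + nu K')%R.
Proof.
move=> cK cK' KK'; rewrite -mean_add//; [|exact: bK|exact: bK].
congr L; apply/funext => x; rewrite !indicE in_setU.
have : x \notin K `&` K' by rewrite KK' in_set0.
by rewrite in_setI; case: (x \in K); case: (x \in K') => //= _; rewrite ?addr0 ?add0r.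
Qed.

Let nu0 : nu set0 = 0%R.
Proof.
rewrite /nu (_ : \1_set0 = fun=> 0%R); first exact: mean_cst.
by apply/funext => x; rewrite indicE in_set0.
Qed.

Let nuT : nu setT = 1%R.
Proof. by rewrite /nu indicT mean_one. Qed.

Let nu_ge0 K : closed K -> (0 <= nu K)%R.
Proof. by move=> cK; rewrite -nu0 nu_le//; exact: closed0. Qed.

(** Values of [L] on open sets are bypassed: a finitely additive mean need not be countably
    subadditive on them, while this supremum is, by [inner_sigma]. *)
Let inner (U : set T) : \bar R :=
  ereal_sup [set (nu K)%:E | K in [set K | closed K /\ K `<=` U]].

Let nu_inner K U : closed K -> K `<=` U -> (nu K)%:E <= inner U.
Proof. by move=> cK KU; apply: ereal_sup_ubound; exists K. Qed.

Let inner_le U e : (forall K, closed K -> K `<=` U -> (nu K)%:E <= e) -> inner U <= e.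
Proof. by move=> h; apply: ge_ereal_sup => _ [K [cK KU] <-]; exact: h. Qed.

Let inner_ge0 U : 0 <= inner U.
Proof. by rewrite -[0]/(0%R%:E) -nu0; apply: nu_inner => //; exact: closed0. Qed.

Let inner_mono U V : U `<=` V -> inner U <= inner V.
Proof.
move=> UV; apply: inner_le => K cK KU; apply: nu_inner => //.
exact: subset_trans UV.
Qed.

Let inner0 : inner set0 = 0.
Proof.
apply/eqP; rewrite eq_le inner_ge0 andbT; apply: inner_le => K _.
by rewrite subset0 => ->; rewrite nu0.
Qed.

(** Normality gives a neighbourhood [C] of the part of [K] outside [V] with closure inside [U]; the
    closure of [C] and the complement of its interior cut [K] into closed pieces inside [U] and
    [V]. *)
Let innerU U V : open U -> open V -> inner (U `|` V) <= inner U + inner V.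
Proof.
move=> oU oV; apply: inner_le => K cK KUV.
have cKV : closed (K `&` ~` V) by apply: closedI => //; exact: open_closedC.
have [|C KC CU] := @compact_normal T hT cT _ cKV U.
  by move=> x [Kx nVx]; apply: open_nbhs_nbhs; split => //; case: (KUV x Kx).
have cK1 : closed (K `&` closure C) by apply: closedI => //; exact: closed_closure.
have cK2 : closed (K `&` ~` C^°).
  by apply: closedI => //; apply: open_closedC; exact: open_interior.
have KE : K = (K `&` closure C) `|` (K `&` ~` C^°).
  apply/seteqP; split=> [x Kx|x [[]|[]]//].
  have [Cx|Cx] := pselect (C^° x); last by right.
  by left; split => //; apply: subset_closure; exact: interior_subset.
rewrite {1}KE; apply: (@le_trans _ _ (nu (K `&` closure C) + nu (K `&` ~` C^°))%:E).
  by rewrite lee_fin nuU_le.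
rewrite EFinD leeD// nu_inner//.
  by move=> x [_ /CU].
move=> x [Kx nCx]; apply: contrapT => nVx; apply: nCx; exact: KC.
Qed.

Let inner_bigU (U : nat -> set T) n : (forall i, open (U i)) ->
  inner (\bigcup_(i in `I_n) U i) <= \sum_(i < n) inner (U i).
Proof.
move=> oU; elim: n => [|n ih].
  by rewrite big_ord0 (_ : \bigcup_(_ in _) _ = set0) ?inner0//; apply/seteqP; split => x // [].
rewrite big_ord_recr/= (_ : \bigcup_(_ in _) _ = (\bigcup_(i in `I_n) U i) `|` U n).
  apply: (le_trans (innerU _ (oU n))); first by apply: bigcup_open => i _; exact: oU.
  exact: leeD.
apply/seteqP; split => [x [i /= ]|x [[i /= ni Ui]|Un]].
- by rewrite ltnS leq_eqVlt => /predU1P[->|ni Ui]; [right|left; exists i].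
- by exists i => //=; exact: ltnW.
- by exists n => /=.
Qed.

Let inner_sigma (U : nat -> set T) : (forall i, open (U i)) ->
  inner (\bigcup_i U i) <= \sum_(i <oo) inner (U i).
Proof.
move=> oU; apply: inner_le => K cK KU.
have := subclosed_compact cK cT (@subsetT _ _); rewrite compact_cover.
move=> /(_ nat setT U (fun i _ => oU i) KU)[D _ KD].
pose n := (\max_(i <- finmap.enum_fset D) i).+1.
apply: (@le_trans _ _ (inner (\bigcup_(i in `I_n) U i))).
  apply: nu_inner => // x /KD[i /= iD Ui]; exists i => //=.
  by rewrite ltnS; apply: (@leq_bigmax_seq _ (finmap.enum_fset D) xpredT id i).
apply: (le_trans (inner_bigU n oU)).
rewrite -(big_mkord xpredT (fun i => inner (U i))).
by apply: nneseries_lim_ge => i _ _; exact: inner_ge0.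
Qed.

Let outer (A : set T) : \bar R :=
  ereal_inf [set inner U | U in [set U | open U /\ A `<=` U]].

Let outer_le A U : open U -> A `<=` U -> outer A <= inner U.
Proof. by move=> oU AU; apply: ereal_inf_lbound; exists U. Qed.

Let outer_ge A e : (forall U, open U -> A `<=` U -> e <= inner U) -> e <= outer A.
Proof. by move=> h; apply: le_ereal_inf_tmp => _ [U [oU AU] <-]; exact: h. Qed.

Let outer_open U : open U -> outer U = inner U.
Proof.
move=> oU; apply/eqP; rewrite eq_le outer_le//=.
by apply: outer_ge => V oV UV; exact: inner_mono.
Qed.

Let outer_ge0 A : 0 <= outer A.
Proof. by apply: outer_ge => U _ _; exact: inner_ge0. Qed.

Let outer0 : outer set0 = 0.
Proof. by rewrite outer_open ?inner0//; exact: open0. Qed.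

Let outer_mono : {homo outer : A A' / A `<=` A' >-> A <= A'}.
Proof.
move=> A A' AA'; apply: outer_ge => U oU A'U; apply: outer_le => //.
exact: subset_trans A'U.
Qed.

Let inner_le1 U : inner U <= 1.
Proof.
by apply: inner_le => K cK KU; rewrite -nuT lee_fin nu_le//; exact: closedT.
Qed.

Let outer_fin A : outer A \is a fin_num.
Proof.
rewrite ge0_fin_numE ?outer_ge0//.
apply: (@le_lt_trans _ _ 1); last exact: ltry.
by rewrite (le_trans (outer_le openT (@subsetT _ A)))// inner_le1.
Qed.

Let outer_sigma : sigma_subadditive outer.
Proof.
move=> A; apply/lee_addgt0Pr => e e0.
rewrite (le_trans _ (epsilon_trick _ _ (ltW e0)))//.
have /choice[U hU] : forall n, exists U, [/\ open U, A n `<=` U &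
    inner U <= outer (A n) + (e / (2 ^ n.+1)%:R)%:E].
  move=> n; have en : (0 < e / (2 ^ n.+1)%:R)%R by rewrite divr_gt0// ltr0n expn_gt0.
  have [_ [U [oU AU] <-] h] := lb_ereal_inf_adherent en (outer_fin (A n)).
  by exists U; split => //; exact: ltW.
apply: (@le_trans _ _ (inner (\bigcup_n U n))).
  apply: outer_le; first by apply: bigcup_open => n _; case: (hU n).
  by apply: subset_bigcup => n _; case: (hU n).
apply: (le_trans (inner_sigma _)); first by move=> n; case: (hU n).
apply: lee_nneseries => [n _ _|n _]; first exact: inner_ge0.
by case: (hU n).
Qed.

(** A closed [K] nearly exhausts [V] inside [U], then a closed [K'] nearly exhausts [V] outside [K].
    They are disjoint subsets of [V], so additivity on disjoint closed sets bounds the sum by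
    [inner V]. *)
Let outer_caratheodory U : open U ->
  forall A, outer (A `&` U) + outer (A `&` ~` U) <= outer A.
Proof.
move=> oU A; apply: outer_ge => V oV AV.
apply: (@le_trans _ _ (inner (V `&` U) + outer (V `&` ~` U))).
  rewrite leeD//; last by apply: outer_mono; exact: setSI.
  by apply: outer_le; [exact: openI|exact: setSI].
rewrite -leeBrDr//; apply: inner_le => K cK KVU.
rewrite leeBrDr//.
apply: (@le_trans _ _ ((nu K)%:E + inner (V `&` ~` K))).
  rewrite leeD2l//; apply: outer_le.
    by apply: openI => //; exact: closed_openC.
  by move=> x [Vx nUx]; split => // /KVU[].
rewrite -leeBrDl//; apply: inner_le => K' cK' K'VK.
rewrite leeBrDl// -EFinD -nuU_disj//.
  apply: nu_inner; first exact: closedU.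
  by move=> x [/KVU[]//|/K'VK[]].
by apply/seteqP; split => x // [Kx /K'VK[_]]; exact.
Qed.

Let outerT : outer setT = 1.
Proof.
rewrite outer_open; last exact: openT.
by apply/eqP; rewrite eq_le inner_le1/= -[1]/(1%R%:E) -nuT nu_inner//; exact: closedT.
Qed.

(** For closed [K], [L (\1_K)] is at most [inner U] for every open [U] around [K], hence at most
    [mu K]. Equality can fail, and [mean_eq_closed] does not ask for it. *)
Lemma riesz_representation : exists mu : probability B R,
  forall (g : T -> R) (c : R), continuous g ->
  (forall x, (0 <= g x <= c)%R) -> (\int[mu]_x g x)%R = L g.
Proof.
pose om : {outer_measure set T -> \bar R} := HB.pack outer
  (@isOuterMeasure.Build R T outer outer0 outer_ge0 outer_mono outer_sigma).
have mB (A : set B) : measurable A -> om.-caratheodory A.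
  apply: smallest_sub; last first.
    by move=> U oU; apply: le_caratheodory_measurable; exact: outer_caratheodory.
  split.
  - exact: caratheodory_measurable_set0.
  - by move=> C mC; rewrite setTD; exact: caratheodory_measurable_setC.
  - by move=> F mF; exact: caratheodory_measurable_bigcup.
have sa : semi_sigma_additive (outer : set B -> \bar R).
  move=> F mF tF mUF.
  by apply: (@caratheodory_measure_sigma_additive R T om) => //;
    [move=> n; exact: mB|exact: mB].
pose mu0 : {measure set B -> \bar R} := HB.pack (outer : set B -> \bar R)
  (@isMeasure.Build _ B R outer outer0 outer_ge0 sa).
pose mu : probability B R := HB.pack (outer : set B -> \bar R)
  (Measure.class mu0) (@Measure_isProbability.Build _ B R mu0 outerT).
exists mu => g c cg g0c.
apply/esym; apply: (mean_eq_closed hL (mean_probability mu) _ cg g0c) => K cK.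
have -> : (\int[mu]_x (\1_K x : R))%R = fine (outer K).
  by rewrite /Rintegral integral_indic ?setIT//; exact: borel_closed.
rewrite -lee_fin fineK// -/(nu K).
by apply: outer_ge => U oU KU; exact: nu_inner.
Qed.

End RieszMeasure.

(** * From lambda to mu *)

Section UltraMean.
Variables (R : realType) (T : ptopologicalType) (I : topologicalType) (U : set_system I).
Hypothesis uU : UltraFilter U.

(** Compactness gives a cluster point. An ultrafilter that misses a preimage of a neighbourhood
    contains its complement, which contradicts clustering. *)
Lemma ultra_cvg_bounded (u : I -> R) (M : R) : (\forall i \near U, `|u i| <= M) ->
  cvg (u @ U).
Proof.
move=> uM; have PU : ProperFilter U := @ultra_proper _ U uU.
have [|p [_ clp]] := @segment_compact R (- M) M (u @ U) (fmap_proper_filter u PU).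
  by apply: filterS uM => i; rewrite ler_norml.
apply/cvg_ex; exists p => A pA.
have [//|nA] := in_ultra_setVsetC (u @^-1` A) uU.
by have [y [nAy Ay]] := clp (~` A) A nA pA.
Qed.

Lemma mean_bound (L : (T -> R) -> R) f M : is_mean L -> bounded_borel f ->
  (forall x, `|f x| <= M) -> `|L f| <= M.
Proof.
move=> hL bf fM; rewrite ler_norml.
rewrite -{1}(mean_cst (- M) hL) -{2}(mean_cst M hL); apply/andP; split.
  apply: mean_le => //; first exact: bounded_borel_cst.
  by move=> x; have := fM x; rewrite ler_norml => /andP[].
apply: mean_le => //; first exact: bounded_borel_cst.
by move=> x; have := fM x; rewrite ler_norml => /andP[].
Qed.

(** Eventual means suffice, as needed for [flow_mean T], which is shown to be a mean when [[0, T]]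
    has positive finite mass. *)
Lemma ultra_mean (m : I -> (T -> R) -> R) : (\forall i \near U, is_mean (m i)) ->
  exists2 L : (T -> R) -> R, is_mean L &
    forall f, bounded_borel f -> m i f @[i --> U] --> L f.
Proof.
move=> hm; have PU : ProperFilter U := @ultra_proper _ U uU.
pose L f := lim (m i f @[i --> U]).
have cL f : bounded_borel f -> m i f @[i --> U] --> L f.
  move=> bf; have [_ [M fM]] := bf.
  apply: (@ultra_cvg_bounded (fun i => m i f) M).
  by apply: filterS hm => i hi; exact: mean_bound.
exists L => //; split.
- move=> f g bf bg; apply: cvg_lim => //.
  have h := cvgD (cL f bf) (cL g bg).
  refine (cvg_trans (@near_eq_cvg _ _ U _ (fun i => m i f + m i g) _ _) (h _)).
  by apply: filterS hm => i hi; rewrite mean_add.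
- move=> c f bf; apply: cvg_lim => //.
  have h := cvgM (cvg_cst c) (cL f bf).
  refine (cvg_trans (@near_eq_cvg _ _ U _ (fun i => c * m i f) _ _) (h _ _)).
  by apply: filterS hm => i hi; rewrite mean_scale.
- move=> f g bf bg fg; have h : \forall i \near U, m i f <= m i g by apply: filterS hm => i hi; exact: mean_le.
  exact: (ler_cvg_to (cL f bf) (cL g bg) h).
- apply: cvg_lim => //; apply: cvg_near_cst.
  by apply: filterS hm => i hi; rewrite mean_one.
Qed.

End UltraMean.

Section FlowMean.
Variable R : realType.
Local Notation X := (itorus R).
Variable lambda : {measure set R -> \bar R}.

Lemma locally_finite_itv (T : R) : locally_finite lambda -> (lambda `[0%R, T]%classic < +oo)%E.
Proof.
move=> /choice[U hU].
have := @segment_compact R 0 T; rewrite compact_cover.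
move=> /(_ R setT (fun x => (U x)^°)) [||D _ hD].
- by move=> x _; exact: open_interior.
- by move=> x _; exists x => //; have [+ _ _] := hU x.
have [V [mV fV VD]] : exists V : set R, [/\ measurable V, (lambda V < +oo)%E &
    forall x, x \in finmap.enum_fset D -> U x `<=` V].
  elim: (finmap.enum_fset D) => [|x s [V [mV fV VD]]].
    by exists set0; split => //; rewrite measure0.
  have [_ mU fU] := hU x; exists (U x `|` V); split; first exact: measurableU.
    by rewrite (le_lt_trans (measureU2 _ _ _))// lte_add_pinfty.
  move=> y; rewrite inE => /predU1P[->|ys]; first exact: subsetUl.
  by apply: subset_trans (VD y ys) _; exact: subsetUr.
apply: le_lt_trans fV; apply: le_measure; rewrite ?inE//.
by move=> t /hD[x /= xD Uxt]; apply: (VD x xD); exact: interior_subset.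
Qed.

Definition flow_mean (T : R) (f : X -> R) : R :=
  (fine (lambda `[0%R, T]%classic))^-1 * \int[lambda]_(t in `[0%R, T]) f (flow t).

Lemma measurable_flow : measurable_fun setT (@flow R : R -> borel_itorus R).
Proof.
apply: measurable_borel => A oA; apply: open_measurable.
by have /continuousP := @continuous_flow R; exact.
Qed.

Lemma flow_integrable (T : R) (f : X -> R) : (lambda `[0%R, T]%classic < +oo)%E ->
  bounded_borel f -> lambda.-integrable `[0%R, T] (EFin \o (fun t => f (flow t))).
Proof.
move=> fT [mf [M hM]]; apply: measurable_bounded_integrable => //.
  apply: (@measurable_funS _ _ _ _ setT) => //.
  exact: (measurableT_comp mf measurable_flow).
exists M; split; first exact: num_real.
by move=> y My t _; exact: (le_trans (hM _) (ltW My)).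
Qed.

Lemma flow_mean_is_mean (T : R) : (0 < lambda `[0%R, T]%classic)%E ->
  (lambda `[0%R, T]%classic < +oo)%E -> is_mean (flow_mean T).
Proof.
move=> l0 loo; have fi := flow_integrable loo.
have c0 : 0 < fine (lambda `[0%R, T]%classic) by rewrite fine_gt0// l0.
split.
- by move=> f g bf bg; rewrite /flow_mean RintegralD ?mulrDr//; exact: fi.
- by move=> c f bf; rewrite /flow_mean (RintegralZl _ _ (fi f bf))// mulrCA.
- move=> f g bf bg fg; rewrite /flow_mean ler_pM2l ?invr_gt0//.
  by apply: le_Rintegral => //; exact: fi.
- by rewrite /flow_mean Rintegral_cst// mul1r mulVf// gt_eqF.
Qed.

Lemma itorus_bounded (g : X -> R) : continuous g -> exists M, forall z, g z <= M.
Proof.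
move=> cg; have [s hs] : exists s : seq nat, forall z, exists2 n, n \in s & [set z | g z < n%:R] z.
  apply: itorus_finite_cover => [n|z].
    apply: (@open_comp _ _ g [set x | x < n%:R]); last exact: open_lt.
    by move=> z _; exact: cg.
  exists (Num.bound `|g z|); rewrite /=.
  by rewrite (le_lt_trans (ler_norm _))// archi_boundP.
exists (\sum_(n <- s) n%:R) => z; have [n ns /= /ltW gn] := hs z.
apply: (le_trans gn); rewrite (big_rem n ns)/= lerDl.
by rewrite sumr_ge0.
Qed.

Definition lift_sq (a : nat -> cplx R) (z : X) : R := normc (bohr_lift a z) ^+ 2.

Lemma continuous_lift_sq a : dirichlet_algebra a -> continuous (lift_sq a).
Proof.
move=> aA z.
have h : {for z, continuous (fun z => normc (bohr_lift a z))}.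
  apply: (@continuous_comp _ _ _ (bohr_lift a) (@normc R)).
    exact: continuous_bohr_lift.
  exact: continuous_normc.
exact: (cvgM h h).
Qed.

Lemma lift_sq_bounded a : dirichlet_algebra a ->
  exists M, forall z, 0 <= lift_sq a z <= M.
Proof.
move=> aA; have [M hM] := itorus_bounded (continuous_lift_sq aA).
by exists M => z; rewrite hM andbT sqr_ge0.
Qed.

Lemma bounded_borel_lift_sq a : dirichlet_algebra a -> bounded_borel (lift_sq a).
Proof.
move=> aA; have [M hM] := lift_sq_bounded aA.
exact: (continuous_bounded_borel (continuous_lift_sq aA) hM).
Qed.

Lemma boundary_lift_sq a t : dirichlet_algebra a ->
  normc (boundary_value a t) ^+ 2 = lift_sq a (flow t).
Proof. by move=> aA; rewrite bohr_lift_flow. Qed.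

Lemma mean_squareE a (T : R) : dirichlet_algebra a -> (lambda `[0%R, T]%classic < +oo)%E ->
  mean_square lambda a T = (flow_mean T (lift_sq a))%:E.
Proof.
move=> aA loo; rewrite /mean_square /flow_mean EFinM; congr (_ * _)%E.
under eq_integral do rewrite boundary_lift_sq//.
rewrite /Rintegral fineK//.
exact/integrable_fin_num/(flow_integrable loo)/bounded_borel_lift_sq.
Qed.

Lemma mean_probability_lift_sq (mu : probability (borel_itorus R) R) a :
  dirichlet_algebra a ->
  (\int[mu]_z (normc (bohr_lift a z) ^+ 2)%:E)%E = (\int[mu]_z lift_sq a z)%:E.
Proof.
move=> aA; rewrite /Rintegral fineK//; apply: integrable_fin_num => //.
exact/probability_integrable/bounded_borel_lift_sq.
Qed.

Lemma limit_measure :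
  locally_finite lambda ->
  (forall a, dirichlet_algebra a -> exists l : R, mean_square_cvg lambda a l%:E) ->
  exists mu : probability (borel_itorus R) R,
    forall a, dirichlet_algebra a -> mean_identity lambda mu a.
Proof.
move=> lf hl; have foo T := locally_finite_itv T lf.
have l0 : \forall T \near +oo, (0 < lambda `[0%R, T]%classic)%E.
  (* The zero series serves only to extract from the hypothesis that [[0, T]] eventually has
     positive mass. *)
  have a0 : dirichlet_algebra (fun=> 0 : cplx R) by apply: (@dirichlet_algebra_poly _ 0%N).
  by have [l []] := hl _ a0.
have [U [uU oU]] := ultraFilterLemma (@proper_pinfty_nbhs R).
have PU : ProperFilter U := @ultra_proper _ U uU.
have [L hL mL] := @ultra_mean R X R U uU flow_mean
   (oU _ (filterS (fun T h => flow_mean_is_mean h (foo T)) l0)).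
have [mu hmu] := riesz_representation (@compact_itorus R) (@hausdorff_itorus R) hL.
exists mu => a aA; have [l [_ hla]] := hl a aA; split => //.
have [M hM] := lift_sq_bounded aA.
rewrite mean_probability_lift_sq// (hmu _ M (continuous_lift_sq aA) hM).
suff <- : l = L (lift_sq a) by [].
have h1 : mean_square lambda a T @[T --> U] --> l%:E by move=> A /hla/oU.
have h2 : (flow_mean T (lift_sq a)) @[T --> U] --> l.
  have : (flow_mean T (lift_sq a))%:E @[T --> U] --> l%:E.
    by rewrite (_ : (fun T => _) = mean_square lambda a)//; apply/funext => T; rewrite mean_squareE.
  by move/fine_cvgP => [].
exact: (cvg_unique _ h2 (mL _ (bounded_borel_lift_sq aA))).
Qed.

End FlowMean.

Section Uniqueness.
Variable R : realType.
Local Notation X := (itorus R).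

(** For [n = m] the two terms add up to [1 + c], so no case distinction is needed. *)
Definition pair_coef (n m : nat) (c : cplx R) (j : nat) : cplx R :=
  (j == n)%:R + c * (j == m)%:R.

Lemma pair_coef0 n m c j : (n + m < j)%N -> pair_coef n m c j = 0.
Proof.
move=> h; rewrite /pair_coef !gtn_eqF ?mulr0 ?addr0//.
  by rewrite (leq_ltn_trans _ h)// leq_addl.
by rewrite (leq_ltn_trans _ h)// leq_addr.
Qed.

Lemma bohr_poly_pair n m c z : (0 < n)%N -> (0 < m)%N ->
  bohr_poly (n + m) (pair_coef n m c) z = mono n z + c * mono m z.
Proof.
move=> n0 m0; rewrite bohr_polyE.
have sel k (F : nat -> cplx R) : (0 < k)%N -> (k <= n + m)%N ->
    \sum_(1 <= j < (n + m).+1) (j == k)%:R * F j = F k.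
  move=> k0 kn; rewrite (bigD1_seq k) ?iota_uniq//= ?mem_index_iota ?k0//.
  rewrite eqxx mul1r big1 ?addr0// => j /negbTE ->.
  by rewrite mul0r.
under eq_bigr do rewrite /pair_coef mulrDl -mulrA.
by rewrite big_split/= -mulr_sumr !sel// ?leq_addr// leq_addl.
Qed.

Lemma normcD_sq (x y : cplx R) :
  normc (x + y) ^+ 2 = normc x ^+ 2 + normc y ^+ 2 + 2 * Re (x * y^*).
Proof.
rewrite !sqr_normc_ReIm Re_mul !ReD !ImD; case: x => a b; case: y => p q /=.
by ring.
Qed.

Lemma bounded_borel_Re_trig_poly (g : X -> cplx R) :
  trig_poly g -> bounded_borel (fun z => Re (g z)).
Proof.
move=> tg; have cg := continuous_Re_trig_poly tg.
split; first exact: continuous_borel_measurable.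
have [K hK] := @itorus_bounded R (fun z => `|Re (g z)|) (fun z => cvg_norm (cg z)).
by exists K.
Qed.

Lemma mean_trig_poly_eq (L M : (X -> R) -> R) : is_mean L -> is_mean M ->
  (forall a, dirichlet_algebra a -> L (lift_sq a) = M (lift_sq a)) ->
  forall f : X -> cplx R, trig_poly f -> L (fun z => Re (f z)) = M (fun z => Re (f z)).
Proof.
move=> hL hM LM f.
have bRe := bounded_borel_Re_trig_poly.
elim=> [c n m n0 m0|g h tg hg th hh]; last first.
  have -> : (fun z => Re (g z + h z)) = (fun z => Re (g z) + Re (h z)).
    by apply/funext => z; rewrite ReD.
  by rewrite !mean_add ?hg ?hh//; exact: bRe.
pose a := pair_coef n m (c^*)%C.
have a0 : forall j, (n + m < j)%N -> a j = 0 by exact: pair_coef0.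
have aA := dirichlet_algebra_poly a0.
pose h z := Re (c * (mono n z * (mono m z)^*)).
have bh : bounded_borel h by apply: bRe; exact: trig_poly_char.
have E : lift_sq a = fun z => (1 + normc c ^+ 2) + 2 * h z.
  apply/funext => z; rewrite /lift_sq (bohr_lift_poly a0) bohr_poly_pair// normcD_sq.
  rewrite normcM !normc_mono normc_J mulr1 expr1n; congr (_ + 2 * Re _).
  rewrite [RHS]mulrCA; congr (_ * _).
  by rewrite rmorphM; congr (_ * _); exact: conjcK.
have := LM _ aA; rewrite E.
have b1 := bounded_borel_cst X (1 + normc c ^+ 2).
have b2 := bounded_borelZ 2 bh.
rewrite (mean_add hL b1 b2) (mean_add hM b1 b2) (mean_cst _ hL) (mean_cst _ hM).
rewrite (mean_scale hL 2 bh) (mean_scale hM 2 bh) => /addrI/mulfI; apply.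
by rewrite pnatr_eq0.
Qed.

Lemma mean_identity_unique (lambda : {measure set R -> \bar R})
  (mu nu : probability (borel_itorus R) R) :
  (forall a, dirichlet_algebra a -> mean_identity lambda mu a) ->
  (forall a, dirichlet_algebra a -> mean_identity lambda nu a) ->
  forall B, measurable B -> nu B = mu B.
Proof.
move=> hmu hnu.
have LM a : dirichlet_algebra a -> \int[nu]_z lift_sq a z = \int[mu]_z lift_sq a z.
  move=> aA; have [_ h1] := hmu a aA; have [_ h2] := hnu a aA.
  apply: EFin_inj; rewrite -!mean_probability_lift_sq//.
  exact: (cvg_unique (@ereal_hausdorff R) h2 h1).
apply: borel_itorus_unique.
- exact: probability_setT.
- exact: probability_setT.
have bint (pi : probability (borel_itorus R) R) (f : X -> cplx R) : trig_poly f ->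
    (\int[pi]_z (Re (f z))%:E)%E = (\int[pi]_z Re (f z))%:E.
  move=> tf; rewrite /Rintegral fineK//; apply: integrable_fin_num => //.
  exact/probability_integrable/bounded_borel_Re_trig_poly.
move=> f tf; rewrite !bint//; congr (_%:E).
exact: (mean_trig_poly_eq (mean_probability nu) (mean_probability mu) LM tf).
Qed.

End Uniqueness.

(** * From mu to lambda *)

Section Sampling.
Variable R : realType.
Local Notation X := (itorus R).
Local Notation B := (borel_itorus R).

(** The torus is covered by finitely many boxes around points [flow s] with [s > t], and the sampler
    sends [z] to the [s] of the first box of the list that contains it. It is measurable as a finite
    case distinction over open sets. *)
Lemma flow_sampler (m : nat) (t : R) : exists p : {mfun B >-> R} * R,
  [/\ t + 1 <= p.2, forall z, t < p.1 z <= p.2 &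
      forall z : X, box z m m.+1%:R^-1 (flow (p.1 z))].
Proof.
pose U (s : {s : R | t < s}) : set X := box (flow (val s)) m m.+1%:R^-1.
have r0 : 0 < m.+1%:R^-1 :> R by rewrite invr_gt0.
have [l hl] : exists l : seq {s : R | t < s}, forall z, exists2 i, i \in l & U i z.
  apply: itorus_finite_cover => [i|z]; first exact: box_open.
  have [s ts hs] := flow_dense m r0 t z.
  by exists (exist _ s ts) => j jm; rewrite normcBC; exact: hs.
suff [theta [t' [mt tt' ht hb]]] : exists (theta : B -> R) t',
    [/\ measurable_fun setT theta, t + 1 <= t', forall z, t < theta z <= t' &
     forall z : X, (exists2 i, i \in l & U i z) -> box z m m.+1%:R^-1 (flow (theta z))].
  pose f : {mfun B >-> R} := HB.pack theta (isMeasurableFun.Build _ _ _ _ theta mt).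
  by exists (f, t'); split => // z; exact/hb/hl.
elim: {hl} l => [|s l [theta [t' [mt tt' ht hb]]]].
  (* This starting value is replaced at every point once the list covers the torus; as end of the
     window it forces length at least one. *)
  exists (fun=> t + 1), (t + 1); split => //.
    by move=> _; rewrite lexx ltrDl ltr01.
  by move=> z [].
exists (fun z => if `[< U s z >] then val s else theta z), (Num.max (val s) t'); split.
- apply: measurable_fun_ifT => //; apply: (@measurable_fun_bool _ _ _ _ true).
  rewrite setTI (_ : _ @^-1` _ = U s).
    exact: (@borel_open X (U s) (box_open _ _ _)).
  by apply/seteqP; split => z /=; [move/asboolP|move=> ?; apply/asboolP].
- by rewrite le_max tt' orbT.
- move=> z; rewrite le_max; case: asboolP => _; first by rewrite (valP s) lexx.
  by have /andP[-> ->] := ht z; rewrite orbT.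
- move=> z zU; case: asboolP => [Uz j jm|nU]; first by rewrite normcBC; exact: Uz.
  apply: hb; case: zU => i; rewrite inE => /predU1P[-> //|il Uz].
  by exists i.
Qed.

Lemma flow_samplers : exists (theta : nat -> {mfun B >-> R}) (tau : nat -> R),
  [/\ 0 <= tau 0%N, forall n, tau n + 1 <= tau n.+1,
      forall n z, tau n < theta n z <= tau n.+1 &
      forall n (z : X), box z n n.+1%:R^-1 (flow (theta n z))].
Proof.
have [S hS] := choice (fun mt : nat * R => flow_sampler mt.1 mt.2).
pose tau := fix tau n := if n is n'.+1 then (S (n', tau n')).2 else 0.
by exists (fun n => (S (n, tau n)).1), tau; split => // n; have [] := hS (n, tau n).
Qed.

Lemma cvg_box (w : nat -> X) (z : X) :
  (forall n, box z n n.+1%:R^-1 (w n)) -> w n @[n --> \oo] --> z.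
Proof.
move=> hw A /nbhs_itorusP[d [r [r0 dA]]].
have h1 : \forall n \near \oo, (d <= n)%N by exact: nbhs_infty_ge.
apply: filterS2 h1 (near_infty_natSinv_lt (PosNum r0)) => n dn nr.
by apply: dA => j jd; apply: lt_trans nr; apply: hw; exact: leq_trans dn.
Qed.

Section SampledMeasure.
Variables (mu : probability B R) (theta : nat -> {mfun B >-> R}) (tau : nat -> R).
Hypothesis tau0 : 0 <= tau 0%N.
Hypothesis tauS : forall n, tau n + 1 <= tau n.+1.
Hypothesis theta_tau : forall n z, tau n < theta n z <= tau n.+1.
Hypothesis theta_flow : forall n (z : X), box z n n.+1%:R^-1 (flow (theta n z)).

Definition sampled : {measure set R -> \bar R} :=
  mseries (fun n => distribution mu (theta n)) 0.

Lemma tau_mono m n : (m <= n)%N -> tau m <= tau n.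
Proof.
apply: (@homo_leq _ tau (fun x y => x <= y)) => [//|x y z|i]; first exact: le_trans.
by apply: le_trans (tauS i); rewrite lerDl.
Qed.

Lemma tau_nat n : n%:R <= tau n.
Proof.
elim: n => [//|n ih]; apply: le_trans (tauS n).
by rewrite -natr1 lerD2r.
Qed.

(** Samplers of index at least [N] never enter [D], so the series of pushforwards reduces to a
    finite sum. *)
Lemma sampled_integral (D : set R) (N : nat) (f : R -> \bar R) :
  measurable D -> (forall n z, (N <= n)%N -> ~ D (theta n z)) ->
  measurable_fun D f -> (forall t, 0 <= f t)%E ->
  (\int[sampled]_(t in D) f t =
   \sum_(0 <= n < N) \int[mu]_(z in theta n @^-1` D) f (theta n z))%E.
Proof.
move=> mD hD mf f0; rewrite ge0_integral_measure_series//.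
have E n : (\int[distribution mu (theta n)]_(t in D) f t =
    \int[mu]_(z in theta n @^-1` D) f (theta n z))%E.
  by rewrite ge0_integral_pushforward.
rewrite (nneseries_split 0 N) ?add0n; last by move=> n _; exact: integral_ge0.
rewrite [X in (_ + X)%E]eseries0 ?adde0; last first.
  move=> n Nn _; rewrite E (_ : _ @^-1` _ = set0) ?integral_set0//.
  by apply/seteqP; split => // z /(hD _ _ Nn).
by apply: eq_bigr => n _; exact: E.
Qed.

(** Since [n <= tau n], a bounded interval meets only finitely many windows, each of mass one. *)
Lemma sampled_locally_finite : locally_finite sampled.
Proof.
move=> x; exists `]x - 1, x + 1[%classic; split => //.
  by apply: near_in_itvoo; rewrite in_itv/= ltrBlDr !ltrDl ltr01.
rewrite -[X in (X < _)%E]mul1e -(integral_cst sampled (measurable_itv _)).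
rewrite (@sampled_integral _ (Num.bound `|x + 1|))//.
- apply/lte_sum_pinfty => n _.
  rewrite integral_cst ?mul1e.
    exact: (le_lt_trans (probability_le1 mu (measurable_funPTI _ (measurable_itv _))) (ltry _)).
  exact: measurable_funPTI.
- move=> n z nN; rewrite /= in_itv/= => /andP[_].
  apply/negP; rewrite -leNgt.
  have /andP[h _] := theta_tau n z; apply: le_trans (ltW h).
  apply: le_trans (tau_nat n); apply: le_trans (_ : (Num.bound `|x + 1|)%:R <= _).
    by rewrite (le_trans (ler_norm _))// ltW// archi_boundP.
  by rewrite ler_nat.
Qed.

(** The windows before [M] lie entirely in [[0, T]]; [q] is the contribution of the window that [T]
    cuts. *)
Lemma sampled_flow_integral (g : X -> R) (K T : R) (M : nat) :
  continuous g -> (forall z, 0 <= g z <= K) -> tau M < T -> T <= tau M.+1 ->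
  exists2 q, 0 <= q <= K & (\int[sampled]_(t in `[0%R, T]) (g (flow t))%:E =
    (\sum_(0 <= n < M) \int[mu]_z g (flow (theta n z)) + q)%:E)%E.
Proof.
move=> cg gK tT Tt.
have bg := continuous_bounded_borel cg gK.
have mg : measurable_fun setT (fun t : R => g (flow t)).
  exact: (measurableT_comp bg.1 (@measurable_flow R)).
have bh n : bounded_borel (fun z => g (flow (theta n z))).
  split; last by exists K => z; have /andP[h ?] := gK (flow (theta n z)); rewrite ger0_norm.
  exact: (measurableT_comp mg (measurable_funP (theta n))).
have mA : measurable (theta M @^-1` `[0, T]%classic) by exact: measurable_funPTI.
have ih n A : measurable A -> mu.-integrable A (EFin \o (fun z => g (flow (theta n z)))).
  by move=> mA'; apply: (integrableS measurableT) => //; exact: probability_integrable.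
exists (\int[mu]_(z in theta M @^-1` `[0, T]%classic) g (flow (theta M z))).
  apply/andP; split.
    by apply: Rintegral_ge0 => z _; have /andP[] := gK (flow (theta M z)).
  apply: (@le_trans _ _ (\int[mu]_(z in theta M @^-1` `[0, T]%classic) K)).
    apply: le_Rintegral => //; first exact: ih.
      by apply: (integrableS measurableT) => //; apply: probability_integrable;
        exact: bounded_borel_cst.
    by move=> z _; have /andP[] := gK (flow (theta M z)).
  rewrite Rintegral_cst// ler_piMr//.
    by have /andP[h1 h2] := gK point; exact: le_trans h2.
  by rewrite -lee_fin fineK ?fin_num_measure// probability_le1.
rewrite (@sampled_integral _ M.+1)//.
- rewrite big_nat_recr//= EFinD -sumEFin; congr (_ + _)%E.
    apply: eq_big_nat => n /andP[_ nM].
    have -> : theta n @^-1` `[0, T]%classic = setT.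
      apply/seteqP; split => // z _; rewrite /= in_itv/=.
      have /andP[h1 h2] := theta_tau n z; apply/andP; split.
        apply: le_trans (ltW h1); apply: le_trans tau0 _; exact: tau_mono.
      apply: (le_trans h2); apply: le_trans (ltW tT); exact: tau_mono.
    by rewrite /Rintegral fineK//; apply: integrable_fin_num => //; exact: ih.
  by rewrite /Rintegral fineK//; apply: integrable_fin_num => //; exact: ih.
- move=> n z Mn; rewrite /= in_itv/= => /andP[_]; apply/negP; rewrite -ltNge.
  have /andP[h _] := theta_tau n z; apply: le_lt_trans h.
  by apply: (le_trans Tt); exact: tau_mono.
- by apply/measurable_EFinP; exact: measurable_funTS.
- by move=> t; rewrite lee_fin; have /andP[] := gK (flow t).
Qed.

Lemma cvg_sample (g : X -> R) (K : R) : continuous g -> (forall z, 0 <= g z <= K) ->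
  \int[mu]_z g (flow (theta n z)) @[n --> \oo] --> \int[mu]_z g z.
Proof.
move=> cg gK; have bg := continuous_bounded_borel cg gK.
have mg : measurable_fun setT (fun t : R => g (flow t)).
  exact: (measurableT_comp bg.1 (@measurable_flow R)).
apply: fine_cvg; rewrite fineK; last first.
  by apply: integrable_fin_num => //; exact: probability_integrable.
apply: (@dominated_cvg _ _ _ mu setT measurableT
   (fun n z => (g (flow (theta n z)))%:E) (fun z => (g z)%:E) (fun=> K%:E)) => //.
- move=> n; apply/measurable_EFinP.
  exact: (measurableT_comp mg (measurable_funP (theta n))).
- move=> z _; apply: cvg_EFin; first by apply: nearW.
  apply: (@cvg_comp _ _ _ (fun n => flow (theta n z)) g _ (nbhs z)); last exact: cg.
  by apply: cvg_box => n; exact: theta_flow.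
- exact/(@probability_integrable _ _ mu (fun=> K))/bounded_borel_cst.
- move=> n z _; rewrite lee_fin ger0_norm; first by have /andP[] := gK (flow (theta n z)).
  by have /andP[] := gK (flow (theta n z)).
Qed.

End SampledMeasure.

End Sampling.

Section Cesaro.
Variable R : realType.

(** After multiplication by [M + p], half of [e * M] pays for the Cesaro error, and the other half
    absorbs the bounded terms [q] and [J * p]. *)
Lemma cesaro_perturbed (I : nat -> R) (J K e : R) : I n @[n --> \oo] --> J -> 0 < e ->
  exists M0, forall (M : nat) p q, (M0 <= M)%N -> 0 <= p <= 1 -> 0 <= q <= K ->
    `|J - (M%:R + p)^-1 * (\sum_(0 <= n < M) I n + q)| <= e.
Proof.
move=> IJ e0; have /cvgrPdist_le/(_ (e / 2)) := cesaro IJ.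
case; first by rewrite divr_gt0.
move=> M1 _ hM1.
(* [arithmetic_mean] at index [M] averages [M + 1] terms, hence the shift of [M1]. *)
exists (maxn M1.+1 (Num.bound `|(K + `|J|) / (e / 2)|)) => -[|M] p q; first by rewrite leqn0 -leqn0 geq_max.
rewrite geq_max ltnS => /andP[h1 h2] /andP[p0 p1] /andP[q0 qK].
have := hM1 M h1; rewrite /arithmetic_mean/= /series/=.
set S := \sum_(0 <= n < M.+1) I n => hS.
have Mp : 0 < M.+1%:R + p by rewrite ltr_wpDr.
have hK : K + `|J| <= e / 2 * M.+1%:R.
  rewrite mulrC -ler_pdivrMr ?divr_gt0//.
  apply: le_trans (_ : (Num.bound `|(K + `|J|) / (e / 2)|)%:R <= _); last by rewrite ler_nat.
  by rewrite (le_trans (ler_norm _))// ltW// archi_boundP.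
have hS' : `|J * M.+1%:R - S| <= e / 2 * M.+1%:R.
  have -> : J * M.+1%:R - S = (J - M.+1%:R^-1 * S) * M.+1%:R.
    by rewrite mulrBl mulrAC mulVf ?mul1r// pnatr_eq0.
  by rewrite normrM [X in _ * X]ger0_norm// ler_wpM2r.
have -> : J - (M.+1%:R + p)^-1 * (S + q) = (M.+1%:R + p)^-1 * ((J * M.+1%:R - S) + (J * p - q)).
  by rewrite -[X in X - _](mulKf (lt0r_neq0 Mp)) -mulrBr; congr (_ * _); ring.
rewrite normrM ger0_norm ?invr_ge0 ?(ltW Mp)// mulrC ler_pdivrMr//.
apply: (le_trans (ler_normD _ _)).
have hJ : `|J * p - q| <= K + `|J|.
  rewrite (le_trans (ler_normB _ _))// addrC normrM lerD//.
    by rewrite ger0_norm.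
  by rewrite [X in _ * X]ger0_norm// ler_piMr.
have : 0 <= e * p by rewrite mulr_ge0// ltW.
by lra.
Qed.

End Cesaro.

Section Realization.
Variable R : realType.
Local Notation X := (itorus R).
Local Notation B := (borel_itorus R).

Lemma sampled_mean_identity (mu : probability B R) :
  exists lambda : {measure set R -> \bar R}, locally_finite lambda /\
    forall a, dirichlet_algebra a -> mean_identity lambda mu a.
Proof.
have [theta [tau [tau0 tauS ht hb]]] := flow_samplers R.
pose lambda := sampled mu theta; exists lambda.
have lf : locally_finite lambda by exact: (sampled_locally_finite mu tau0 tauS ht).
split => // a aA; have foo T := locally_finite_itv T lf.
(* The least index [n] with [T <= tau n] is a successor, because [tau 0 <= tau M0 < T]. *)
have stage M0 T : tau M0 < T -> exists M, [/\ (M0 <= M)%N, tau M < T & T <= tau M.+1].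
  move=> MT; have [|[|M] hM mM] := @ex_minnP (fun n => T <= tau n).
  - exists (Num.bound `|T|); apply: le_trans (tau_nat tau0 tauS _).
    by rewrite (le_trans (ler_norm _))// ltW// archi_boundP.
  - by have := lt_le_trans MT (le_trans hM (tau_mono tauS (leq0n M0))); rewrite ltxx.
  - have TM : tau M < T by rewrite ltNge; apply/negP => /mM; rewrite ltnn.
    exists M; split => //; rewrite leqNgt; apply/negP => MM0.
    have := lt_le_trans MT (le_trans hM (tau_mono tauS MM0)); by rewrite ltxx.
(* The mass of [[0, T]] is the integral of the constant function 1, so the numerator and the
   normalisation share one computation. *)
have hmass M T : tau M < T -> T <= tau M.+1 ->
    exists2 p, 0 <= p <= 1 & lambda `[0%R, T]%classic = (M%:R + p)%:E.
  move=> tT Tt; have c1 : continuous (fun _ : X => 1 : R) by exact: cst_continuous.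
  have [z|p hp] := @sampled_flow_integral R mu theta tau tau0 tauS ht (fun=> 1) 1 T M c1 _ tT Tt.
    by rewrite ler01 lexx.
  rewrite integral_cst// mul1e => ->; exists p => //; congr (_ + _)%:E.
  rewrite (eq_bigr (fun=> 1)) ?sumr_const_nat ?subn0// => n _.
  exact: (mean_one (mean_probability mu)).
split.
  exists (tau 1%N); split; first exact: num_real.
  move=> T /stage[M [M1 tT Tt]]; have [p /andP[p0 _] ->] := hmass M T tT Tt.
  by rewrite lte_fin ltr_wpDr// ltr0n.
rewrite mean_probability_lift_sq//.
have -> : mean_square lambda a = EFin \o (fun T => flow_mean lambda T (lift_sq a)).
  by apply/funext => T; rewrite mean_squareE.
apply: cvg_EFin; first by apply: nearW.
have [K hK] := lift_sq_bounded aA.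
have cg := continuous_lift_sq aA.
have cI := cvg_sample (mu := mu) hb cg hK.
apply/cvgrPdist_le => e e0.
have [M0 hM0] := @cesaro_perturbed R _ _ K e cI e0.
exists (tau M0); split; first exact: num_real.
move=> T /stage[M [M1 tT Tt]]; have [p hp hl] := hmass M T tT Tt.
have [q hq hi] := @sampled_flow_integral R mu theta tau tau0 tauS ht _ K T M cg hK tT Tt.
by rewrite /= /flow_mean hl /Rintegral hi; exact: hM0.
Qed.

End Realization.

Theorem theorem4 (R : realType) :
  (forall mu : probability (borel_itorus R) R,
    exists lambda : {measure set R -> \bar R},
      locally_finite lambda /\
      forall a, dirichlet_algebra a -> mean_identity lambda mu a) /\
  (forall lambda : {measure set R -> \bar R},
    locally_finite lambda ->
    (forall a, dirichlet_algebra a ->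
      exists l : R, mean_square_cvg lambda a l%:E) ->
    exists mu : probability (borel_itorus R) R,
      (forall a, dirichlet_algebra a -> mean_identity lambda mu a) /\
      forall nu : probability (borel_itorus R) R,
        (forall a, dirichlet_algebra a -> mean_identity lambda nu a) ->
        forall B, measurable B -> nu B = mu B).
Proof.
split=> [mu|lambda lf hl]; first exact: sampled_mean_identity.
have [mu hmu] := limit_measure lf hl; exists mu; split=> // nu hnu B mB.
exact: (mean_identity_unique hmu hnu).
Qed.
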